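(* Let $N\ge 2$, let $\Omega\subset\mathbb{R}^N$ be a bounded domain, let $f\in L^1(\Omega)$, and let $u$ be a weak solution of $$-Q_N u=f(x)\ \text{ in }\Omega,\qquad u|_{\partial\Omega}=0 .$$ Put $\beta_N=N^{\frac{N}{N-1}}k^{\frac{1}{N-1}}$. Then for every $\delta\in(0,\beta_N)$, $$\int_\Omega \exp\left\{\frac{(\beta_N-\delta)\,|u(x)|}{\|f\|_{L^1(\Omega)}^{1/(N-1)}}\right\}dx\le \frac{\beta_N}{\delta}\,|\Omega| .$$
   Context: Let $N\ge 2$ and let $F:\mathbb{R}^N\to[0,\infty)$ be a fixed convex function of class $C^2(\mathbb{R}^N\setminus\{0\})$ with $F(t\xi)=|t|F(\xi)$ for all $t\in\mathbb{R}$, $\xi\in\mathbb{R}^N$, with $F(\xi)>0$ for $\xi\ne0$, and with $\mathrm{Hess}(F^2)$ positive definite in $\mathbb{R}^N\setminus\{0\}$. Write $F_{\xi_i}=\partial F/\partial\xi_i$ and $F_\xi=(F_{\xi_1},\dots,F_{\xi_N})$. The support function of $F$ is $F^0(x)=\sup_{\xi\in K}\langle x,\xi\rangle$, where $K=\{x\in\mathbb{R}^N:F(x)<1\}$, and $k=|\{x\in\mathbb{R}^N:F^0(x)\le 1\}|$ (Lebesgue measure). The $N$-anisotropic Laplacian is $$Q_N u=\sum_{i=1}^N\frac{\partial}{\partial x_i}\bigl(F^{N-1}(\nabla u)F_{\xi_i}(\nabla u)\bigr),$$ where $F^{N-1}F_\xi$ is taken to be $0$ at the origin. A weak solution of $-Q_Nu=g$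 in $\Omega$ is understood in the usual sense, $\int_\Omega F^{N-1}(\nabla u)\langle F_\xi(\nabla u),\nabla\varphi\rangle\,dx=\int_\Omega g\varphi\,dx$ for test functions $\varphi$, with boundary values taken in the Sobolev sense. $|\Omega|$ denotes Lebesgue measure. *)

(* Defs.v *)
From HB Require Import structures.
From mathcomp Require Import all_boot all_order all_algebra.
From mathcomp Require Import all_classical all_reals all_analysis.
Set Implicit Arguments.
Unset Strict Implicit.
Unset Printing Implicit Defensive.
Import Order.TTheory GRing.Theory Num.Theory.
Import numFieldNormedType.Exports.
Local Open Scope classical_set_scope.
Local Open Scope ring_scope.

(* 'rV[T]_n carries the product sigma-algebra, generated by the coordinates;
   for T = R this is the Borel sigma-algebra of R^n. *)
Definition measure_rV_display : measure_display -> measure_display.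
Proof. exact. Qed.

Section measurable_rV.
Context {d} {T : measurableType d} (n : nat).

Let coors : 'I_n -> 'rV[T]_n -> T := fun i x => x ord0 i.

Let rV_set0 : g_sigma_preimage coors set0.
Proof. exact: sigma_algebra0. Qed.

Let rV_setC A : g_sigma_preimage coors A -> g_sigma_preimage coors (~` A).
Proof. exact: sigma_algebraC. Qed.

Let rV_bigcup (F : _^nat) : (forall i, g_sigma_preimage coors (F i)) ->
  g_sigma_preimage coors (\bigcup_i (F i)).
Proof. exact: sigma_algebra_bigcup. Qed.

HB.instance Definition _ := @isMeasurable.Build (measure_rV_display d)
  'rV[T]_n (g_sigma_preimage coors) rV_set0 rV_setC rV_bigcup.

Lemma measurable_coor (i : 'I_n) :
  measurable_fun [set: 'rV[T]_n] (fun x : 'rV[T]_n => x ord0 i).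
Proof.
move=> _ Y mY; rewrite setTI; apply: sub_sigma_algebra => /=.
rewrite -bigcup_seq/=; exists i => /=; first by rewrite mem_index_enum.
by exists Y => //; rewrite setTI.
Qed.

Lemma measurable_fun_rV d1 (T1 : measurableType d1) (f : T1 -> 'rV[T]_n) :
  (forall i, measurable_fun [set: T1] (fun x => f x ord0 i)) ->
  measurable_fun [set: T1] f.
Proof.
move=> mf; suff H : g_sigma_preimage
    (fun i => (fun x : 'rV[T]_n => x ord0 i) \o f) `<=` measurable.
  rewrite g_sigma_preimage_comp in H.
  by move=> _ A mA; apply: H; exists A.
apply: smallest_sub; first exact: sigma_algebra_measurable.
rewrite -bigcup_seq => A [i _ [B mB <-]]; exact: mf.
Qed.

End measurable_rV.

Section lebesgue_rV.
Variable R : realType.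

Definition cons_rV n (p : measurableTypeR R * 'rV[R]_n) : 'rV[R]_n.+1 :=
  row_mx (p.1%:M : 'rV[R]_1) p.2.

Definition uncons_rV n (x : 'rV[R]_n.+1) : measurableTypeR R * 'rV[R]_n :=
  (x ord0 ord0, \row_i x ord0 (lift ord0 i)).

Lemma cons_rV0 n p : @cons_rV n p ord0 ord0 = p.1.
Proof.
rewrite /cons_rV (_ : (ord0 : 'I_n.+1) = lshift n (ord0 : 'I_1));
  last exact/val_inj.
by rewrite (row_mxEl (_ : 'rV_1)) mxE eqxx mulr1n.
Qed.

Lemma cons_rVS n p i : @cons_rV n p ord0 (lift ord0 i) = p.2 ord0 i.
Proof.
rewrite /cons_rV (_ : lift ord0 i = rshift 1 i); last exact/val_inj.
by rewrite (row_mxEr (_ : 'rV_1)).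
Qed.

Lemma cons_rVK n : cancel (@cons_rV n) (@uncons_rV n).
Proof.
move=> [t y]; rewrite /uncons_rV cons_rV0; congr pair.
by apply/rowP => i; rewrite mxE cons_rVS.
Qed.

Lemma uncons_rVK n : cancel (@uncons_rV n) (@cons_rV n).
Proof.
move=> x; apply/rowP => i; case: (unliftP ord0 i) => [j|] ->.
  by rewrite cons_rVS mxE.
by rewrite cons_rV0.
Qed.

Lemma measurable_cons_rV n :
  measurable_fun [set: measurableTypeR R * 'rV[R]_n] (@cons_rV n).
Proof.
apply: measurable_fun_rV => i; case: (unliftP ord0 i) => [j|] ->.
  under eq_fun do rewrite cons_rVS.
  exact: (measurableT_comp (measurable_coor j) measurable_snd).
under eq_fun do rewrite cons_rV0.
exact: measurable_fst.
Qed.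

Lemma measurable_uncons_rV n :
  measurable_fun [set: 'rV[R]_n.+1] (@uncons_rV n).
Proof.
apply: measurable_fun_pair; first exact: measurable_coor.
apply: measurable_fun_rV => i; under eq_fun do rewrite mxE.
exact: measurable_coor.
Qed.

Section step.
Variables (n : nat) (m : {sigma_finite_measure set 'rV[R]_n -> \bar R}).

Definition lebesgue_rV_step : set 'rV[R]_n.+1 -> \bar R :=
  pushforward (@lebesgue_measure R \x m)%E (@cons_rV n).

Let step0 : lebesgue_rV_step set0 = 0%E.
Proof. by rewrite /lebesgue_rV_step /pushforward preimage_set0 measure0. Qed.

Let step_ge0 A : (0 <= lebesgue_rV_step A)%E.
Proof. by rewrite /lebesgue_rV_step /pushforward measure_ge0. Qed.

Let step_sigma_additive : semi_sigma_additive lebesgue_rV_step.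
Proof.
move=> A mA tA mUA; rewrite /lebesgue_rV_step /pushforward preimage_bigcup.
apply: measure_semi_sigma_additive.
- by move=> k; rewrite -[X in measurable X]setTI; exact: measurable_cons_rV.
- apply/trivIsetP => /= i j _ _ ij; rewrite -preimage_setI.
  by move/trivIsetP : tA => /(_ _ _ _ _ ij) ->//; rewrite preimage_set0.
- rewrite -preimage_bigcup -[X in measurable X]setTI.
  exact: measurable_cons_rV.
Qed.

HB.instance Definition _ := isMeasure.Build _ _ _ lebesgue_rV_step
  step0 step_ge0 step_sigma_additive.

Let step_sigma_finite : sigma_finite [set: 'rV[R]_n.+1] lebesgue_rV_step.
Proof.
have /sigma_finiteP[A [TA ndA mA]] := sigma_finiteT (@lebesgue_measure R).
have /sigma_finiteP[B [TB ndB mB]] := sigma_finiteT m.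
exists (fun k => @uncons_rV n @^-1` (A k `*` B k)).
  apply/esym; rewrite -subTset => x _.
  have [i _ Ai] : (\bigcup_i A i) (uncons_rV x).1 by rewrite -TA.
  have [j _ Bj] : (\bigcup_i B i) (uncons_rV x).2 by rewrite -TB.
  exists (maxn i j) => //; split.
  - by move: Ai; exact/subsetPset/ndA/leq_maxl.
  - by move: Bj; exact/subsetPset/ndB/leq_maxr.
move=> k; have [mAk Ak] := mA k; have [mBk Bk] := mB k; split.
  rewrite -[X in measurable X]setTI.
  by apply: measurable_uncons_rV => //; exact: measurableX.
rewrite /lebesgue_rV_step /pushforward -comp_preimage.
rewrite (_ : _ \o _ = id) ?preimage_id; last first.
  by apply/funext => p /=; rewrite cons_rVK.
by rewrite product_measure1E// lte_mul_pinfty// ge0_fin_numE.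
Qed.

HB.instance Definition _ := Measure_isSigmaFinite.Build _ _ _ lebesgue_rV_step
  step_sigma_finite.

End step.

Fixpoint lebesgue_rV n : {sigma_finite_measure set 'rV[R]_n -> \bar R} :=
  match n with
  | 0 => \d_(0 : 'rV[R]_0)
  | k.+1 => lebesgue_rV_step (lebesgue_rV k)
  end.

End lebesgue_rV.

Section calculus.
Variables (R : realType) (n : nat).
Implicit Types (f g : 'rV[R]_n -> R) (x y : 'rV[R]_n) (D : set 'rV[R]_n).

Definition dotrV x y : R := \sum_(i < n) x ord0 i * y ord0 i.

Definition partial (i : 'I_n) f : 'rV[R]_n -> R :=
  fun x => 'D_(delta_mx ord0 i) f x.

Definition gradient f x : 'rV[R]_n := \row_i partial i f x.

Definition hessian f x : 'M[R]_n := \matrix_(i, j) partial j (partial i f) x.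

Definition posdef (A : 'M[R]_n) : Prop :=
  A^T = A /\ forall v : 'rV[R]_n, v != 0 -> 0 < (v *m A *m v^T) ord0 ord0.

(* partials s f = d_(s_1) (d_(s_2) ... f) for the multi-index s *)
Definition partials (s : seq 'I_n) f := foldr partial f s.

(* meant for D open *)
Definition Ck (k : nat) D f : Prop :=
  forall s : seq 'I_n, (size s <= k)%N -> forall x, D x ->
    {for x, continuous (partials s f)} /\
    ((size s < k)%N -> forall i, derivable (partials s f) x (delta_mx ord0 i)).

Definition test_function D f : Prop :=
  [/\ forall k, Ck k setT f,
      compact (closure [set x | f x != 0]) &
      closure [set x | f x != 0] `<=` D].

End calculus.

Section sobolev.
Variables (R : realType) (n : nat).
Implicit Types (Omega : set 'rV[R]_n) (p : R) (f u : 'rV[R]_n -> R).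
Implicit Types G : 'rV[R]_n -> 'rV[R]_n.
Local Notation mu := (lebesgue_rV R n).

Definition Lp_norm Omega p f : \bar R :=
  Lnorm mu p%:E (EFin \o (f \_ Omega)).

Definition in_Lp Omega p f : Prop :=
  measurable_fun Omega f /\ (Lp_norm Omega p f < +oo)%E.

Definition weak_gradient Omega u G : Prop :=
  forall (i : 'I_n) f, test_function Omega f ->
    \int[mu]_(x in Omega) (u x * partial i f x) =
    - \int[mu]_(x in Omega) (G x ord0 i * f x).

Definition sobolev1 Omega p u G : Prop :=
  [/\ in_Lp Omega p u,
      forall i, in_Lp Omega p (fun x => G x ord0 i) &
      weak_gradient Omega u G].

(* W_0^{1,p}(Omega) is the closure of C_c^oo(Omega) in W^{1,p}(Omega) *)
Definition sobolev1_0 Omega p u G : Prop :=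
  sobolev1 Omega p u G /\
  exists phi : nat -> 'rV[R]_n -> R,
    [/\ forall j, test_function Omega (phi j),
        Lp_norm Omega p (phi j \- u) @[j --> \oo] --> 0%E &
        forall i, Lp_norm Omega p
          (fun x => partial i (phi j) x - G x ord0 i) @[j --> \oo] --> 0%E].

End sobolev.

Section anisotropic.
Variables (R : realType) (N : nat).
Implicit Types (F : 'rV[R]_N -> R) (x xi : 'rV[R]_N).

Definition finsler_norm F : Prop :=
  [/\ [/\ forall xi, 0 <= F xi,
          forall (t : R) xi, F (t *: xi) = `|t| * F xi &
          forall xi, xi != 0 -> 0 < F xi],
      convex_function setT (F : 'rV[R]_N -> R^o),
      Ck 2 [set xi | xi != 0] F &
      forall xi, xi != 0 -> posdef (hessian (fun eta => F eta ^+ 2) xi)].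

Definition support_fun F x : R :=
  sup [set dotrV x xi | xi in [set xi | F xi < 1]].

Definition wulff_volume F : R :=
  fine (lebesgue_rV R N [set x | support_fun F x <= 1]).

Definition anisotropic_flux F xi : 'rV[R]_N :=
  if xi == 0 then 0 else F xi ^+ N.-1 *: gradient F xi.

(* The energy space W_0^{1,N} encodes both the finiteness of the Dirichlet
   energy and u = 0 on the boundary. The gradient is unique almost everywhere,
   so the choice of the representative gradu is immaterial. *)
Definition weak_solution F (Omega : set 'rV[R]_N) (f u : 'rV[R]_N -> R) : Prop :=
  exists gradu : 'rV[R]_N -> 'rV[R]_N,
    sobolev1_0 Omega N%:R u gradu /\
    forall phi, test_function Omega phi ->
      \int[lebesgue_rV R N]_(x in Omega)
        dotrV (anisotropic_flux F (gradu x)) (gradient phi x) =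
      \int[lebesgue_rV R N]_(x in Omega) (f x * phi x).

Definition beta_N F : R :=
  N%:R `^ (N%:R / (N%:R - 1)) * wulff_volume F `^ (N%:R - 1)^-1.

Definition bounded_domain (Omega : set 'rV[R]_N) : Prop :=
  [/\ Omega !=set0, open Omega, connected Omega & bounded_set Omega].

End anisotropic.

(* Main.v *)
(* Testing the equation with smooth odd truncations of u bounds the energy of u on
   a level band by int_(a <= |u| <= b) F(grad u)^N <= (b - a) |f|_1.  The Wulff
   isoperimetric inequality bounds int_(a < |u| < b) F(grad u) from below by
   N k^(1/N) (b - a) mu(b)^((N-1)/N), where mu(t) = |{|u| > t}|.  For a test function
   phi it comes from Brunn-Minkowski: {|phi| > s} + h K, with K the polar ball, lies
   in {|phi| + h (F(grad phi) + o(1)) > s}, so the layer-cake formula turns the growth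
   of the superlevel sets into a lower bound for the integral of F(grad phi).  By
   Young's inequality the two estimates give (1 + c (b - a)) mu(b) <= mu(a) with
   c = beta_N / |f|_1^(1/(N-1)), whence mu(t) <= |Omega| exp(- c t), and the layer-cake
   formula for exp gives the theorem. *)
Require Import Defs.
From mathcomp Require Import all_boot all_order all_algebra.
From mathcomp Require Import all_classical all_reals all_analysis.
From mathcomp Require Import ring lra measurable_realfun.
Import Order.TTheory GRing.Theory Num.Theory.
Import numFieldNormedType.Exports.
Local Open Scope classical_set_scope.
Local Open Scope ring_scope.
Set Implicit Arguments.
Unset Strict Implicit.
Unset Printing Implicit Defensive.

(** * Lebesgue measure and the Brunn-Minkowski inequality *)

(** The equation may be tested with compactly supported smooth functions only, and f is merely
    integrable, so truncations of u are not admissible themselves. A smooth function vanishing at 0,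
    composed with smooth approximants of u, is admissible, and dominated convergence carries the
    identity to u; the flux of u stays fixed meanwhile, so no convergence of fluxes is needed. The
    isoperimetric bound reaches u through continuous cut-offs, because the level sets of the
    approximants need not converge to those of u. Neither a coarea formula nor a differential
    inequality for mu occurs: all bands have finite width, and each approximation costs a factor q <
    1 or a term eps that is removed at the end. The step inequality is iterated n times with width t
    / n, which gives mu(t) <= |Omega| (1 + c t / n)^(-n). The constant c is what the best parameter
    in Young's inequality yields, in the form c^(N-1) |f|_1 = N^N k. With alpha = (beta_N - delta) /
    |f|_1^(1/(N-1)) the last integration gives c / (c - alpha) = beta_N / delta. *)

Lemma lebesgue_rVS (R : realType) n (A : set 'rV[R]_n.+1) :
  lebesgue_rV R n.+1 A =
  (\int[lebesgue_measure]_t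
     lebesgue_rV R n [set y | A (cons_rV (t, y))])%E.
Proof.
rewrite /= /lebesgue_rV_step /pushforward /= /product_measure1 /=.
apply: eq_integral => t _ /=; congr (_ _).
by apply/seteqP; split => y /=; rewrite /xsection /= inE.
Qed.

Lemma measurable_slice (R : realType) n (A : set 'rV[R]_n.+1) (t : R) :
  measurable A -> measurable [set y : 'rV[R]_n | A (cons_rV (t, y))].
Proof.
move=> mA; rewrite (_ : mkset _ = xsection (@cons_rV R n @^-1` A) t); last first.
  by apply/seteqP; split => y /=; rewrite /xsection /= inE.
apply: measurable_xsection; rewrite -[X in measurable X]setTI.
exact: measurable_cons_rV.
Qed.

Definition slice_measure (R : realType) n (A : set 'rV[R]_n.+1)
    (t : measurableTypeR R) : \bar R :=
  lebesgue_rV R n [set y : 'rV[R]_n | A (cons_rV (t, y))].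

Lemma measurable_slice_measure (R : realType) n (A : set 'rV[R]_n.+1) :
  measurable A -> measurable_fun [set: measurableTypeR R] (slice_measure A).
Proof.
move=> mA.
have mA' : measurable (@cons_rV R n @^-1` A).
  by rewrite -[X in measurable X]setTI; exact: measurable_cons_rV.
have := measurable_fun_xsection (lebesgue_rV R n) mA'.
congr (measurable_fun _ _); apply/funext => t /=; congr (_ _).
by apply/seteqP; split => y /=; rewrite /xsection /= inE.
Qed.

(** Uniqueness of Lebesgue measure: r times its pushforward under the affine map has the right value
    on half-open intervals. *)
Lemma lebesgue_measure_affine (R : realType) (r b : R) (A : set R) : 0 < r ->
  measurable A ->
  lebesgue_measure ((fun x => r * x + b) @^-1` A) = (r^-1%:E * lebesgue_measure A)%E.
Proof.
move=> r0 mA.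
have mf : measurable_fun [set: measurableTypeR R]
    ((fun x => r * x + b) : measurableTypeR R -> measurableTypeR R).
  by apply: measurable_funD => //; exact: measurable_funM.
have r_ge0 : 0 <= r by exact: ltW.
pose m := mscale (NngNum r_ge0)
  (measure_function_pushforward__canonical__measure_function_Measure
    (@lebesgue_measure R) mf).
rewrite (@lebesgue_measure_unique R m _ A mA).
  rewrite /m /mscale /= muleA -EFinM mulVf ?gt_eqF// mul1e//.
move=> X /ocitvP[->|[[x y] /= xy ->]]; first by rewrite !measure0.
rewrite /m /mscale /= /pushforward.
have -> : (fun x0 => r * x0 + b) @^-1` `]x, y] = `](x-b)/r,(y-b)/r]%classic.
  by apply/seteqP; split => z /=;
    rewrite !in_itv /= ltr_pdivrMr ?ler_pdivlMr // ltrBlDr lerBrDr (mulrC r).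
rewrite !lebesgue_measure_itv /= !lte_fin ltr_pM2r ?invr_gt0 // ltrD2r xy -!EFinB
  -EFinM; congr EFin.
by field; rewrite gt_eqF.
Qed.

Lemma lebesgue_measure_shift (R : realType) (b : R) (A : set R) :
  measurable A -> lebesgue_measure [set x | A (x + b)] = lebesgue_measure A.
Proof.
move=> mA; rewrite -[RHS]mul1e -(@invr1 R) -(lebesgue_measure_affine b ltr01 mA).
by congr (lebesgue_measure _); apply/seteqP; split => x /=; rewrite mul1r.
Qed.

Lemma measurable_shift (R : realType) (b : R) (A : set R) :
  measurable A -> measurable [set x | A (x + b)].
Proof.
move=> mA; rewrite -[X in measurable X]setTI.
have : measurable_fun [set: R] (fun x : R => x + b) by exact: measurable_funD.
exact.
Qed.

(* V + min W and max V + W overlap in one point only. *)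
Lemma brunn_minkowski_compact (R : realType) (V W C : set R) :
  compact V -> compact W -> V !=set0 -> W !=set0 -> measurable C ->
  (forall v w, V v -> W w -> C (v + w)) ->
  (lebesgue_measure V + lebesgue_measure W <= lebesgue_measure C)%E.
Proof.
move=> cV cW V0 W0 mC VWC.
have cid (A : set R) : {within A, continuous (id : R -> R)}.
  by apply: continuous_subspaceT => x.
have [a aV maxV] := compact_EVT_max V0 cV (cid _).
have [b bW minW] := compact_EVT_min W0 cW (cid _).
rewrite !inE in aV bW.
have mV := compact_measurable cV; have mW := compact_measurable cW.
rewrite -(lebesgue_measure_shift (- b) mV) -(lebesgue_measure_shift (- a) mW).
set V' := mkset _; set W' := mkset _.
have mV' : measurable V' by exact: measurable_shift.
have mW' : measurable W' by exact: measurable_shift.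
have mW1 : measurable (W' `\` [set a + b]) by exact: measurableD.
have -> : lebesgue_measure W' = lebesgue_measure (W' `\` [set a + b]).
  have WE : W' = (W' `\` [set a + b]) `|` [set a + b].
    rewrite setDE setUIl setUCl setIT; apply/seteqP; split => x; first by left.
    by case=> // ->; rewrite /W' /= addrC addKr.
  rewrite [in LHS]WE measureU//.
    by rewrite [X in (_ + X)%E](_ : _ = 0%E) ?adde0 //; exact: lebesgue_measure_set1.
  by apply/seteqP; split => x //= [[]].
rewrite -measureU//; last first.
  apply/seteqP; split => x //= -[Vx [Wx]].
  have := maxV (x - b) (mem_set (Vx : V _));
    have := minW (x - a) (mem_set (Wx : W _)) => /= h1 h2.
  by apply; apply: le_anti; lra.
apply: le_measure; rewrite ?inE//; first exact: measurableU.
move=> x [Vx|[Wx _]].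
  by rewrite -(subrK b x); apply: VWC.
by rewrite -(subrK a x) addrC; apply: VWC.
Qed.

(** Inner regularity reduces the claim to compact subsets. The two sets are exhausted one after the
    other, so that each supremum is taken with a finite second summand. *)
Lemma brunn_minkowski1 (R : realType) (A B C : set R) :
  measurable A -> measurable B -> measurable C -> A !=set0 -> B !=set0 ->
  (forall a b, A a -> B b -> C (a + b)) ->
  (lebesgue_measure A + lebesgue_measure B <= lebesgue_measure C)%E.
Proof.
move=> mA mB mC [a0 Aa0] [b0 Bb0] ABC.
have key (V W : set R) : compact V -> compact W -> V `<=` A -> W `<=` B ->
    (lebesgue_measure V + lebesgue_measure W <= lebesgue_measure C)%E.
  move=> cV cW VA WB.
  have c1 (x : R) : compact [set x] by exact: compact_set1.
  (* Compact subsets of A and B may be empty; adding one point of A and one of B makes the compact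
     case applicable. *)
  have cV' := compactU cV (c1 a0); have cW' := compactU cW (c1 b0).
  apply: (@le_trans _ _ (lebesgue_measure (V `|` [set a0]) +
    lebesgue_measure (W `|` [set b0]))%E).
    by apply: leeD; apply: le_measure; rewrite ?inE //;
      try exact: compact_measurable; exact: subsetUl.
  apply: brunn_minkowski_compact => //; [by exists a0; right|by exists b0; right|].
  by move=> v w [/VA Av|->] [/WB Bw|->]; exact: ABC.
have [Coo|Coo] := eqVneq (lebesgue_measure C) +oo%E; first by rewrite [leRHS]Coo leey.
have Cfin : lebesgue_measure C \is a fin_num by rewrite ge0_fin_numE // ltey.
have cpt0 : compact (@set0 R) by exact: compact0.
have finK (V : set R) : compact V -> lebesgue_measure V \is a fin_num.
  by move=> cV; rewrite ge0_fin_numE //; exact: compact_finite_measure.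
have keyA W : compact W -> W `<=` B ->
    (lebesgue_measure A + lebesgue_measure W <= lebesgue_measure C)%E.
  move=> cW WB; rewrite -leeBrDr ?finK//.
  rewrite (lebesgue_regularity_inner_sup mA); apply: ge_ereal_sup => _ [V [cV VA] <-].
  by rewrite leeBrDr ?finK//; exact: key.
have Afin : lebesgue_measure A \is a fin_num.
  rewrite ge0_fin_numE //; apply: (@le_lt_trans _ _ (lebesgue_measure C));
    last by rewrite ltey.
  by have := keyA _ cpt0 (@sub0set _ B); rewrite measure0 adde0.
rewrite addeC -leeBrDr// (lebesgue_regularity_inner_sup mB).
by apply: ge_ereal_sup => _ [W [cW WB] <-]; rewrite leeBrDr// addeC; exact: keyA.
Qed.

(** * The layer-cake formula *)

Lemma measurable_subgraph d (T : measurableType d) (R : realType) (v w : T -> R) :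
  measurable_fun setT v -> measurable_fun setT w ->
  measurable [set z : T * measurableTypeR R | v z.1 <= z.2 < w z.1].
Proof.
move=> mv mw.
have m1 (g : T -> R) : measurable_fun setT g ->
    measurable_fun [set: T * measurableTypeR R] (fun z => g z.1).
  by move=> mg; exact: measurableT_comp mg measurable_fst.
have m2 : measurable_fun [set: T * measurableTypeR R] (fun z => z.2 : R).
  exact: measurable_snd.
have h1 : measurable [set z : T * measurableTypeR R | v z.1 <= z.2].
  rewrite -[X in measurable X]setTI.
  exact: (measurable_fun_ler (m1 _ mv) m2).
have h2 : measurable [set z : T * measurableTypeR R | z.2 < w z.1].
  rewrite -[X in measurable X]setTI.
  exact: (measurable_fun_ltr m2 (m1 _ mw)).
rewrite (_ : mkset _ = [set z : T * measurableTypeR R | v z.1 <= z.2] `&`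
  [set z : T * measurableTypeR R | z.2 < w z.1]).
  exact: measurableI.
by apply/seteqP; split => z /= => [/andP[]//|[-> ->]].
Qed.

Section layer_cake.
Context d (T : measurableType d) (R : realType).
Variables (m : {sigma_finite_measure set T -> \bar R}) (v w : T -> R) (rho : R -> R).
Hypotheses (mv : measurable_fun setT v) (mw : measurable_fun setT w).
Hypotheses (mr : measurable_fun setT rho) (r0 : forall s, 0 <= rho s).

Let S := [set z : T * measurableTypeR R | v z.1 <= z.2 < w z.1].
Let f (z : T * measurableTypeR R) : \bar R := ((rho z.2)%:E * (\1_S z)%:E)%E.

Let mf : measurable_fun setT f.
Proof.
have mS : measurable S by exact: measurable_subgraph.
apply: emeasurable_funM; apply/measurable_EFinP.
  exact: (measurableT_comp mr measurable_snd).
exact: measurable_indic.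
Qed.

Let f0 z : (0 <= f z)%E. Proof. by rewrite mule_ge0 ?lee_fin. Qed.

Let innerE x : (\int[lebesgue_measure]_s f (x, s) =
  \int[lebesgue_measure]_(s in `[v x, w x[) (rho s)%:E)%E.
Proof.
rewrite [RHS]integral_mkcond /=; apply: eq_integral => s _ /=.
rewrite /f /= patchE indicE; case: ifPn => h.
  by move: h; rewrite inE/= in_itv /= => h; rewrite mem_set ?mule1.
rewrite memNset ?mule0 // => h1; move/negP: h; apply; rewrite inE /= in_itv /=; exact: h1.
Qed.

Let outerE s : (\int[m]_x f (x, s) = (rho s)%:E * m [set x | (v x <= s < w x)%R])%E.
Proof.
have mSx : measurable [set x0 | v x0 <= s < w x0].
  have -> : [set x0 | v x0 <= s < w x0] = ysection S s.
    by apply/seteqP; split => y; rewrite /ysection /= inE.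
  by apply: measurable_ysection; exact: measurable_subgraph.
have SE y : \1_S (y, s) = \1_[set x0 | v x0 <= s < w x0] y :> R.
  by rewrite !indicE; congr ((_ : bool)%:R); apply/idP/idP; rewrite !inE.
rewrite /f /=; under eq_integral do rewrite SE.
rewrite ge0_integralZl //.
- by rewrite integral_indic// setIT.
- by apply/measurable_EFinP; exact: measurable_indic.
- by rewrite lee_fin.
Qed.

(** Tonelli's theorem for the density rho on the region between the graphs of v and w. With v = 0 it
    is the usual layer-cake formula; with w a small enlargement of v it converts the growth of
    superlevel sets into the integral of w - v. *)
Lemma layer_cake :
  (\int[m]_x \int[lebesgue_measure]_(s in `[v x, w x[) (rho s)%:E =
   \int[lebesgue_measure]_s ((rho s)%:E * m [set x | (v x <= s < w x)%R]))%E.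
Proof.
have := @fubini_tonelli _ _ _ _ _ m (@lebesgue_measure R) f mf f0.
congr (_ = _); apply: eq_integral => x _; [exact: innerE|exact: outerE].
Qed.

Lemma measurable_layer_inner : measurable_fun setT
  (fun x => \int[lebesgue_measure]_(s in `[v x, w x[) (rho s)%:E)%E.
Proof.
have := measurable_fun_fubini_tonelli_F (m2 := @lebesgue_measure R) f mf f0.
by apply: eq_measurable_fun => x _; rewrite /fubini_F innerE.
Qed.

Lemma measurable_layer_outer : measurable_fun [set: measurableTypeR R]
  (fun s => (rho s)%:E * m [set x | (v x <= s < w x)%R])%E.
Proof.
have := measurable_fun_fubini_tonelli_G (m1 := m) f mf f0.
by apply: eq_measurable_fun => s _; rewrite /fubini_G outerE.
Qed.

End layer_cake.

(** * Bounded sets, dilations and the n-dimensional inequality *)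

Lemma lebesgue_rV_box_le (R : realType) n (r : R) (A : set 'rV[R]_n) : 0 <= r ->
  measurable A -> (forall x, A x -> forall i, `|x ord0 i| <= r) ->
  (lebesgue_rV R n A <= ((r *+ 2) ^+ n)%:E)%E.
Proof.
move=> r0; elim: n A => [A _ _|n IH A mA Ar].
  by rewrite /= diracE expr0 lee_fin lern1 leq_b1.
rewrite lebesgue_rVS.
apply: (@le_trans _ _ (\int[lebesgue_measure]_(t in `[(-r)%R, r])
  (((r *+ 2) ^+ n)%:E))%E).
  rewrite [leRHS]integral_mkcond; apply: ge0_le_integral => //.
  - exact: measurable_slice_measure.
  - by apply/(measurable_restrictT _ _).1 => //; exact: measurable_itv.
  move=> t _; rewrite patchE; case: ifPn => tr.
    apply: IH; first exact: measurable_slice.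
    by move=> y /Ar Ay i; have := Ay (lift ord0 i); rewrite cons_rVS.
  rewrite (_ : mkset _ = set0) ?measure0//.
  apply/seteqP; split => y //= /Ar /(_ ord0); rewrite cons_rV0 /= => tr'.
  by move/negP: tr; apply; rewrite inE /= in_itv /= -ler_norml.
rewrite integral_cst//= lebesgue_measure_itv /=.
case: ifPn => _; rewrite ?mule0 ?lee_fin ?exprn_ge0 ?mulrn_wge0//.
by rewrite opprK exprSr mulr2n.
Qed.

Lemma ge0_integral_scale (R : realType) (r : R) (g : measurableTypeR R -> \bar R) :
  0 < r -> measurable_fun setT g -> (forall t, 0 <= g t)%E ->
  (\int[lebesgue_measure]_t g (r * t)%R = r^-1%:E * \int[lebesgue_measure]_t g t)%E.
Proof.
move=> r0 mg g0.
have mf : measurable_fun [set: measurableTypeR R]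
    ((fun x => r * x) : measurableTypeR R -> measurableTypeR R).
  exact: measurable_funM.
have ri0 : 0 <= r^-1 by rewrite invr_ge0 ltW.
have := @ge0_integral_pushforward _ _ _ _ R _ mf (@lebesgue_measure R) setT g
  measurableT mg (fun y _ => g0 y).
rewrite preimage_setT => <-.
rewrite -(@ge0_integral_mscale _ _ R (@lebesgue_measure R) _ measurableT (NngNum ri0)) //.
apply: eq_measure_integral => A mA _ /=.
rewrite /mscale/= -(lebesgue_measure_affine 0 r0 mA) /pushforward.
by congr (lebesgue_measure _); apply/seteqP; split => x /=; rewrite addr0.
Qed.

Lemma cons_rV_scale (R : realType) n (r t : R) (y : 'rV[R]_n) :
  cons_rV (r * t, r *: y) = r *: cons_rV (t, y).
Proof.
apply/rowP => i; rewrite [RHS]mxE; case: (unliftP ord0 i) => [j|] ->.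
  by rewrite !cons_rVS mxE.
by rewrite !cons_rV0.
Qed.

Lemma measurable_scale_rV (R : realType) n (r : R) (A : set 'rV[R]_n) :
  measurable A -> measurable [set x | A (r *: x)].
Proof.
move=> mA; have : measurable_fun setT (fun x : 'rV[R]_n => r *: x).
  apply: measurable_fun_rV => i; under eq_fun do rewrite mxE.
  by apply: measurable_funM => //; exact: measurable_coor.
by move=> /(_ measurableT _ mA); rewrite setTI.
Qed.

Lemma lebesgue_rV_scale (R : realType) n (r : R) (A : set 'rV[R]_n) : 0 < r ->
  measurable A ->
  lebesgue_rV R n [set x | A (r *: x)] = ((r^-1 ^+ n)%:E * lebesgue_rV R n A)%E.
Proof.
move=> r0; elim: n A => [A mA|n IH A mA].
  rewrite expr0 mul1e; congr (lebesgue_rV R 0 _).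
  by apply/seteqP; split => x /=; rewrite (thinmx0 (r *: x)) (thinmx0 x).
rewrite !lebesgue_rVS exprSr EFinM -muleA -ge0_integral_scale//.
- rewrite -ge0_integralZl//.
  + apply: eq_integral => t _; rewrite -IH; last exact: measurable_slice.
    congr (lebesgue_rV R n _).
    by apply/seteqP; split => y /=; rewrite cons_rV_scale.
  + have mf : measurable_fun [set: measurableTypeR R]
      ((fun x => r * x) : measurableTypeR R -> measurableTypeR R).
      exact: measurable_funM.
    exact: (measurableT_comp (measurable_slice_measure mA) mf).
  + by rewrite lee_fin exprn_ge0 // invr_ge0 ltW.
- exact: measurable_slice_measure.
Qed.

(** The graph of a power lies above its tangent at Z; in the induction the surplus is (m+1) Z^m (X -
    Z)^2. This one inequality supplies the Hoelder, Bernoulli and Young inequalities used below. *)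
Lemma pow_tangent (R : realFieldType) (X Z : R) m : 0 <= X -> 0 <= Z ->
  Z ^+ m.+1 + m.+1%:R * Z ^+ m * (X - Z) <= X ^+ m.+1.
Proof.
move=> X0 Z0; elim: m => [|m IH]; first by rewrite !expr1 expr0; lra.
have := ler_wpM2l X0 IH; rewrite -exprS; apply: le_trans.
rewrite -subr_ge0 [X in 0 <= X](_ : _ = m.+1%:R * Z ^+ m * (X - Z) ^+ 2).
  by rewrite mulr_ge0 ?sqr_ge0// mulr_ge0// exprn_ge0.
by rewrite !exprS -[m.+2%:R]natr1; ring.
Qed.

(** Jensen's inequality for the power n+1 at the points x/P and y/Q with weights P and Q: in the
    weighted sum of the two tangents at the mean Z = (x+y)/(P+Q) the linear terms cancel. *)
Lemma pow_hoelder (R : realFieldType) (x y P Q : R) n :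
  0 < x -> 0 < y -> 0 < P -> 0 < Q ->
  (x + y) ^+ n.+1 <= (P + Q) ^+ n * (x ^+ n.+1 / P ^+ n + y ^+ n.+1 / Q ^+ n).
Proof.
move=> x0 y0 P0 Q0; set Z := (x + y) / (P + Q).
have Z0 : 0 <= Z by rewrite divr_ge0 // ltW // addr_gt0.
have PQ0 : P + Q != 0 by rewrite gt_eqF // addr_gt0.
have hx := @pow_tangent _ (x / P) Z n (divr_ge0 (ltW x0) (ltW P0)) Z0.
have hy := @pow_tangent _ (y / Q) Z n (divr_ge0 (ltW y0) (ltW Q0)) Z0.
have -> : (x + y) ^+ n.+1 = (P + Q) ^+ n * ((P + Q) * Z ^+ n.+1).
  by rewrite mulrA -exprSr -exprMn /Z mulrC divfK.
rewrite ler_pM2l ?exprn_gt0 ?addr_gt0 //.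
have e (u U : R) : 0 < U -> u ^+ n.+1 / U ^+ n = U * (u / U) ^+ n.+1.
  by move=> U0; rewrite expr_div_n [U ^+ n.+1]exprS; field; rewrite !expf_neq0 ?gt_eqF.
rewrite !e //.
have := lerD (ler_wpM2l (ltW P0) hx) (ler_wpM2l (ltW Q0) hy).
apply: le_trans; rewrite le_eqVlt; apply/orP; left; apply/eqP.
have zE : (P + Q) * Z = x + y by rewrite /Z mulrC divfK.
have pE : P * (x / P) = x by rewrite mulrC divfK // gt_eqF.
have qE : Q * (y / Q) = y by rewrite mulrC divfK // gt_eqF.
transitivity ((P + Q) * Z ^+ n.+1 + n.+1%:R * Z ^+ n * (P * (x/P) + Q * (y / Q)
  - (P + Q) * Z)).
  by rewrite pE qE zE; ring.
by ring.
Qed.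

Lemma layer_cake01 (R : realType) (w : measurableTypeR R -> R) :
  measurable_fun setT w -> (forall x, 0 <= w x <= 1) ->
  (\int[lebesgue_measure]_x (w x)%:E =
   \int[lebesgue_measure]_(s in `]0%R, 1%R[) lebesgue_measure [set x | (s < w x)%R])%E.
Proof.
move=> mw w01.
have := @layer_cake _ _ R (@lebesgue_measure R) (cst 0) w (\1_(`]0, 1[%classic)).
move=> /(_ (measurable_cst _) mw) /= H.
have {}H := H (measurable_indic (measurable_itv `]0, 1[)) (fun s => ler0n _ _).
transitivity (\int[lebesgue_measure]_x
     \int[lebesgue_measure]_(s in `[0%R, w x[) ((\1_(`]0, 1[%classic) s)%:E : \bar R))%E.
  apply: eq_integral => x _; rewrite integral_indic //.
  have /andP[w0 w1] := w01 x.
  rewrite (_ : _ `&` _ = `]0, w x[%classic); last first.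
    apply/seteqP; split => s /=; rewrite !in_itv /=.
      by move=> [/andP[-> _] /andP[_ ->]].
    by move=> /andP[s0 sw]; rewrite s0 sw ltW //= (lt_le_trans sw).
  have := @lebesgue_measure_itv R `]0, w x[ => /= itvE; rewrite [RHS]itvE lte_fin.
  case: ltP => h; first by rewrite sube0.
  by congr EFin; apply: le_anti; rewrite w0 h.
rewrite H [RHS]integral_mkcond; apply: eq_integral => s _.
rewrite patchE indicE; case: ifPn => h; last by rewrite mul0e.
rewrite mul1e; congr (lebesgue_measure _); apply/seteqP; split => x /=.
  by case/andP.
by move: h; rewrite inE /= in_itv /= => /andP[/ltW -> _] ->.
Qed.

Lemma cons_rV_add (R : realType) n (s t : R) (x y : 'rV[R]_n) :
  cons_rV (s, x) + cons_rV (t, y) = cons_rV (s + t, x + y).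
Proof.
apply/rowP => i; rewrite mxE; case: (unliftP ord0 i) => [j|] ->.
  by rewrite !cons_rVS mxE.
by rewrite !cons_rV0.
Qed.

Lemma exists_root (R : realType) n (a : R) : (0 < n)%N -> 0 < a ->
  exists2 p : R, 0 < p & p ^+ n = a.
Proof.
move=> n0 a0; exists (a `^ (n%:R^-1)); first exact: powR_gt0.
by rewrite -powR_mulrn ?powR_ge0// -powRrM mulVf ?powRr1 ?ltW// pnatr_eq0 -lt0n.
Qed.

(** The space ['rV_0] is one point carrying a Dirac mass, so the slices of A have measure 0 or 1 and
    dimension one reduces to the real line. *)
Lemma lebesgue_rV1 (R : realType) (A : set 'rV[R]_1) : measurable A ->
  exists2 A' : set R, measurable A' & lebesgue_rV R 1 A = lebesgue_measure A' /\
    forall t, A' t <-> A (cons_rV (t, 0)).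
Proof.
move=> mA;
pose A' : set (measurableTypeR R) := [set t | A (cons_rV (t, 0))].
have mA' : measurable A'.
  have m0 : measurable_fun [set: measurableTypeR R] (fun t => @cons_rV R 0 (t, 0)).
    apply: (measurableT_comp (@measurable_cons_rV R 0)).
    exact: measurable_fun_pair.
  by have := m0 measurableT _ mA; rewrite setTI.
exists A' => //; split=> //; rewrite lebesgue_rVS.
transitivity (\int[lebesgue_measure]_t (\1_A' t)%:E)%E;
  last by rewrite integral_indic // setIT.
apply: eq_integral => t _; rewrite /= diracE indicE.
by congr ((_ : bool)%:R%:E); apply/idP/idP; rewrite !inE.
Qed.

(** Boundedness makes the slice measures real-valued with a finite supremum, so that they can be
    normalized in R. *)
Lemma slice_measureE (R : realType) n (r : R) (A : set 'rV[R]_n.+1) : 0 <= r ->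
  measurable A -> (forall x, A x -> forall i, `|x ord0 i| <= r) ->
  exists a : measurableTypeR R -> R,
  [/\ measurable_fun setT a,
      forall t, 0 <= a t <= (r *+ 2) ^+ n,
      forall t, slice_measure A t = (a t)%:E &
      lebesgue_rV R n.+1 A = (\int[lebesgue_measure]_t (a t)%:E)%E].
Proof.
move=> r0 mA Ar.
have bnd t : (slice_measure A t <= ((r *+ 2) ^+ n)%:E)%E.
  apply: lebesgue_rV_box_le => //; first exact: measurable_slice.
  by move=> y /Ar Ay i; have := Ay (lift ord0 i); rewrite cons_rVS.
have fin t : slice_measure A t \is a fin_num.
  by rewrite ge0_fin_numE ?measure_ge0//; apply: le_lt_trans (bnd t) (ltry _).
have E t : slice_measure A t = (fine (slice_measure A t))%:E by rewrite fineK.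
exists (fun t => fine (slice_measure A t)); split => //.
- exact: (measurableT_comp (fine_measurable measurableT) (measurable_slice_measure mA)).
- move=> t; rewrite fine_ge0 /=; last exact: measure_ge0.
  by rewrite -lee_fin -E.
- by rewrite lebesgue_rVS; apply: eq_integral => t _; exact: E.
Qed.

(** The radii x and y stand for the n-th roots of the measures, and their positivity rules out empty
    sets. The induction slices along the first coordinate; the one-dimensional case is a base of its
    own because the step combines it with the inequality for the slices. *)
Lemma brunn_minkowski_bounded (R : realType) n (r : R) (A B C : set 'rV[R]_n) (x y : R) :
  0 <= r -> measurable A -> measurable B -> measurable C ->
  (forall z, A z -> forall i, `|z ord0 i| <= r) ->
  (forall z, B z -> forall i, `|z ord0 i| <= r) ->
  (forall z, C z -> forall i, `|z ord0 i| <= r) ->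
  (forall a b, A a -> B b -> C (a + b)) ->
  0 < x -> 0 < y ->
  ((x ^+ n)%:E <= lebesgue_rV R n A)%E -> ((y ^+ n)%:E <= lebesgue_rV R n B)%E ->
  (((x + y) ^+ n)%:E <= lebesgue_rV R n C)%E.
Proof.
move=> r0; elim: n => [|[_|n IH]] in A B C x y *.
- move=> _ _ _ _ _ _ ABC _ _; rewrite /= !diracE !expr0 !lee_fin !ler1n !lt0b.
  by rewrite !inE => A0 B0; have := ABC _ _ A0 B0; rewrite addr0.
- move=> mA mB mC _ _ _ ABC x0 y0; rewrite !expr1.
  have [A' mA' [-> AE]] := lebesgue_rV1 mA.
  have [B' mB' [-> BE]] := lebesgue_rV1 mB.
  have [C' mC' [-> CE]] := lebesgue_rV1 mC.
  have ne (D : set R) z : 0 < z -> (z%:E <= lebesgue_measure D)%E -> D !=set0.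
    move=> z0; have [->|/set0P//] := eqVneq D set0.
    by rewrite measure0 lee_fin leNgt z0.
  move=> Ax By; apply: (@le_trans _ _ (lebesgue_measure A' + lebesgue_measure B')%E).
    by rewrite EFinD leeD.
  apply: brunn_minkowski1 => //; [exact: ne Ax|exact: ne By|].
  by move=> a b /AE Aa /BE Bb; apply/CE; have := ABC _ _ Aa Bb; rewrite cons_rV_add addr0.
move=> mA mB mC Ar Br Cr ABC x0 y0 Ax By.
have [a [ma a0 aE AE]] := slice_measureE r0 mA Ar.
have [b [mb b0 bE BE]] := slice_measureE r0 mB Br.
have [c [mc c0 cE CE]] := slice_measureE r0 mC Cr.
(* The slice measures a, b are normalized by their suprema P^n, Q^n: the one
   dimensional inequality applies to the level sets {a > s P^n}, {b > s Q^n} and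
   the induction hypothesis to the slices, so that |C| >= (P+Q)^n (|A|/P^n + |B|/Q^n). *)
have peak (f : measurableTypeR R -> R) z : 0 < z ->
  (forall t, 0 <= f t <= (r *+ 2) ^+ n.+1) ->
    (z%:E <= \int[lebesgue_measure]_t (f t)%:E)%E ->
    exists p, [/\ 0 < p, forall t, 0 <= f t / p ^+ n.+1 <= 1 &
       forall s, s < 1 -> exists t, s < f t / p ^+ n.+1].
  move=> z0 f0 zf.
  have [t0 ft0] : exists t, 0 < f t.
    apply: contrapT => /forallNP H; move: zf;
      rewrite integral0_eq ?lee_fin ?leNgt ?z0// => t _.
    congr EFin; apply: le_anti; have /andP[-> _] := f0 t; rewrite andbT leNgt.
    exact/negP/H.
  have hs : has_sup (range f).
    by split; [exists (f t0), t0|exists ((r *+ 2) ^+ n.+1) => _ [t _ <-];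
      case/andP: (f0 t)].
  have fs t : f t <= sup (range f) by apply: sup_ubound; [case: hs|exists t].
  have [p p0 pE] := @exists_root R n.+1 (sup (range f)) isT (lt_le_trans ft0 (fs t0)).
  have s0 : 0 < sup (range f) := lt_le_trans ft0 (fs t0).
  exists p; split => [//|t|s s1].
    rewrite pE ler_pdivrMr // mul1r fs andbT divr_ge0 ?(ltW s0) //.
    by case/andP: (f0 t).
  have e0 : 0 < (1 - s) * sup (range f) by rewrite mulr_gt0 ?subr_gt0.
  have [_ [t' _ <-] ht] := sup_adherent e0 hs; exists t'.
  by rewrite pE ltr_pdivlMr //; move: ht; rewrite mulrBl mul1r opprB addrC subrK.
have xp : 0 < x ^+ n.+2 by exact: exprn_gt0.
have Ax' := Ax; rewrite AE in Ax'.
have [P [P0 aP aS]] := peak a _ xp a0 Ax'.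
have yp : 0 < y ^+ n.+2 by exact: exprn_gt0.
have By' := By; rewrite BE in By'.
have [Q [Q0 bQ bS]] := peak b _ yp b0 By'.
pose K := (P + Q) ^+ n.+1.
have K0 : 0 < K by rewrite exprn_gt0 // addr_gt0.
pose a' (t : measurableTypeR R) : R := a t / P ^+ n.+1.
pose b' (t : measurableTypeR R) : R := b t / Q ^+ n.+1.
(* Cutting at 1 makes the layer-cake formula on ]0, 1[ applicable and only lowers the integral for
   C. *)
pose c' (t : measurableTypeR R) : R := Num.min (c t / K) 1.
have ma' : measurable_fun setT a' by exact: measurable_funM.
have mb' : measurable_fun setT b' by exact: measurable_funM.
have mc' : measurable_fun setT c' by apply: measurable_minr => //; exact: measurable_funM.
have c'01 t : 0 <= c' t <= 1.
  rewrite /c' le_min ler01 ge_min lexx orbT !andbT divr_ge0 ?(ltW K0) //.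
  by case/andP: (c0 t).
(* With p^(n+1) the smaller of the two normalized slice measures, the slices of A and B have radii
   at least pP and pQ. By the induction hypothesis the slice of C at t1 + t2 has measure at least
   p^(n+1) (P+Q)^(n+1), which exceeds s K. *)
have main s t1 t2 : 0 < s -> s < 1 -> s < a' t1 -> s < b' t2 -> s < c' (t1 + t2).
  move=> s0 s1 sa sb; rewrite /c' lt_min s1 andbT.
  pose m := Num.min (a' t1) (b' t2).
  have sm : s < m by rewrite lt_min sa sb.
  have [p p0 pm] := @exists_root R n.+1 m isT (lt_trans s0 sm).
  apply: lt_le_trans sm _; rewrite ler_pdivlMr// mulrC -pm /K -exprMn mulrDl.
  rewrite -lee_fin -cE; apply: (IH [set z | A (cons_rV (t1, z))]
    [set z | B (cons_rV (t2, z))]).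
  - exact: measurable_slice.
  - exact: measurable_slice.
  - exact: measurable_slice.
  - by move=> z /Ar Az i; have := Az (lift ord0 i); rewrite cons_rVS.
  - by move=> z /Br Az i; have := Az (lift ord0 i); rewrite cons_rVS.
  - by move=> z /Cr Az i; have := Az (lift ord0 i); rewrite cons_rVS.
  - by move=> u v /= Au Bv; rewrite -cons_rV_add; exact: ABC.
  - exact: mulr_gt0.
  - exact: mulr_gt0.
  - rewrite [leRHS]aE lee_fin exprMn pm mulrC -ler_pdivlMr ?exprn_gt0//.
    by rewrite /m ge_min lexx.
  - rewrite [leRHS]bE lee_fin exprMn pm mulrC -ler_pdivlMr ?exprn_gt0//.
    by rewrite /m ge_min lexx orbT.
have ml (f : measurableTypeR R -> R) s : measurable_fun setT f ->
  measurable [set x | s < f x].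
  by move=> mf; rewrite -[X in measurable X]setTI;
    exact: (@measurable_fun_ltr _ _ R setT (cst s) f (measurable_cst s) mf).
have mlev (f : measurableTypeR R -> R) : measurable_fun setT f ->
    measurable_fun (`]0%R, 1%R[%classic : set (measurableTypeR R))
    (fun s => lebesgue_measure [set x | (s < f x)%R]).
  move=> mf; have mS := @measurable_subgraph _ _ R (cst 0) f (measurable_cst _) mf.
  have := measurable_funTS (measurable_fun_ysection (@lebesgue_measure R) mS).
  move=> /(_ `]0%R, 1%R[%classic); apply: eq_measurable_fun => s.
  rewrite inE /= in_itv /= => /andP[s0 _]; congr (lebesgue_measure _).
  apply/seteqP; split => t; rewrite /ysection /= inE /=; first by case/andP.
  by rewrite (ltW s0) => ->.
have sum : (\int[lebesgue_measure]_t (a' t)%:E + \int[lebesgue_measure]_t (b' t)%:E <=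
    \int[lebesgue_measure]_t (c' t)%:E)%E.
  rewrite !layer_cake01 // -ge0_integralD //.
  - apply: ge0_le_integral => //.
    + by move=> s _; rewrite adde_ge0.
    + by apply: emeasurable_funD; exact: mlev.
    + exact: mlev.
    move=> s; rewrite /= in_itv /= => /andP[s0 s1].
    apply: brunn_minkowski1; [exact: ml|exact: ml|exact: ml|exact: aS|exact: bS|].
    by move=> t1 t2 /=; exact: main.
  - exact: mlev.
  - exact: mlev.
rewrite CE.
apply: (@le_trans _ _ (K%:E * \int[lebesgue_measure]_t (c' t)%:E)%E); last first.
  rewrite -ge0_integralZl//; last 3 first.
  - exact/measurable_EFinP.
  - by move=> t _; rewrite lee_fin; case/andP: (c'01 t).
  - by rewrite lee_fin ltW.
  apply: ge0_le_integral => //.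
  - by move=> t _; rewrite -EFinM lee_fin mulr_ge0 ?(ltW K0)//; case/andP: (c'01 t).
  - by apply/measurable_EFinP; exact: measurable_funM.
  - exact/measurable_EFinP.
  move=> t _; rewrite -EFinM lee_fin mulrC -ler_pdivlMr // /c' ge_min lexx //.
apply: le_trans (lee_wpmul2l _ sum); last by rewrite lee_fin ltW.
have intE (f : measurableTypeR R -> R) p : measurable_fun setT f -> 0 < p ->
  (forall t, 0 <= f t <= (r *+ 2) ^+ n.+1) ->
   (\int[lebesgue_measure]_t (f t / p ^+ n.+1)%:E = (p ^+ n.+1)^-1%:E *
     \int[lebesgue_measure]_t (f t)%:E)%E.
  move=> mf p0 f0; rewrite -ge0_integralZl//; last 3 first.
  - exact/measurable_EFinP.
  - by move=> t _; rewrite lee_fin; case/andP: (f0 t).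
  - by rewrite lee_fin invr_ge0 exprn_ge0 // ltW.
  by apply: eq_integral => t _; rewrite -EFinM mulrC.
rewrite /a' /b' !intE // -AE -BE.
apply: (@le_trans _ _ (K%:E * ((P ^+ n.+1)^-1%:E * (x ^+ n.+2)%:E + (Q ^+ n.+1)^-1%:E
  * (y ^+ n.+2)%:E))%E).
  rewrite -!EFinM lee_fin.
  by rewrite ![_^-1 * _]mulrC; exact: pow_hoelder.
have Pi0 : (0%R <= (P ^+ n.+1)^-1%:E)%E by rewrite lee_fin invr_ge0 exprn_ge0 // ltW.
have Qi0 : (0%R <= (Q ^+ n.+1)^-1%:E)%E by rewrite lee_fin invr_ge0 exprn_ge0 // ltW.
have K0' : (0%R <= K%:E)%E by rewrite lee_fin ltW.
exact: (lee_wpmul2l K0' (leeD (lee_wpmul2l Pi0 Ax) (lee_wpmul2l Qi0 By))).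
Qed.

Lemma measurable_box (R : realType) n (r : R) :
  measurable [set z : 'rV[R]_n | forall i, `|z ord0 i| <= r].
Proof.
rewrite (_ : mkset _ = \bigcap_(i in [set: 'I_n]) [set z : 'rV[R]_n | `|z ord0 i| <= r]).
  apply: fin_bigcap_measurable => // i _; rewrite -[X in measurable X]setTI.
  apply: (@measurable_fun_ler _ _ R setT (fun z : 'rV[R]_n => `|z ord0 i|) (cst r)) => //.
  by apply: measurableT_comp => //; exact: measurable_coor.
by apply/seteqP; split => z /= h i; [move=> _|]; exact: h.
Qed.

(** Sums of points of A and B lie in the box of twice the radius, so C may be replaced by its part
    in that box. *)
Lemma brunn_minkowski (R : realType) n (r : R) (A B C : set 'rV[R]_n) (x y : R) :
  measurable A -> measurable B -> measurable C ->
  (forall z, A z -> forall i, `|z ord0 i| <= r) ->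
  (forall z, B z -> forall i, `|z ord0 i| <= r) ->
  (forall a b, A a -> B b -> C (a + b)) ->
  0 < x -> 0 < y ->
  ((x ^+ n)%:E <= lebesgue_rV R n A)%E -> ((y ^+ n)%:E <= lebesgue_rV R n B)%E ->
  (((x + y) ^+ n)%:E <= lebesgue_rV R n C)%E.
Proof.
move=> mA mB mC Ar Br ABC x0 y0 Ax By.
pose r' := `|r| *+ 2.
have rr' : r <= r' by rewrite /r' mulr2n (le_trans (ler_norm r))// lerDl.
pose C' := C `&` [set z : 'rV[R]_n | forall i, `|z ord0 i| <= r'].
have mC' : measurable C' by apply: measurableI => //; exact: measurable_box.
apply: (@le_trans _ _ (lebesgue_rV R n C')); last first.
  by apply: le_measure; rewrite ?inE //; exact: subIsetl.
apply: (@brunn_minkowski_bounded _ _ r' A B) => //.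
- by rewrite mulrn_wge0.
- by move=> z /Ar Az i; exact: le_trans (Az i) rr'.
- by move=> z /Br Az i; exact: le_trans (Az i) rr'.
- by move=> z [].
move=> a b Aa Bb; split; first exact: ABC.
move=> i; rewrite mxE (le_trans (ler_normD _ _))// /r' mulr2n.
by rewrite lerD// (le_trans _ (ler_norm r))//; [exact: Ar|exact: Br].
Qed.

(** * Borel sets and calculus on row vectors *)

Lemma rV_norm_leP (R : realType) n (x : 'rV[R]_n) (r : R) : 0 <= r ->
  (`|x| <= r) <-> (forall i, `|x ord0 i| <= r).
Proof.
move=> r0; rewrite [`|x|]mx_normrE; split.
  move=> h i; apply: le_trans h.
  exact: (le_bigmax _ (fun ij : 'I_1 * 'I_n => `|x ij.1 ij.2|) (ord0, i)).
by move=> h; apply: bigmax_le => // -[i j] _ /=; rewrite (ord1 i).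
Qed.

Lemma coor_le_norm (R : realType) n (x : 'rV[R]_n) i : `|x ord0 i| <= `|x|.
Proof. by move: i; apply/rV_norm_leP. Qed.

(** The sigma-algebra is generated by the coordinates, hence contains boxes, and an open set is the
    union of the countably many boxes with rational centre and radius 1/(k+1) that it contains. *)
Lemma open_measurable_rV (R : realType) n (U : set 'rV[R]_n) : open U -> measurable U.
Proof.
move=> oU.
pose box (c : 'rV[rat]_n * nat) := [set z : 'rV[R]_n | forall i,
  `|ratr (c.1 ord0 i) - z ord0 i| < c.2.+1%:R^-1 :> R].
pose D (c : 'rV[rat]_n * nat) := `[< box c `<=` U >].
rewrite (_ : U = \bigcup_c (if D c then box c else set0)).
  apply: countable_bigcupT_measurable => [|c];
    first exact: (@countableP ('rV[rat]_n * nat)%type).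
  case: ifP => // _.
  rewrite (_ : box c = \bigcap_(i in [set: 'I_n])
    [set z : 'rV[R]_n | `|ratr (c.1 ord0 i) - z ord0 i| < c.2.+1%:R^-1]).
    apply: fin_bigcap_measurable => // i _; rewrite -[X in measurable X]setTI.
    apply: (@measurable_fun_ltr _ _ R setT (fun z : 'rV[R]_n =>
      `|ratr (c.1 ord0 i) - z ord0 i|) (cst c.2.+1%:R^-1)) => //.
    apply: measurableT_comp => //; apply: measurable_funB => //.
    exact: measurable_coor.
  by apply/seteqP; split => z /= h i; [move=> _|]; exact: h.
apply/seteqP; split => x; last first.
  by case=> c _; case: ifP => // /asboolP cU /cU.
move=> Ux; have := oU x Ux => /nbhs_ballP[e /= e0 eU].
(* The centre will be within 1/(k+1) of x and the box has the same radius, so its points are within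
   2/(k+1) of x. *)
have [k ke] : exists k : nat, k.+1%:R^-1 *+ 2 < e :> R.
  exists (Num.trunc (2 / e)).
  by rewrite -[X in X < _]mulr_natl ltr_pdivrMr // mulrC -ltr_pdivrMr // truncnS_gt.
have kp : 0 < k.+1%:R^-1 :> R by rewrite invr_gt0.
have rt (i : 'I_n) : exists q : rat, `|ratr q - x ord0 i| < k.+1%:R^-1.
  have /rat_in_itvoo[q] : x ord0 i - k.+1%:R^-1 < x ord0 i + k.+1%:R^-1.
    by rewrite ltrD2l gtrN.
  rewrite inE /= => /andP[]; rewrite !bnd_simp => h1 h2; exists q.
  by rewrite ltr_norml; move: (k.+1%:R^-1) h1 h2 => d h1 h2; apply/andP; split; lra.
have [q qx] := fin_all_exists rt.
exists (\row_i q i, k) => //; rewrite /D; case: asboolP => [_|];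
  first by move=> i /=; rewrite mxE.
case=> z zb; apply: eU; rewrite -ball_normE /=.
apply: le_lt_trans ke; apply/rV_norm_leP; first by rewrite mulrn_wge0 // ltW.
move=> i; have := zb i; have := qx i; rewrite !mxE /= !ltr_norml ler_norml;
  move: (k.+1%:R^-1) => d.
by move=> /andP[h1 h2] /andP[h3 h4]; lra.
Qed.

Lemma open_continuous_measurable_rV (R : realType) n (D : set 'rV[R]_n) (f : 'rV[R]_n
  -> R) :
  open D -> {in D, continuous f} -> measurable_fun D f.
Proof.
move=> oD cf; apply: (measurability _ (RGenOInfty.measurableE R)).
move=> /= _ [_ [a ->]] <-; apply: open_measurable_rV.
rewrite openE => x [Dx] /=; rewrite in_itv /= andbT => ax.
apply: filterI; first exact: oD.
by have := cf x (mem_set Dx); move=> /cvgr_gt /(_ _ ax); apply: filterS => y;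
  rewrite /= in_itv /= andbT.
Qed.

Lemma continuous_measurable_rV (R : realType) n (f : 'rV[R]_n -> R) :
  continuous f -> measurable_fun setT f.
Proof.
by move=> cf; apply: open_continuous_measurable_rV => //; exact: openT.
Qed.

(** * Mean value theorems, C^k functions and the chain rule *)

Lemma is_derive_line (R : realType) n (f : 'rV[R]_n -> R) (p v : 'rV[R]_n) (s : R) :
  derivable f (p + s *: v) v ->
  is_derive s 1 (fun t : R => f (p + t *: v)) ('D_v f (p + s *: v)).
Proof.
have E : (fun h : R => h^-1 *: (f (p + (h *: 1 + s) *: v) - f (p + s *: v))) =
         (fun h : R => h^-1 *: (f (h *: v + (p + s *: v)) - f (p + s *: v))).
  by apply/funext => h; rewrite [h *: 1]mulr1 scalerDl addrCA.
move=> df; split; rewrite /derivable /derive /=.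
  by move: df; rewrite /derivable /= E.
by rewrite E.
Qed.

Lemma derive_MVT (R : realType) n (f : 'rV[R]_n -> R) (p v : 'rV[R]_n) (c : R) :
  (forall s, `|s| <= `|c| -> derivable f (p + s *: v) v) ->
  exists2 s, `|s| <= `|c| & f (p + c *: v) - f p = c * 'D_v f (p + s *: v).
Proof.
move=> df; pose g t := f (p + t *: v).
have dg (s : R) : `|s| <= `|c| -> is_derive s 1 g ('D_v f (p + s *: v)).
  by move=> /df; exact: is_derive_line.
have cg (s : R) : `|s| <= `|c| -> {for s, continuous g}.
  move=> /dg h; apply: differentiable_continuous; apply/derivable1_diffP.
  exact: ex_derive.
have [c0|c0] := leP 0 c.
  have [||s sc E] := @MVT_segment R g (fun s => 'D_v f (p + s *: v)) 0 c c0.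
  - move=> s; rewrite in_itv /= => /andP[s0 sc]; apply: dg.
    by rewrite !ger0_norm // ltW.
  - apply: continuous_in_subspaceT => s; rewrite inE /= in_itv /= => /andP[s0 sc].
    by apply: cg; rewrite !ger0_norm.
  move: sc; rewrite in_itv /= => /andP[s0 sc].
  exists s; first by rewrite !ger0_norm.
  by move: E; rewrite /g scale0r addr0 subr0 mulrC.
have [||s sc E] := @MVT_segment R g (fun s => 'D_v f (p + s *: v)) c 0 (ltW c0).
- move=> s; rewrite in_itv /= => /andP[s0 sc]; apply: dg.
  by rewrite !ltr0_norm // lerN2 ltW.
- apply: continuous_in_subspaceT => s; rewrite inE /= in_itv /= => /andP[s0 sc].
  by apply: cg; rewrite (ltr0_norm c0) ler0_norm // lerN2.
move: sc; rewrite in_itv /= => /andP[s0 sc].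
exists s; first by rewrite (ltr0_norm c0) ler0_norm // lerN2.
by move: E; rewrite /g scale0r addr0 sub0r => E; rewrite -opprB E mulrN opprK mulrC.
Qed.

(* Walk from x to x + y along the coordinate directions. *)
Lemma coordinate_MVT (R : realType) n (f : 'rV[R]_n -> R) (x y : 'rV[R]_n) :
  (forall z, `|z - x| <= `|y| -> forall i, derivable f z (delta_mx ord0 i)) ->
  exists2 z : 'I_n -> 'rV[R]_n, (forall i, `|z i - x| <= `|y|) &
    f (x + y) - f x = \sum_i y ord0 i * partial i f (z i).
Proof.
(* [p k] has the first k increments applied to x. In the sup norm no point of this path is farther
   than |y| from x. *)
move=> df; pose p k := x + \row_j (if (j < k)%N then y ord0 j else 0).
have pn : p n = x + y by congr (_ + _); apply/rowP => j; rewrite mxE ltn_ord.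
have p0 : p 0%N = x by rewrite -[RHS]addr0; congr (_ + _); apply/rowP => j; rewrite !mxE.
have pS (i : 'I_n) : p i.+1 = p i + y ord0 i *: delta_mx ord0 i.
  rewrite /p -addrA; congr (_ + _); apply/rowP => j; rewrite !mxE eqxx /= ltnS.
  have [->|ij] := eqVneq j i; first by rewrite leqnn ltnn mulr1 add0r.
  by rewrite leq_eqVlt -[X in X || _]/(j == i) (negPf ij) mulr0 addr0.
have close (i : 'I_n) s : `|s| <= `|y ord0 i| ->
  `|p i + s *: delta_mx ord0 i - x| <= `|y|.
  move=> sy; rewrite /p addrAC [x + _]addrC addrK; apply/rV_norm_leP => // j;
    rewrite !mxE eqxx /=.
  have [->|ij] := eqVneq j i.
    by rewrite ltnn mulr1 add0r; apply: le_trans sy _; exact: coor_le_norm.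
  rewrite mulr0 addr0; case: ifP => _; first exact: coor_le_norm.
  by rewrite normr0.
have step (i : 'I_n) : exists z, `|z - x| <= `|y| /\
  f (p i.+1) - f (p i) = y ord0 i * partial i f z.
  have [|s sy E] := @derive_MVT _ _ f (p i) (delta_mx ord0 i) (y ord0 i).
    by move=> s sy; apply: df; exact: close.
  by exists (p i + s *: delta_mx ord0 i); split; [exact: close|rewrite pS E].
have [z zP] := fin_all_exists step.
exists z => [i|]; first by case: (zP i).
rewrite -pn -[X in _ - f X]p0 -(telescope_sumr (fun k => f (p k))) // big_mkord.
by apply: eq_bigr => i _; case: (zP i).
Qed.

(** A smooth function is carried together with all its derivatives, [D n] being the n-th; higher
    partial derivatives of a composition are then reached by raising the index. *)
Definition smooth1 (R : realType) (D : nat -> R -> R) : Prop :=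
  forall n (x : R), is_derive x 1 (D n) (D n.+1 x).

Lemma is_derive_of_line (R : realType) n (f : 'rV[R]_n -> R) (p v : 'rV[R]_n) (d : R) :
  is_derive (0 : R) 1 (fun t : R => f (p + t *: v)) d -> is_derive p v f d.
Proof.
have E : (fun h : R => h^-1 *: (f (p + (h *: 1 + 0) *: v) - f (p + 0 *: v))) =
         (fun h : R => h^-1 *: (f (h *: v + p) - f p)).
  apply/funext => h; congr (_ *: (f _ - f _)); last by rewrite scale0r addr0.
  by rewrite [h *: 1]mulr1 addr0 addrC.
move=> [df dE]; split.
  by move: df; rewrite /derivable /= E.
by move: dE; rewrite /derive /= E.
Qed.

Lemma is_derive_comp1 (R : realType) n (G : R -> R) (f : 'rV[R]_n ->
  R) (x v : 'rV[R]_n) (d : R) :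
  is_derive (f x) 1 G d -> derivable f x v ->
  is_derive x v (G \o f) (d * 'D_v f x).
Proof.
move=> dG df; apply: is_derive_of_line.
have df0 : derivable f (x + 0 *: v) v by rewrite scale0r addr0.
have l := is_derive_line df0.
have dG' : is_derive (f (x + 0 *: v)) 1 G d by rewrite scale0r addr0.
have := @is_derive1_comp _ G (fun t => f (x + t *: v)) 0 _ _ dG' l.
by rewrite scale0r addr0.
Qed.

Lemma Ck_le (R : realType) n k l D (f : 'rV[R]_n -> R) : (k <= l)%N -> Ck l D f ->
  Ck k D f.
Proof.
move=> kl fC s sk x Dx; have [c d] := fC s (leq_trans sk kl) x Dx.
by split=> // sk'; apply: d; exact: leq_trans sk' kl.
Qed.

Lemma Ck0 (R : realType) n D (f : 'rV[R]_n -> R) :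
  (forall x, D x -> {for x, continuous f}) -> Ck 0 D f.
Proof. by move=> cf [|i s] // _ x Dx; split; [exact: cf|]. Qed.

(** The multi-index is split at its last entry, which is the derivative taken first; the remaining
    entries then act on [partial i f]. *)
Lemma CkS (R : realType) n k D (f : 'rV[R]_n -> R) :
  (forall x, D x -> {for x, continuous f}) ->
  (forall x i, D x -> derivable f x (delta_mx ord0 i)) ->
  (forall i, Ck k D (partial i f)) -> Ck k.+1 D f.
Proof.
move=> cf df pf s; case/lastP: s => [_ x Dx|s i].
  by split=> [|_ i]; [exact: cf|exact: df].
rewrite size_rcons !ltnS => sk x Dx.
rewrite /partials foldr_rcons; have [c d] := pf i s sk x Dx.
by split=> // ?; exact: d.
Qed.

Lemma Ck_continuous (R : realType) n k D (f : 'rV[R]_n -> R) x :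
  Ck k D f -> D x -> {for x, continuous f}.
Proof. by move=> /(_ [::] isT x) /[apply] -[]. Qed.

Lemma Ck_derivable (R : realType) n k D (f : 'rV[R]_n -> R) x i :
  Ck k.+1 D f -> D x -> derivable f x (delta_mx ord0 i).
Proof. by move=> /(_ [::] isT x) /[apply] -[_]; exact. Qed.

Lemma Ck_partial (R : realType) n k D (f : 'rV[R]_n -> R) i :
  Ck k.+1 D f -> Ck k D (partial i f).
Proof.
move=> fC s sk x Dx; have := fC (rcons s i); rewrite size_rcons !ltnS => /(_ sk x Dx).
by rewrite /partials foldr_rcons.
Qed.

Lemma CkD (R : realType) n k (f g : 'rV[R]_n -> R) :
  Ck k setT f -> Ck k setT g -> Ck k setT (fun x => f x + g x).
Proof.
elim: k f g => [|k IH] f g fC gC.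
  apply: Ck0 => x _; apply: continuousD;
    [exact: (Ck_continuous fC)|exact: (Ck_continuous gC)].
apply: CkS => [x _|x i _|i].
- by apply: continuousD; [exact: (Ck_continuous fC)|exact: (Ck_continuous gC)].
- exact: (derivableD (@Ck_derivable _ _ _ _ _ x i fC I) (@Ck_derivable _ _ _ _ _ x i
  gC I)).
rewrite (_ : partial i _ = fun x => partial i f x + partial i g x).
  by apply: IH; exact: Ck_partial.
by apply/funext => x; exact: (deriveD (@Ck_derivable _ _ _ _ _ x i fC I)
  (@Ck_derivable _ _ _ _ _ x i gC I)).
Qed.

Lemma CkM (R : realType) n k (f g : 'rV[R]_n -> R) :
  Ck k setT f -> Ck k setT g -> Ck k setT (fun x => f x * g x).
Proof.
elim: k f g => [|k IH] f g fC gC.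
  apply: Ck0 => x _; apply: continuousM;
    [exact: (Ck_continuous fC)|exact: (Ck_continuous gC)].
apply: CkS => [x _|x i _|i].
- by apply: continuousM; [exact: (Ck_continuous fC)|exact: (Ck_continuous gC)].
- exact: (derivableM (@Ck_derivable _ _ _ _ _ x i fC I) (@Ck_derivable _ _ _ _ _ x i
  gC I)).
rewrite (_ : partial i _ = fun x => f x * partial i g x + g x * partial i f x).
  apply: CkD; apply: IH; try exact: Ck_partial.
    exact: Ck_le fC.
  exact: Ck_le gC.
by apply/funext => x; exact: (deriveM (@Ck_derivable _ _ _ _ _ x i fC I)
  (@Ck_derivable _ _ _ _ _ x i gC I)).
Qed.

Lemma partial_comp (R : realType) n (D : nat -> R -> R) (f : 'rV[R]_n -> R) m i x :
  smooth1 D -> derivable f x (delta_mx ord0 i) ->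
  partial i (D m \o f) x = D m.+1 (f x) * partial i f x.
Proof.
move=> sD df.
by rewrite /partial; apply: derive_val; exact: is_derive_comp1.
Qed.

(** The index m is general in the induction on k, since differentiating [D m \o f] brings in
    [D m.+1]. *)
Lemma Ck_comp (R : realType) n k (D : nat -> R -> R) (f : 'rV[R]_n -> R) m :
  smooth1 D -> Ck k setT f -> Ck k setT (D m \o f).
Proof.
move=> sD; have cD j : continuous (D j).
  move=> x; apply: differentiable_continuous; apply/derivable1_diffP.
  by have [] := sD j x.
elim: k m => [|k IH] m fC.
  by apply: Ck0 => x _; apply: continuous_comp; [exact: (Ck_continuous fC)|exact: cD].
apply: CkS => [x _|x i _|i].
- by apply: continuous_comp; [exact: (Ck_continuous fC)|exact: cD].
- by have [] := is_derive_comp1 (sD m (f x)) (@Ck_derivable _ _ _ _ _ x i fC I).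
rewrite (_ : partial i _ = fun x => (D m.+1 \o f) x * partial i f x).
  by apply: CkM; [apply: IH; exact: Ck_le fC|exact: Ck_partial].
by apply/funext => x; apply: partial_comp => //;
  exact: (@Ck_derivable _ _ _ _ _ x i fC I).
Qed.

(** Since [D m] vanishes at 0, the support does not grow. This makes truncations of the smooth
    approximants admissible in the weak equation. *)
Lemma test_function_comp (R : realType) n (D : nat -> R -> R) (Omega : set 'rV[R]_n)
    (f : 'rV[R]_n -> R) m : smooth1 D -> D m 0 = 0 ->
  test_function Omega f -> test_function Omega (D m \o f).
Proof.
move=> sD D0 [fC cf fO].
have sub : closure [set x | (D m \o f) x != 0] `<=` closure [set x | f x != 0].
  by apply: closure_subset => x /=; apply: contra => /eqP ->; rewrite D0.
split.
- by move=> k; exact: Ck_comp.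
- by apply: subclosed_compact cf sub; exact: closed_closure.
- exact: subset_trans fO.
Qed.

Lemma gradient_comp (R : realType) n (D : nat -> R -> R) (Omega : set 'rV[R]_n)
    (f : 'rV[R]_n -> R) m x : smooth1 D -> test_function Omega f ->
  gradient (D m \o f) x = D m.+1 (f x) *: gradient f x.
Proof.
move=> sD [fC _ _]; apply/rowP => i; rewrite !mxE partial_comp//.
exact: (@Ck_derivable _ _ _ _ _ x i (fC 1%N) I).
Qed.

(** * Finsler norms *)

Lemma dotrVC (R : realType) n (x y : 'rV[R]_n) : dotrV x y = dotrV y x.
Proof. by apply: eq_bigr => i _; rewrite mulrC. Qed.

Lemma dotrVZr (R : realType) n (x y : 'rV[R]_n) (a : R) :
  dotrV x (a *: y) = a * dotrV x y.
Proof. by rewrite mulr_sumr; apply: eq_bigr => i _; rewrite mxE mulrCA. Qed.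

Lemma dotrVZl (R : realType) n (x y : 'rV[R]_n) (a : R) :
  dotrV (a *: x) y = a * dotrV x y.
Proof. by rewrite dotrVC dotrVZr dotrVC. Qed.

Lemma cvg_sumr (R : realType) (T : Type) (G : set_system T) (FG : Filter G)
    (I : Type) (s : seq I) (f : I -> T -> R) (l : I -> R) :
  (forall i, f i x @[x --> G] --> l i) ->
  (\sum_(i <- s) f i x) @[x --> G] --> \sum_(i <- s) l i.
Proof.
move=> fl; elim: s => [|i s IH].
  rewrite big_nil (_ : (fun x => _) = cst 0); first exact: cvg_cst.
  by apply/funext => x; rewrite big_nil.
rewrite big_cons (_ : (fun x => _) = (fun x => f i x + \sum_(j <- s) f j x)).
  exact: cvgD.
by apply/funext => x; rewrite big_cons.
Qed.

Section finsler.
Variables (R : realType) (N : nat) (F : 'rV[R]_N -> R).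
Hypothesis hF : finsler_norm F.

Lemma finsler_ge0 xi : 0 <= F xi. Proof. by case: hF => -[]. Qed.

Lemma finslerZ t xi : F (t *: xi) = `|t| * F xi. Proof. by case: hF => -[]. Qed.

Lemma finsler_gt0 xi : xi != 0 -> 0 < F xi. Proof. by case: hF => -[] _ _ h _ _ _ /h. Qed.

Lemma finsler0 : F 0 = 0. Proof. by rewrite -(scale0r 0) finslerZ normr0 mul0r. Qed.

Lemma finslerN xi : F (- xi) = F xi.
Proof. by rewrite -scaleN1r finslerZ normrN normr1 mul1r. Qed.

(** Convexity at the midpoint, doubled by homogeneity. *)
Lemma finslerD xi eta : F (xi + eta) <= F xi + F eta.
Proof.
have [_ hC _ _] := hF.
have h0 : 0 <= 2^-1 :> R by rewrite invr_ge0.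
have h1 : 2^-1 <= 1 :> R by rewrite invf_le1 // ler1n.
have h : F (2^-1 *: xi + (1 - 2^-1) *: eta) <= 2^-1 * F xi + (1 - 2^-1) * F eta.
  exact: (hC (Itv01 h0 h1) xi eta (mem_set I) (mem_set I)).
have e : 1 - 2^-1 = 2^-1 :> R by lra.
move: h; rewrite e -scalerDr finslerZ ger0_norm// -mulrDr ler_pM2l //.
Qed.

Lemma finsler_sum (I : Type) (s : seq I) (P : pred I) (x : I -> 'rV[R]_N) :
  F (\sum_(i <- s | P i) x i) <= \sum_(i <- s | P i) F (x i).
Proof.
elim/big_rec2 : _ => [|i y z _ h]; first by rewrite finsler0.
by apply: le_trans (finslerD _ _) _; rewrite lerD2l.
Qed.

(** This number is a Lipschitz constant of F for the sup norm, and it also bounds the coordinates of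
    the points of the polar ball. *)
Definition finsler_bound := \sum_(i < N) F (delta_mx ord0 i).

Lemma finsler_bound_ge0 : 0 <= finsler_bound.
Proof. by apply: sumr_ge0 => i _; exact: finsler_ge0. Qed.

Lemma finsler_delta_le i : F (delta_mx ord0 i) <= finsler_bound.
Proof.
rewrite /finsler_bound (bigD1 i)//= lerDl; apply: sumr_ge0 => j _.
exact: finsler_ge0.
Qed.

Lemma finsler_le xi : F xi <= finsler_bound * `|xi|.
Proof.
rewrite {1}(row_sum_delta xi); apply: le_trans (finsler_sum _ _ _) _.
rewrite mulr_suml; apply: ler_sum => i _; rewrite finslerZ mulrC.
by rewrite ler_wpM2l ?finsler_ge0// coor_le_norm.
Qed.

Lemma finsler_dist xi eta : `|F xi - F eta| <= finsler_bound * `|xi - eta|.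
Proof.
apply: le_trans (finsler_le _); rewrite ler_norml; apply/andP; split.
  have := finslerD (- (xi - eta)) xi; rewrite opprB subrK -opprB finslerN; lra.
by have := finslerD (xi - eta) eta; rewrite subrK; lra.
Qed.

Lemma finsler_continuous : continuous F.
Proof.
move=> x; apply/(@cvgrPdist_lt _ _ _ (nbhs x) (nbhs_filter x)) => e e0.
have b0 : 0 < finsler_bound + 1 by rewrite ltr_wpDl ?finsler_bound_ge0.
have := nbhsx_ballx x (e / (finsler_bound + 1)) (divr_gt0 e0 b0).
apply: filterS => y; rewrite -ball_normE /= => xy.
apply: le_lt_trans (finsler_dist _ _) _.
apply: (@le_lt_trans _ _ ((finsler_bound + 1) * `|x - y|)).
  by rewrite ler_wpM2r ?lerDl.
by rewrite mulrC -ltr_pdivlMr.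
Qed.

(** The minimum of F on the compact unit sphere of the sup norm is positive, and homogeneity spreads
    the bound to all vectors. *)
Lemma finsler_coercive : exists2 c : R, 0 < c & forall xi, c * `|xi| <= F xi.
Proof.
pose S := [set xi : 'rV[R]_N | `|xi| = 1].
(* The sphere can be empty, namely in dimension 0, and then has no minimizer. *)
have [S0|S0] := eqVneq S set0.
  exists 1 => // xi; have [->|xi0] := eqVneq xi 0;
    first by rewrite normr0 mulr0 finsler_ge0.
  have : S (`|xi|^-1 *: xi) by rewrite /S /= normrZ normfV normr_id mulVf ?normr_eq0.
  by rewrite S0.
have cS : compact S.
  apply: bounded_closed_compact.
    by exists 1; split; [exact: num_real|move=> x x1 y /= ->; exact: ltW].
  rewrite (_ : S = (fun x : 'rV[R]_N => `|x|) @^-1` [set 1]) //.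
  apply: closed_comp => [x _|]; first exact: norm_continuous.
  exact: closed_eq.
have /set0P S0' := S0.
have [|c cS' cmin] := EVT_min_rV S0' cS (f := F).
  by apply: continuous_subspaceT => x; exact: finsler_continuous.
have c1 : `|c| = 1 by move: cS'; rewrite inE.
exists (F c).
  by apply: finsler_gt0; rewrite -normr_eq0 c1 oner_eq0.
move=> xi; have [->|xi0] := eqVneq xi 0; first by rewrite normr0 mulr0 finsler_ge0.
have x0 : 0 < `|xi| by rewrite normr_gt0.
have : F c <= F (`|xi|^-1 *: xi).
  by apply: cmin; rewrite inE /S /= normrZ normfV normr_id mulVf ?normr_eq0.
by rewrite finslerZ normfV normr_id mulrC ler_pdivlMr.
Qed.

(** This describes the polar ball by linear inequalities. The real [sup] is meaningful only for sets
    bounded above, and coercivity of F supplies the bound. *)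
Lemma support_funP x : support_fun F x <= 1 <-> forall xi, dotrV x xi <= F xi.
Proof.
set E := [set dotrV x xi | xi in [set xi | F xi < 1]].
have E0 : E !=set0 by exists (dotrV x 0), 0 => //=; rewrite finsler0.
split; last first.
  by move=> h; apply: ge_sup => // _ [xi /= h1 <-]; exact: le_trans (h xi) (ltW h1).
move=> h xi.
have hE : has_ubound E.
  have [c c0 cF] := finsler_coercive.
  exists (\sum_(i < N) `|x ord0 i| * c^-1) => _ [eta /= h1 <-].
  apply: ler_sum => i _; apply: le_trans (ler_norm _) _; rewrite normrM.
  rewrite ler_wpM2l//; apply: le_trans (coor_le_norm _ _) _.
  by rewrite -(ler_pM2l c0) mulfV ?gt_eqF//; exact: le_trans (cF _) (ltW h1).
(* Dividing xi by slightly more than F xi puts it in the open unit ball of F, also when F xi = 0. *)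
apply/ler_addgt0Pr => e e0; pose t := F xi + e.
have t0 : 0 < t by rewrite ltr_wpDl ?finsler_ge0.
have : dotrV x (t^-1 *: xi) <= 1.
  apply: le_trans h; apply: ub_le_sup => //; exists (t^-1 *: xi) => //=.
  by rewrite finslerZ normfV gtr0_norm // mulrC ltr_pdivrMr // mul1r ltrDl.
by rewrite dotrVZr mulrC ler_pdivrMr // mul1r.
Qed.

Lemma support_fun_coor x i : support_fun F x <= 1 -> `|x ord0 i| <= finsler_bound.
Proof.
move/support_funP => h.
have dE : dotrV x (delta_mx ord0 i) = x ord0 i.
  rewrite /dotrV (bigD1 i)//= mxE !eqxx mulr1 big1 ?addr0// => j ji.
  by rewrite mxE (negPf ji) andbF mulr0.
rewrite ler_norml; apply/andP; split; last first.
  by rewrite -dE; apply: le_trans (h _) (finsler_delta_le i).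
rewrite lerNl -dE -mulN1r -dotrVZr; apply: le_trans (h _) _.
by rewrite scaleN1r finslerN; exact: finsler_delta_le.
Qed.

Lemma dotrV_continuous (xi : 'rV[R]_N) : continuous (fun x : 'rV[R]_N => dotrV x xi).
Proof.
move=> x; apply: (@cvg_sumr _ _ (nbhs x) (nbhs_filter x)) => i.
apply: (@cvgM _ _ (nbhs x) (nbhs_filter x)); last exact: cvg_cst.
exact: coord_continuous.
Qed.

Lemma measurable_dual_ball : measurable [set x | support_fun F x <= 1].
Proof.
rewrite -[X in measurable X]setCK; apply: measurableC; apply: open_measurable_rV.
rewrite openC (_ : mkset _ = \bigcap_(xi in setT) [set x | dotrV x xi <= F xi]).
  apply: closed_bigI => xi _; apply: (@closed_comp _ _ _ [set y : R | y <= F xi]).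
    by move=> x _; exact: dotrV_continuous.
  exact: closed_le.
apply/seteqP; split => x; first by move/support_funP => h xi _; exact: h.
by move=> h; apply/support_funP => xi; exact: h.
Qed.

(** Subadditivity bounds every difference quotient, and the bound survives the limit. *)
Lemma finsler_partial_le xi i : xi != 0 -> `|partial i F xi| <= F (delta_mx ord0 i).
Proof.
move=> xi0; have [_ _ FC _] := hF.
have dF : derivable F xi (delta_mx ord0 i) by exact: (@Ck_derivable _ _ _ _ _ xi i FC).
have b (h : R) : `|h^-1 *: (F (h *: delta_mx ord0 i + xi) - F xi)| <= F (delta_mx ord0 i).
  have [->|h0] := eqVneq h 0; first by rewrite invr0 scale0r normr0 finsler_ge0.
  rewrite normrM normfV mulrC ler_pdivrMr ?normr_gt0// mulrC -finslerZ.
  rewrite ler_norml; apply/andP; split.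
    have := finslerD (- (h *: delta_mx ord0 i)) (h *: delta_mx ord0 i + xi).
    by rewrite addKr finslerN; lra.
  by have := finslerD (h *: delta_mx ord0 i) xi; lra.
rewrite ler_norml; apply/andP; split.
  by apply: limr_ge; [exact: dF|apply: nearW => h; have := b h;
    rewrite ler_norml => /andP[]].
by apply: limr_le; [exact: dF|apply: nearW => h; have := b h;
  rewrite ler_norml => /andP[]].
Qed.

(** Euler's identity for degree one. Between xi and (1 + s) xi the increment is s F(xi) by
    homogeneity, and by the coordinatewise mean value theorem it is also s times a sum of partial
    derivatives near xi; continuity of these gives the identity as s shrinks. *)
Lemma finsler_euler xi : xi != 0 -> dotrV (gradient F xi) xi = F xi.
Proof.
move=> xi0; have [_ _ FC _] := hF.
have x0 : 0 < `|xi| by rewrite normr_gt0.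
set L := dotrV _ _.
suff h (e : R) : 0 < e -> `|F xi - L| <= N%:R * `|xi| * e.
  apply/eqP; rewrite eq_sym -subr_eq0 -normr_le0; apply/ler_addgt0Pr => e e0;
    rewrite add0r.
  have n0 : 0 < N%:R * `|xi| + 1 by rewrite ltr_wpDl ?mulr_ge0.
  apply: le_trans (h (e / (N%:R * `|xi| + 1)) (divr_gt0 e0 n0)) _.
  rewrite mulrCA ler_piMr ?(ltW e0) // ler_pdivrMr // mul1r lerDl //.
move=> e0.
have : \forall z \near nbhs xi, forall i, `|partial i F xi - partial i F z| <= e.
  apply: filter_forall => i.
  have := Ck_continuous (Ck_partial (k := 1) i FC) xi0.
  by move=> /(@cvgrPdist_le _ _ _ (nbhs xi) (nbhs_filter xi)) /(_ e e0).
move=> /nbhs_ballP[d /= d0 dP].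
(* Below d/|xi| the intermediate points stay where the partial derivatives are e-close to those at
   xi; below 1 they avoid the origin. Halving makes both bounds strict. *)
pose s := Num.min (d / `|xi|) 1 / 2.
have s0 : 0 < s by rewrite /s divr_gt0 // lt_min divr_gt0 //= ltr01.
have m0 : 0 < Num.min (d / `|xi|) 1 by rewrite lt_min divr_gt0 //= ltr01.
have sm : s < Num.min (d / `|xi|) 1 by rewrite /s; lra.
have sd : `|s *: xi| < d.
  rewrite normrZ gtr0_norm // -ltr_pdivlMr //; apply: lt_le_trans sm _.
  by rewrite ge_min lexx.
have s1 : s < 1 by apply: lt_le_trans sm _; rewrite ge_min lexx orbT.
have zn0 z : `|z - xi| <= `|s *: xi| -> z != 0.
  apply: contraTneq => ->; rewrite sub0r normrN normrZ gtr0_norm // -ltNge.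
  by rewrite gtr_pMl.
have [z zi|z zP E] := @coordinate_MVT _ _ F xi (s *: xi).
  by move=> i; apply: (@Ck_derivable _ _ _ _ _ z i FC); exact: zn0 zi.
have : s * F xi = \sum_i s * (xi ord0 i * partial i F (z i)).
  rewrite -{1}[xi]scale1r -scalerDl in E; move: E.
  rewrite finslerZ gtr0_norm ?addr_gt0 // mulrDl mul1r addrAC subrr add0r => ->.
  by apply: eq_bigr => i _; rewrite mxE mulrA.
rewrite -mulr_sumr => /(mulfI _) -> //; last by rewrite gt_eqF.
rewrite -sumrB; apply: le_trans (ler_norm_sum _ _ _) _.
rewrite -mulrA mulr_natl -[X in _ *+ X]card_ord -sumr_const; apply: ler_sum => i _.
rewrite mxE [_ * xi _ _]mulrC -mulrBr normrM ler_pM // ?coor_le_norm// distrC.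
by apply: dP; rewrite -ball_normE /= distrC; apply: le_lt_trans (zP i) sd.
Qed.

Lemma flux_euler xi : (0 < N)%N -> dotrV (anisotropic_flux F xi) xi = F xi ^+ N.
Proof.
move=> N0; rewrite /anisotropic_flux; case: eqP => [->|/eqP xi0].
  by rewrite -[X in dotrV _ X](scale0r 0) dotrVZr mul0r finsler0 expr0n -[N]prednK.
by rewrite dotrVZl finsler_euler// -exprSr prednK.
Qed.

(** Growth of order N - 1 in xi is what an integrable majorant of the N-th powers of both gradients
    can absorb. *)
Lemma flux_bound xi eta :
  `|dotrV (anisotropic_flux F xi) eta| <= finsler_bound * (F xi ^+ N.-1 * `|eta|).
Proof.
rewrite /anisotropic_flux; case: eqP => [->|/eqP xi0].
  rewrite -{1}(scale0r 0) dotrVZl mul0r normr0.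
  by rewrite mulr_ge0 ?finsler_bound_ge0 // mulr_ge0 // exprn_ge0 ?finsler_ge0.
rewrite dotrVZl normrM ger0_norm ?exprn_ge0 ?finsler_ge0// mulrCA.
rewrite ler_wpM2l ?exprn_ge0 ?finsler_ge0//.
apply: le_trans (ler_norm_sum _ _ _) _; rewrite mulr_suml; apply: ler_sum => i _.
by rewrite normrM ler_pM // ?coor_le_norm// mxE finsler_partial_le.
Qed.

(** The flux is continuous on the open complement of the origin, and its value 0 at the origin is
    that of the extension by zero. *)
Lemma measurable_flux i : measurable_fun setT (fun xi => anisotropic_flux F xi ord0 i).
Proof.
have [_ _ FC _] := hF.
pose D := [set xi : 'rV[R]_N | xi != 0].
have oD : open D.
  rewrite (_ : D = ~` [set 0]).
    by rewrite openC; apply: accessible_closed_set1; apply: hausdorff_accessible;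
      exact: norm_hausdorff.
  by apply/seteqP; split => x /= /eqP.
rewrite (_ : (fun _ => _) = (fun xi => F xi ^+ N.-1 * partial i F xi) \_ D).
  apply: (measurable_restrictT _ (open_measurable_rV oD)).1.
apply: measurable_funM.
    apply: measurable_funX; apply: measurable_funTS; apply: continuous_measurable_rV.
    exact: finsler_continuous.
  apply: open_continuous_measurable_rV => // xi; rewrite inE => xi0.
  exact: (Ck_continuous (Ck_partial (k := 1) i FC) xi0).
apply/funext => xi; rewrite patchE /anisotropic_flux; case: eqP => [->|/eqP xi0].
  by rewrite mxE memNset // /D /= eqxx.
by rewrite !mxE mem_set.
Qed.

End finsler.

(** * Isoperimetric inequality for test functions *)

Section test_function_bounds.
Variables (R : realType) (n : nat) (Omega : set 'rV[R]_n) (f : 'rV[R]_n -> R).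
Hypothesis tf : test_function Omega f.

Lemma test_function_derivable s x i : derivable (partials s f) x (delta_mx ord0 i).
Proof.
case: tf => fC _ _; have [_ h] := fC (size s).+1 s (leqnSn _) x I.
exact: h.
Qed.

Lemma test_function_continuous s : continuous (partials s f).
Proof. by case: tf => fC _ _ x; have [] := fC (size s) s (leqnn _) x I. Qed.

Lemma test_function_partials0 s x : ~ closure [set x | f x != 0] x -> partials s f x = 0.
Proof.
elim: s x => [|i s IH] x cx /=.
  by apply/eqP; apply: contra_notT cx => fx; exact: subset_closure.
rewrite /partial (_ : 'D__ _ _ = 'D_(delta_mx ord0 i) (cst 0) x); last first.
  apply: near_eq_derive; have : open (~` closure [set x | f x != 0]).
    by rewrite openC; exact: closed_closure.
  by move=> /(_ x cx); apply: filterS => y; exact: IH.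
exact: derive_cst.
Qed.

Lemma test_function_bounded s : exists2 M, 0 <= M & forall x, `|partials s f x| <= M.
Proof.
have [_ cS _] := tf.
have cI : compact (partials s f @` closure [set x | f x != 0]).
  apply: continuous_compact => //; apply: continuous_subspaceT.
  exact: test_function_continuous.
have [M [_ MB]] := compact_bounded cI.
have h0 : M < `|M| + 1 by rewrite (le_lt_trans (ler_norm M)) // ltrDl.
exists (`|M| + 1) => [|x]; first by rewrite addr_ge0.
have [cx|cx] := pselect (closure [set x | f x != 0] x).
  by apply: (MB _ h0); exists x.
by rewrite test_function_partials0 // normr0 addr_ge0.
Qed.

Lemma test_function_supp x : f x != 0 -> Omega x.
Proof. by case: tf => _ _ fO fx; apply: fO; exact: subset_closure. Qed.

(** Second derivatives of a test function are bounded; this makes the remainder in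
    [test_function_increment] quadratic in h, uniformly in x. *)
Lemma partial_lipschitz : exists2 L, 0 <= L &
  forall i x z, `|partial i f z - partial i f x| <= L * `|z - x|.
Proof.
have H (ij : 'I_n * 'I_n) : exists m, 0 <= m /\ forall x, `|partials [:: ij.1;
  ij.2] f x| <= m.
  by have [M M0 h] := test_function_bounded [:: ij.1; ij.2]; exists M.
have [M MP] := fin_all_exists H.
have M0 ij : 0 <= M ij by case: (MP ij).
exists (\sum_(ij : 'I_n * 'I_n) M ij) => [|i x z]; first exact: sumr_ge0.
have [|w _] := @coordinate_MVT _ _ (partial i f) x (z - x).
  by move=> y _ j; exact: (@test_function_derivable [:: i] y j).
rewrite [x + _]addrC subrK => ->; apply: le_trans (ler_norm_sum _ _ _) _.
rewrite mulr_suml; apply: (@le_trans _ _ (\sum_j M (j, i) * `|z - x|)).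
  apply: ler_sum => j _; rewrite normrM mulrC ler_pM // ?coor_le_norm//.
  by case: (MP (j, i)) => _; exact.
rewrite -!mulr_suml ler_wpM2r //.
have -> : \sum_(ij : 'I_n * 'I_n) M ij = \sum_j \sum_k M (j, k).
  by rewrite pair_bigA; apply: eq_bigr => -[].
apply: ler_sum => j _.
by rewrite (bigD1 i) //= lerDl sumr_ge0.
Qed.

End test_function_bounds.

(** First-order expansion in a direction y of the polar ball: duality bounds the linear term by F of
    the gradient, and the error is h^2 C with C independent of x and y. *)
Lemma test_function_increment (R : realType) N (F : 'rV[R]_N -> R) (hF : finsler_norm F)
    (Omega : set 'rV[R]_N) (phi : 'rV[R]_N -> R) : test_function Omega phi ->
  exists2 C, 0 <= C & forall (x y : 'rV[R]_N) h, 0 <= h -> support_fun F y <= 1 ->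
    `|phi (x + h *: y) - phi x| <= h * (F (gradient phi x) + h * C).
Proof.
move=> tp; have [L L0 LP] := partial_lipschitz tp; pose B := finsler_bound F.
have B0 : 0 <= B by exact: finsler_bound_ge0.
exists (N%:R * (L * B ^+ 2)) => [|x y h h0 Ky].
  by rewrite mulr_ge0 // mulr_ge0 // exprn_ge0.
have yB : `|y| <= B by apply/rV_norm_leP => // i; exact: support_fun_coor.
have [|z zP ->] := @coordinate_MVT _ _ phi x (h *: y).
  by move=> w _ i; exact: (@test_function_derivable _ _ _ _ tp [::] w i).
(* The gradient at x is separated from its variation along the path, of order h. *)
have -> : \sum_i (h *: y) ord0 i * partial i phi (z i) =
    h * (dotrV y (gradient phi x) + \sum_i y ord0 i * (partial i phi (z i) - partial
      i phi x)).
  rewrite -big_split mulr_sumr; apply: eq_bigr => i _ /=; rewrite !mxE.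
  by ring.
rewrite normrM (ger0_norm h0) ler_wpM2l //; apply: le_trans (ler_normD _ _) _.
apply: lerD.
  have yP := (support_funP hF y).1 Ky; rewrite ler_norml yP andbT lerNl.
  by rewrite -mulN1r -dotrVZr scaleN1r -(finslerN hF (gradient phi x)).
apply: le_trans (ler_norm_sum _ _ _) _.
rewrite mulrCA mulr_natl -[X in _ *+ X]card_ord -sumr_const; apply: ler_sum => i _.
rewrite normrM; apply: (@le_trans _ _ (B * (L * (h * B)))).
  apply: ler_pM => //; first exact: le_trans (coor_le_norm _ _) yB.
  apply: le_trans (LP _ _ _) _; rewrite ler_wpM2l //; apply: le_trans (zP i) _.
  by rewrite normrZ (ger0_norm h0) ler_wpM2l.
by rewrite le_eqVlt; apply/orP; left; apply/eqP; ring.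
Qed.

Lemma measurable_gradient (R : realType) N (Omega : set 'rV[R]_N) (phi : 'rV[R]_N -> R) :
  test_function Omega phi -> measurable_fun setT (gradient phi).
Proof.
move=> tp; apply: measurable_fun_rV => i; under eq_fun do rewrite mxE.
apply: continuous_measurable_rV; exact: (@test_function_continuous _ _ _ _ tp [:: i]).
Qed.

Lemma measurable_finsler_gradient (R : realType) N (F : 'rV[R]_N ->
  R) (hF : finsler_norm F)
    (Omega : set 'rV[R]_N) (phi : 'rV[R]_N -> R) :
  test_function Omega phi -> measurable_fun setT (fun x => F (gradient phi x)).
Proof.
move=> tp; apply: (measurableT_comp (continuous_measurable_rV (finsler_continuous hF))).
exact: measurable_gradient tp.
Qed.

Lemma finsler_gradient_bounded (R : realType) N (F : 'rV[R]_N -> R) (hF : finsler_norm F)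
    (Omega : set 'rV[R]_N) (phi : 'rV[R]_N -> R) :
  test_function Omega phi -> exists2 C, 0 <= C & forall x, F (gradient phi x) <= C.
Proof.
move=> tp.
have H (i : 'I_N) : exists m, 0 <= m /\ forall x, `|partial i phi x| <= m.
  by have [M M0 h] := test_function_bounded tp [:: i]; exists M.
have [M MP] := fin_all_exists H.
have M0 : 0 <= \sum_i M i by apply: sumr_ge0 => i _; case: (MP i).
exists (finsler_bound F * \sum_i M i) => [|x].
  by rewrite mulr_ge0 ?(finsler_bound_ge0 hF).
apply: le_trans (finsler_le hF _) _; rewrite ler_wpM2l ?(finsler_bound_ge0 hF)//.
apply/rV_norm_leP => // i; rewrite mxE; have [_ h] := MP i; apply: le_trans (h x) _.
by rewrite (bigD1 i) //= lerDl; apply: sumr_ge0 => j _; case: (MP j).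
Qed.

Lemma support_funN (R : realType) N (F : 'rV[R]_N -> R) (hF : finsler_norm F) x :
  support_fun F x <= 1 -> support_fun F (- x) <= 1.
Proof.
move=> /(support_funP hF) h; apply/(support_funP hF) => xi.
by rewrite -scaleN1r dotrVZl -dotrVZr scaleN1r -(finslerN hF); exact: h.
Qed.

(** The hypothesis on v(x + h y) says that {w > s} contains {v > s} + h K, with K the polar ball.
    Brunn-Minkowski followed by the tangent inequality bounds the gain in measure from below by N
    rho^(N-1) h kap, and the band v <= s < w is exactly that gain. *)
Lemma superlevel_growth (R : realType) N (F : 'rV[R]_N -> R) (hF : finsler_norm F)
    (Omega : set 'rV[R]_N) (r : R) (Or : forall x, Omega x -> forall i, `|x ord0 i| <= r)
    (v w : 'rV[R]_N -> R) (s h rho kap : R) : (0 < N)%N ->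
  measurable_fun setT v -> measurable_fun setT w ->
  0 < h -> 0 < rho -> 0 < kap ->
  (forall x, s < v x -> Omega x) ->
  (forall x, v x <= w x) ->
  (forall x y, support_fun F y <= 1 -> v (x + h *: y) <= w x) ->
  ((kap ^+ N)%:E <= lebesgue_rV R N [set x | support_fun F x <= 1]%R)%E ->
  ((rho ^+ N)%:E <= lebesgue_rV R N [set x | s < v x]%R)%E ->
  ((N%:R * rho ^+ N.-1 * (h * kap))%:E <= lebesgue_rV R N [set x | v x <= s < w x]%R)%E.
Proof.
case: N => // n in F hF Omega Or v w *; move=> _ mv mw h0 rho0 kap0 vO vw vhw kapK rhov.
set mu := lebesgue_rV R n.+1 in kapK rhov *.
set K := mkset _ in kapK; set A := mkset _ in rhov; set D := mkset _.
pose C := [set x | s < w x].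
have msup (f : 'rV[R]_n.+1 -> R) : measurable_fun setT f -> measurable [set x | s < f x].
  move=> mf; rewrite -[X in measurable X]setTI.
  exact: (@measurable_fun_ltr _ _ R setT (cst s) f (measurable_cst s) mf).
have mA : measurable A by exact: msup.
have mC : measurable C by exact: msup.
have DE : D = C `\` A.
  apply/seteqP; split => x /=; first by move=> /andP[h1 h2]; split => //=;
    rewrite /A /= ltNge h1.
  by move=> [h1 /negP]; rewrite -leNgt => h2; apply/andP; split.
have mD : measurable D by rewrite DE; exact: measurableD.
have mK : measurable K by exact: measurable_dual_ball.
have Ar x : A x -> forall i, `|x ord0 i| <= r by move=> /vO; exact: Or.
have CE : mu C = (mu A + mu D)%E.
  rewrite (_ : C = A `|` D) ?measureU//.
    by apply/seteqP; split => x //; rewrite DE => -[Ax [_]].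
  rewrite DE; apply/seteqP; split => x; last first.
    by case=> [Ax|[]//]; apply: lt_le_trans Ax (vw x).
  by move=> Cx; have [Ax|Ax] := pselect (A x); [left|right].
have Afin : mu A \is a fin_num.
  rewrite ge0_fin_numE ?measure_ge0//.
  apply: le_lt_trans (lebesgue_rV_box_le (normr_ge0 r) mA _) (ltry _).
  by move=> x Ax i; apply: le_trans (Ar x Ax i) (ler_norm r).
pose hK := [set x | K (h^-1 *: x)].
have mhK : measurable hK by exact: measurable_scale_rV.
have h10 : 0 < h^-1 by rewrite invr_gt0.
have hKE : (((h * kap) ^+ n.+1)%:E <= mu hK)%E.
  have := @lebesgue_rV_scale R n.+1 h^-1 K h10 mK; rewrite invrK => E.
  rewrite [leRHS]E exprMn EFinM; apply: lee_wpmul2l => //.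
  by rewrite lee_fin exprn_ge0 // ltW.
have a0 : 0 < fine (mu A).
  rewrite -lte_fin fineK //; apply: lt_le_trans rhov.
  by rewrite lte_fin exprn_gt0.
(* The exact radius of A is needed, and not only its lower bound rho, since the measure of A itself
   is subtracted at the end. *)
have [x x0 xA] := @exists_root R n.+1 _ isT a0.
have xrho : rho <= x.
  have := rhov; rewrite -(fineK Afin) lee_fin -xA.
  by rewrite ler_pXn2r // nnegrE ltW.
have BM : (((x + h * kap) ^+ n.+1)%:E <= mu C)%E.
  pose B := finsler_bound F.
  have B0 : 0 <= B by exact: finsler_bound_ge0.
  apply: (@brunn_minkowski R n.+1 (`|r| + h * B) A hK) => //.
  - move=> z Az i; apply: le_trans (Ar z Az i) _;
    rewrite (le_trans (ler_norm r)) // lerDl.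
    by rewrite mulr_ge0 // ltW.
  - move=> z Kz i; have := support_fun_coor hF i Kz; rewrite mxE normrM gtr0_norm //.
    rewrite ler_pdivrMl // => zB; apply: le_trans zB _.
    by rewrite lerDr.
  (* The point a is reached from a + b in the direction -b, so the symmetry of the polar ball
     enters. *)
  - move=> a b Aa Kb; rewrite /C /=; apply: lt_le_trans Aa _.
    have := vhw (a + b) (- (h^-1 *: b)) (support_funN hF Kb).
    by rewrite scalerN scalerA mulfV ?gt_eqF // scale1r addrK.
  - exact: mulr_gt0.
  - by rewrite xA fineK.
have hk0 : 0 <= h * kap by rewrite mulr_ge0 // ltW.
have T := @pow_tangent R (x + h * kap) x n (addr_ge0 (ltW x0) hk0) (ltW x0).
rewrite [x + _]addrC addrK [_ + x]addrC in T.
have : ((x ^+ n.+1 + n.+1%:R * x ^+ n * (h * kap))%:E <= mu A + mu D)%E.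
  by rewrite -CE; apply: le_trans BM; rewrite lee_fin.
rewrite EFinD xA fineK // leeD2lE // => le; apply: le_trans le; rewrite lee_fin.
rewrite ler_wpM2r // ler_wpM2l //.
by rewrite lerXn2r // nnegrE ltW.
Qed.

Lemma measurable_level_band (R : realType) d (T : measurableType d) (v : T ->
  R) (a b : R) :
  measurable_fun setT v -> measurable [set x | a <= v x <= b].
Proof.
move=> mv; rewrite (_ : mkset _ = v @^-1` `[a, b]);
  first by rewrite -[X in measurable X]setTI; exact: mv.
by apply/seteqP; split => x /=; rewrite in_itv.
Qed.

(** Growth of superlevel sets is integrated over the levels in ]t, t+e[, divided by h, and h is
    taken small. The margin between t' and t accommodates the enlargement of v; t' > 0 keeps the
    band inside Omega, hence of finite measure. *)
Lemma isoperimetric_test (R : realType) N (F : 'rV[R]_N -> R) (hF : finsler_norm F)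
    (Omega : set 'rV[R]_N) (r : R) (Or : forall x, Omega x -> forall i, `|x ord0 i| <= r)
    (phi : 'rV[R]_N -> R) (tp : test_function Omega phi) (t' t e rho kap : R) :
  (0 < N)%N -> measurable Omega ->
  0 < t' -> t' < t -> 0 < e -> 0 < rho -> 0 < kap ->
  ((kap ^+ N)%:E <= lebesgue_rV R N [set x | support_fun F x <= 1]%R)%E ->
  ((rho ^+ N)%:E <= lebesgue_rV R N [set x | t + e < `|phi x|]%R)%E ->
  ((N%:R * rho ^+ N.-1 * kap * e)%:E <=
   \int[lebesgue_rV R N]_(x in [set x | (t' <= `|phi x| <= t + e)%R]) (F (gradient
     phi x))%:E)%E.
Proof.
move=> N0 mO t'0 t't e0 rho0 kap0 kapK rhov.
set mu := lebesgue_rV R N in kapK rhov *; set E := mkset _.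
pose v x := `|phi x|.
have mphi : measurable_fun setT phi.
  by apply: continuous_measurable_rV; exact: (@test_function_continuous _ _ _ _ tp [::]).
have mv : measurable_fun setT v by exact: measurableT_comp.
have mF := measurable_finsler_gradient hF tp.
have mE : measurable E by exact: measurable_level_band.
have vO x : 0 < v x -> Omega x.
  by rewrite /v normr_gt0; exact: test_function_supp.
have EO : E `<=` Omega by move=> x /andP[h _]; apply: vO; exact: lt_le_trans h.
have Ofin : mu Omega \is a fin_num.
  rewrite ge0_fin_numE ?measure_ge0//.
  apply: le_lt_trans (lebesgue_rV_box_le (normr_ge0 r) mO _) (ltry _).
  by move=> x Ox i; apply: le_trans (Or x Ox i) (ler_norm r).
have Efin : mu E \is a fin_num.
  rewrite ge0_fin_numE ?measure_ge0//; apply: (@le_lt_trans _ _ (mu Omega)).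
    by apply: le_measure; rewrite ?inE.
  by rewrite -ge0_fin_numE ?measure_ge0.
pose m := fine (mu E).
have m0 : 0 <= m by rewrite fine_ge0 ?measure_ge0.
have [C1 C10 FC1] := finsler_gradient_bounded hF tp.
have [C2 C20 incr] := test_function_increment hF tp.
apply/lee_addgt0Pr => eps eps0.
(* The three bounds give h C2 <= C2, then g <= t - t', and finally an error h C2 m of at most
   eps. *)
pose h := Num.min 1 (Num.min ((t - t') / (C1 + C2 + 1)) (eps / (C2 * m + 1))).
have d10 : 0 < C1 + C2 + 1 by rewrite ltr_wpDl // addr_ge0.
have d20 : 0 < C2 * m + 1 by rewrite ltr_wpDl // mulr_ge0.
have h0 : 0 < h by rewrite /h !lt_min ltr01 !divr_gt0 // subr_gt0.
have h1 : h <= 1 by rewrite /h ge_min lexx.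
have h2 : h * (C1 + C2 + 1) <= t - t' by rewrite -ler_pdivlMr // /h !ge_min lexx !orbT.
have h3 : h * (C2 * m + 1) <= eps by rewrite -ler_pdivlMr // /h !ge_min lexx !orbT.
(* v + g dominates the sup-convolution of v by the polar ball of radius h. *)
pose g x := h * (F (gradient phi x) + h * C2).
have g0 x : 0 <= g x by rewrite mulr_ge0 ?addr_ge0 ?(finsler_ge0 hF) ?mulr_ge0 // ltW.
have mg : measurable_fun setT g by apply: measurable_funM => //; exact: measurable_funD.
pose w x := v x + g x.
have mw : measurable_fun setT w by exact: measurable_funD.
have gle x : g x <= t - t'.
  apply: le_trans h2; rewrite ler_wpM2l ?(ltW h0) //.
  have := FC1 x; have : h * C2 <= C2 by rewrite ler_piMl.
  lra.
pose k := N%:R * rho ^+ N.-1 * (h * kap).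
have k0 : 0 <= k by rewrite mulr_ge0 ?mulr_ge0 ?exprn_ge0 // ltW.
have growth s : t < s -> s < t + e -> (k%:E <= mu [set x | (v x <= s < w x)%R])%E.
  move=> ts se; apply: (superlevel_growth hF Or) => //.
  - by move=> x sx; apply: vO; apply: lt_trans sx; apply: lt_trans ts;
    exact: lt_trans t't.
  - by move=> x; rewrite /w lerDl.
  - move=> x y Ky; have := incr x y h (ltW h0) Ky; rewrite /w /g /v => le1.
    by rewrite -(subrK (phi x) (phi (x + h *: y))) (le_trans (ler_normD _ _)) //
      addrC lerD2l.
  apply: le_trans rhov _; apply: le_measure.
  - by rewrite inE -[X in measurable X]setTI;
    exact: (@measurable_fun_ltr _ _ R setT (cst (t + e)) v (measurable_cst _) mv).
  - by rewrite inE -[X in measurable X]setTI;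
    exact: (@measurable_fun_ltr _ _ R setT (cst s) v (measurable_cst _) mv).
  - by move=> x /=; exact: lt_trans.
have LC := @layer_cake _ _ R mu v w
  (\1_(`]t, t + e[%classic)) mv mw (measurable_indic (measurable_itv `]t, t + e[))
  (fun s => ler0n _ _).
(* A level of ]t, t+e[ between v x and w x forces t' <= v x <= t + e, because g <= t - t'; the inner
   integral is then at most the length g x of the interval. *)
have upper : (\int[mu]_x \int[lebesgue_measure]_(s in `[v x, w x[)
      ((\1_(`]t, t + e[%classic) s)%:E : \bar R)
     <= \int[mu]_(x in E) (g x)%:E)%E.
  rewrite [leRHS]integral_mkcond; apply: ge0_le_integral => //.
  - by move=> x _; apply: integral_ge0 => s _; rewrite lee_fin.
  - by apply: measurable_layer_inner => //; exact: measurable_indic.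
  - by apply: (measurable_restrictT _ mE).1; apply: measurable_funTS;
    exact/measurable_EFinP.
  move=> x _; rewrite integral_indic // patchE; case: ifPn => xE.
    apply: (@le_trans _ _ (lebesgue_measure (`[v x, w x[%classic : set R))).
      by apply: le_measure; rewrite ?inE //; (exact: measurableI || exact: subIsetr).
    rewrite lebesgue_measure_itv /= lte_fin; case: ifPn => _; last by rewrite lee_fin.
    by rewrite -EFinB lee_fin /w addrC addKr.
  rewrite (_ : _ `&` _ = set0) ?measure0 //; apply/seteqP; split => s //=.
  rewrite !in_itv /= => -[/andP[ts se] /andP[vs sw]]; move/negP: xE; apply;
    rewrite inE /E /=.
  rewrite -/(v x); apply/andP; split; last exact: le_trans vs (ltW se).
  by have := gle x; move: sw; rewrite /w; lra.
have lower : ((k * e)%:E <= \int[lebesgue_measure]_s ((\1_(`]t,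
  t + e[%classic) s)%:E * mu [set x | (v x <= s < w x)%R]))%E.
  refine (@le_trans _ _ (\int[lebesgue_measure]_(s in `]t, (t + e)%R[) (k%:E))%E _ _ _ _).
    rewrite integral_cst //= lebesgue_measure_itv /= lte_fin ltrDl e0 -EFinB -EFinM.
    by rewrite [t + e]addrC addrK.
  rewrite integral_mkcond; apply: ge0_le_integral => //.
  - by move=> s _; rewrite patchE; case: ifPn.
  - by apply: (measurable_restrictT _ (measurable_itv _)).1.
  - by apply: measurable_layer_outer => //; exact: measurable_indic.
  move=> s _; rewrite patchE indicE; case: ifPn => [|_]; last by rewrite mul0e.
  by rewrite inE /= in_itv /= mul1e => /andP[]; exact: growth.
have hE : (0%R < h%:E)%E by rewrite lte_fin.
rewrite -(@lee_pmul2l _ h%:E) //.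
have -> : (h%:E * (N%:R * rho ^+ N.-1 * kap * e)%:E = (k * e)%:E)%E.
  by rewrite -EFinM; congr EFin; rewrite /k; ring.
apply: le_trans lower _; rewrite -LC; apply: le_trans upper _.
have -> : (\int[mu]_(x in E) (g x)%:E = h%:E * (\int[mu]_(x in E) (F (gradient phi
  x))%:E + (h * C2 * m)%:E))%E.
  have mF' : measurable_fun E (fun x => F (gradient phi x)) by exact: measurable_funTS.
  have {}mF' : measurable_fun E (fun x =>
    (F (gradient phi x))%:E) by apply/measurable_EFinP.
  transitivity (\int[mu]_(x in E) (h%:E * ((F (gradient phi x))%:E + (h * C2)%:E)))%E.
    by apply: eq_integral => x _; rewrite -EFinD -EFinM.
  have hC0 : 0 <= h * C2 by rewrite mulr_ge0 // ltW.
  rewrite ge0_integralZl //.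
  - rewrite ge0_integralD //.
    + by rewrite integral_cst // [in RHS]EFinM fineK.
    + by move=> x _; rewrite lee_fin; exact: finsler_ge0 hF _.
  - exact: emeasurable_funD.
  - by move=> x _; rewrite -EFinD lee_fin addr_ge0 ?(finsler_ge0 hF).
  - by rewrite lee_fin ltW.
apply: lee_wpmul2l; first exact: ltW.
rewrite leeD2l // lee_fin; apply: le_trans h3; rewrite -mulrA ler_wpM2l ?(ltW h0) //.
by rewrite lerDl.
Qed.

(** * Passage to the Sobolev space *)

(** A subsequence with integrals at most 2^-(j+1) has an integrable sum. Where this sum is finite,
    the terms tend to 0 and the sum dominates each of them. *)
Lemma dominated_subsequence d (T : measurableType d) (R : realType)
    (mu : {measure set T -> \bar R}) (D : set T) (H : nat -> T -> R) :
  measurable D -> (forall j, measurable_fun D (H j)) -> (forall j x, 0 <= H j x) ->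
  (\int[mu]_(x in D) (H j x)%:E)%E @[j --> \oo] --> 0%E ->
  exists (k : nat -> nat) (S : T -> R), mu.-integrable D (EFin \o S) /\
    \forall x \ae mu, D x ->
      H (k j) x @[j --> \oo] --> (0 : R) /\ forall j, H (k j) x <= S x.
Proof.
move=> mD mH H0 H_cvg.
have /choice[k kP] (j : nat) : exists i,
  (\int[mu]_(x in D) (H i x)%:E <= (1 / (2 ^ j.+1)%:R)%:E)%E.
  have e0 : 0 < 1 / (2 ^ j.+1)%:R :> R by rewrite divr_gt0 // ltr0n expn_gt0.
  have /fine_cvgP[fin cv] := H_cvg.
  have [i _ iP] := filterI fin (@cvgr_lt _ _ _ _ _ _ cv _ e0).
  exists i; have [f1 f2] := iP i (leqnn i).
  by rewrite -(fineK f1) lee_fin; exact: ltW.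
pose S x := (\sum_(0 <= j <oo) (H (k j) x)%:E)%E.
have mHE j : measurable_fun D (fun x => (H (k j) x)%:E) by exact/measurable_EFinP.
have S0 x : (0 <= S x)%E by apply: nneseries_ge0 => j _ _; rewrite lee_fin.
have mS : measurable_fun D S.
  by apply: ge0_emeasurable_sum => // j x _ _; rewrite lee_fin.
have iS : mu.-integrable D S.
  apply/integrableP; split=> //.
  rewrite (eq_integral S); last by move=> x _; rewrite gee0_abs.
  rewrite integral_nneseries //; last by move=> j x _; rewrite lee_fin.
  apply: (@le_lt_trans _ _ 1%E); last exact: ltry.
  apply: le_trans (@epsilon_trick0 R 1 xpredT ler01).
  apply: lee_nneseries => [j _ _|j _]; last exact: kP.
  by apply: integral_ge0 => x _; rewrite lee_fin.
exists k, (fine \o S); split.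
  apply: le_integrable iS => //.
    by apply/measurable_EFinP; exact: (measurableT_comp (fine_measurable measurableT) mS).
  move=> x _ /=; case: (S x) (S0 x) => [s||] //=.
  by rewrite normr0 leey.
apply: filterS (integrable_ae mD iS) => x Sfin Dx.
have SE : S x = (fine (S x))%:E by rewrite fineK // Sfin.
have part n : series (fun j => H (k j) x) n <= fine (S x).
  rewrite -lee_fin -SE /series /= -sumEFin; apply: nneseries_lim_ge => j _ _.
  by rewrite lee_fin.
split.
  apply: cvg_series_cvg_0; apply: nondecreasing_is_cvgn.
    apply: nondecreasing_series => j _ _; exact: H0.
  by exists (fine (S x)) => _ [n _ <-].
move=> j; apply: le_trans (part j.+1); rewrite /series /= big_nat_recr //= lerDr.
by apply: sumr_ge0.
Qed.

Lemma integral_Lp_norm (R : realType) n (Omega : set 'rV[R]_n) N (f : 'rV[R]_n -> R) :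
  (0 < N)%N -> measurable Omega ->
  (\int[lebesgue_rV R n]_(x in Omega) (`|f x| ^+ N)%:E = Lp_norm Omega N%:R f `^ N%:R)%E.
Proof.
move=> N0 mO; rewrite /Lp_norm poweR_Lnorm ?pnatr_eq0 -?lt0n //.
rewrite [LHS]integral_mkcond; apply: eq_integral => x _ /=.
rewrite !patchE; case: ifPn => _; first by rewrite powR_mulrn.
by rewrite normr0 powR0 // pnatr_eq0 -lt0n.
Qed.

Lemma integral_cvg_Lp_norm (R : realType) n (Omega : set 'rV[R]_n) N
    (f : nat -> 'rV[R]_n -> R) : (0 < N)%N -> measurable Omega ->
  Lp_norm Omega N%:R (f j) @[j --> \oo] --> 0%E ->
  (\int[lebesgue_rV R n]_(x in Omega) (`|f j x| ^+ N)%:E)%E @[j --> \oo] --> 0%E.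
Proof.
move=> N0 mO /fine_cvgP[fin cv].
have cv' : (fine (Lp_norm Omega N%:R (f j))) ^+ N @[j --> \oo] --> (0 : R).
  have -> : (0 : R) = 0 ^+ N by rewrite expr0n -[N]prednK.
  exact: (@continuous_cvg _ _ _ _ _ _ (fun x : R =>
    x ^+ N) 0 (@exprn_continuous R N 0) cv).
have E : \forall j \near \oo, (((fine (Lp_norm Omega N%:R (f j))) ^+ N)%:E =
    \int[lebesgue_rV R n]_(x in Omega) (`|f j x| ^+ N)%:E)%E.
  apply: filterS fin => j fj; rewrite integral_Lp_norm // -[in RHS](fineK fj).
  by rewrite poweR_EFin powR_mulrn // fine_ge0 // Lnorm_ge0.
apply: cvg_trans (near_eq_cvg E) _.
by apply/fine_cvgP; split; [exact: nearW|exact: cv'].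
Qed.

Lemma in_Lp_integrable (R : realType) n (Omega : set 'rV[R]_n) N (f : 'rV[R]_n -> R) :
  (0 < N)%N -> measurable Omega -> in_Lp Omega N%:R f ->
  (lebesgue_rV R n).-integrable Omega (fun x => (`|f x| ^+ N)%:E).
Proof.
move=> N0 mO [mf fin]; apply/integrableP; split.
  by apply/measurable_EFinP; apply: measurable_funX; exact: measurableT_comp.
under eq_integral => x _ do rewrite gee0_abs ?lee_fin ?exprn_ge0//.
by rewrite integral_Lp_norm // poweR_lty.
Qed.

Lemma norm_exp_le_sum (R : realType) n (v : 'rV[R]_n) N : (0 < N)%N ->
  `|v| ^+ N <= \sum_i `|v ord0 i| ^+ N.
Proof.
move=> N0; have [->|v0] := eqVneq `|v| 0.
  by rewrite expr0n -[N]prednK //=; apply: sumr_ge0 => i _; exact: exprn_ge0.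
have [[i j] E] : exists ij, `|v| = `|v ij.1 ij.2| := mx_norm_neq0 v0.
rewrite E /= (ord1 i) (bigD1 j) //= lerDl.
by apply: sumr_ge0 => k _; exact: exprn_ge0.
Qed.

Lemma expD_le (R : realType) (a b : R) N : 0 <= a -> 0 <= b ->
  (a + b) ^+ N <= 2 ^+ N * (a ^+ N + b ^+ N).
Proof.
move=> a0 b0; have [ab|ba] := leP a b.
  apply: (@le_trans _ _ ((2 * b) ^+ N));
    first by rewrite lerXn2r ?nnegrE ?addr_ge0 ?mulr_ge0 //; lra.
  by rewrite exprMn ler_wpM2l ?exprn_ge0 // lerDr exprn_ge0.
apply: (@le_trans _ _ ((2 * a) ^+ N));
  first by rewrite lerXn2r ?nnegrE ?addr_ge0 ?mulr_ge0 //; lra.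
by rewrite exprMn ler_wpM2l ?exprn_ge0 // lerDl exprn_ge0.
Qed.

Lemma cvg_of_exp_norm (R : realType) (a : nat -> R) (l : R) (H : nat ->
  R) N : (0 < N)%N ->
  (forall j, `|a j - l| ^+ N <= H j) -> H j @[j --> \oo] --> (0 : R) ->
    a j @[j --> \oo] --> l.
Proof.
move=> N0 aH H0; apply/cvgrPdist_lt => e e0.
have H1 : \forall j \near \oo, H j < e ^+ N by apply: (cvgr_lt 0) => //; exact: exprn_gt0.
move: H1; apply: filterS => j He.
rewrite distrC -(@ltr_pXn2r _ N) // ?nnegrE ?(ltW e0) //.
exact: le_lt_trans (aH j) He.
Qed.

(** Norm convergence is traded for almost everywhere convergence with an integrable majorant of the
    N-th powers of the gradients, the form in which dominated convergence is applied from here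
    on. *)
Lemma sobolev_approx (R : realType) N (Omega : set 'rV[R]_N) (u : 'rV[R]_N -> R)
    (G : 'rV[R]_N -> 'rV[R]_N) : (0 < N)%N -> measurable Omega ->
  sobolev1_0 Omega N%:R u G ->
  exists (phi : nat -> 'rV[R]_N -> R) (S : 'rV[R]_N -> R),
  [/\ forall j, test_function Omega (phi j),
      (lebesgue_rV R N).-integrable Omega (EFin \o S) &
      \forall x \ae lebesgue_rV R N, Omega x ->
      [/\ phi j x @[j --> \oo] --> u x,
          forall i, partial i (phi j) x @[j --> \oo] --> G x ord0 i,
          `|G x| ^+ N <= S x &
          forall j, `|gradient (phi j) x| ^+ N <= S x]].
Proof.
move=> N0 mO [[uL GL _] [phi [tphi cu cG]]].
have mphi j s : measurable_fun Omega (partials s (phi j)).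
  apply: measurable_funTS; apply: continuous_measurable_rV.
  exact: (@test_function_continuous _ _ _ _ (tphi j) s).
have [mu_ _] := uL.
have mG i : measurable_fun Omega (fun x => G x ord0 i) by case: (GL i).
pose H0 j x := `|phi j x - u x| ^+ N.
pose Hi i j x := `|partial i (phi j) x - G x ord0 i| ^+ N.
have mH0 j : measurable_fun Omega (H0 j).
  apply: measurable_funX; apply: measurableT_comp => //.
  by apply: measurable_funB => //; exact: (mphi j [::]).
have mHi i j : measurable_fun Omega (Hi i j).
  apply: measurable_funX; apply: measurableT_comp => //.
  by apply: measurable_funB => //; exact: (mphi j [:: i]).
(* Adding the N-th powers of all differences lets a single subsequence serve the function and every
   partial derivative. *)
pose H j x := H0 j x + \sum_i Hi i j x.
have Hi0 i j x : 0 <= Hi i j x by exact: exprn_ge0.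
have H00 j x : 0 <= H0 j x by exact: exprn_ge0.
have Hp j x : 0 <= H j x by rewrite addr_ge0 //; apply: sumr_ge0.
have mH j : measurable_fun Omega (H j).
  by apply: measurable_funD => //; apply: measurable_sum.
have HE j : (\int[lebesgue_rV R N]_(x in Omega) (H j x)%:E =
    \int[lebesgue_rV R N]_(x in Omega) (H0 j x)%:E +
    \sum_i \int[lebesgue_rV R N]_(x in Omega) (Hi i j x)%:E)%E.
  rewrite -ge0_integral_sum //; last 2 first.
  - by move=> i; exact/measurable_EFinP.
  - by move=> i x _; rewrite lee_fin.
  rewrite -ge0_integralD //.
  - by apply: eq_integral => x _; rewrite sumEFin -EFinD.
  - by move=> x _; rewrite lee_fin.
  - exact/measurable_EFinP.
  - by move=> x _; apply: sume_ge0 => i _; rewrite lee_fin.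
  - by apply: emeasurable_sum => i; exact/measurable_EFinP.
have cH : (\int[lebesgue_rV R N]_(x in Omega) (H j x)%:E)%E @[j --> \oo] --> 0%E.
  under eq_fun do rewrite HE.
  have c1 : (\sum_i \int[lebesgue_rV R N]_(x in Omega) (Hi i j x)%:E)%E @[j --> \oo]
      --> (\sum_(i < N) 0 : \bar R)%E.
    apply: cvg_nnesum => i _; last exact: (integral_cvg_Lp_norm N0 mO (cG i)).
    by apply: nearW => j; apply: integral_ge0 => x _; rewrite lee_fin.
  rewrite big1 // in c1.
  have c2 := integral_cvg_Lp_norm N0 mO cu.
  have := cvgeD _ c2 c1; rewrite adde0; exact.
have [k [S [iS Sae]]] := dominated_subsequence mO mH Hp cH.
have iG : (lebesgue_rV R N).-integrable Omega (fun x => (\sum_i `|G x ord0 i| ^+ N)%:E).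
  under eq_fun do rewrite -sumEFin.
  apply: integrable_sum => // i _; exact: in_Lp_integrable.
(* The factor 2^N comes from (a + b)^N <= 2^N (a^N + b^N), with the gradient of phi split into G and
   the difference from G. *)
exists (fun j => phi (k j)), (fun x => 2 ^+ N * (\sum_i `|G x ord0 i| ^+ N + S x)).
have two1 : 1 <= 2 ^+ N :> R by rewrite exprn_ege1 // ler1n.
split=> //.
  have := integrableZl mO (2 ^+ N) (integrableD mO iG iS).
  by apply: eq_integrable => // x _ /=; rewrite -EFinD -EFinM.
apply: filterS Sae => x Sx Dx; have [c b] := Sx Dx.
have sumle i j : Hi i j x <= H j x.
  rewrite /H (bigD1 i) //= addrCA lerDl addr_ge0 //; exact: sumr_ge0.
have S0 : 0 <= S x by exact: le_trans (Hp _ _) (b 0%N).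
split.
- apply: (cvg_of_exp_norm N0 _ c) => j.
  by rewrite /H lerDl; exact: sumr_ge0.
- by move=> i; apply: (cvg_of_exp_norm N0 _ c) => j; exact: sumle.
- apply: le_trans (norm_exp_le_sum _ N0) _.
  rewrite -[X in X <= _]mul1r ler_pM ?ler01 ?sumr_ge0 ?lerDl // => i _; exact: exprn_ge0.
- move=> j; rewrite -(subrK (G x) (gradient (phi (k j)) x)).
  apply: (@le_trans _ _ ((`|gradient (phi (k j)) x - G x| + `|G x|) ^+ N)).
    by rewrite lerXn2r ?nnegrE ?addr_ge0 // ler_normD.
  apply: le_trans (expD_le _ _ _) _ => //; rewrite ler_wpM2l ?exprn_ge0 // addrC lerD //.
    exact: norm_exp_le_sum.
  apply: le_trans (norm_exp_le_sum _ N0) _; apply: le_trans (b j); rewrite /H.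
  under eq_bigr do rewrite !mxE.
  by rewrite lerDr.
Qed.

(** * Isoperimetric inequality in the Sobolev space *)

Lemma dominated_convergence_real d (T : measurableType d) (R : realType)
    (mu : {measure set T -> \bar R}) (D : set T) (f_ : nat -> T -> R) (f g : T -> R) :
  measurable D -> (forall j, measurable_fun D (f_ j)) -> measurable_fun D f ->
  mu.-integrable D (EFin \o g) ->
  (\forall x \ae mu, D x -> f_ j x @[j --> \oo] --> f x) ->
  (\forall x \ae mu, D x -> forall j, `|f_ j x| <= g x) ->
  mu.-integrable D (EFin \o f) /\
  (\int[mu]_(x in D) (f_ j x)%:E)%E @[j --> \oo] --> (\int[mu]_(x in D) (f x)%:E)%E.
Proof.
move=> mD mf_ mf ig cf bf.
have [|||||h1 _ h3] := @dominated_convergence _ _ _ mu D mD (fun j =>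
  EFin \o f_ j) (EFin \o f) (EFin \o g).
- by move=> j; exact/measurable_EFinP.
- exact/measurable_EFinP.
- apply: filterS cf => x cx Dx; apply/fine_cvgP; split; first exact: nearW.
  exact: cx.
- exact: ig.
- by apply: filterS bf => x bx j Dx; rewrite /= lee_fin; exact: bx.
by split.
Qed.

(** A continuous substitute for an indicator: its integrals pass to the limit along the approximants
    even where u has a level set of positive measure. *)
Definition ramp (R : realType) (z : R) : R := Num.min 1 (Num.max 0 z).

Lemma ramp01 (R : realType) (z : R) : 0 <= ramp z <= 1.
Proof. by rewrite /ramp le_min ler01 le_max lexx ge_min lexx. Qed.

Lemma ramp0 (R : realType) (z : R) : z <= 0 -> ramp z = 0.
Proof. by move=> z0; rewrite /ramp (max_idPl z0) (min_idPr ler01). Qed.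

Lemma ramp1 (R : realType) (z : R) : 1 <= z -> ramp z = 1.
Proof.
by move=> z1; rewrite /ramp (max_idPr (le_trans ler01 z1)) (min_idPl z1).
Qed.

Lemma ramp_continuous (R : realType) : continuous (@ramp R).
Proof.
move=> z; apply: continuous_min; first exact: cst_continuous.
by apply: continuous_max; [exact: cst_continuous|move=> A; exact].
Qed.

Lemma continuous_ramp_comp (R : realType) (h : R -> R) : continuous h ->
  continuous (fun y => ramp (h y)).
Proof.
by move=> ch y; exact: (@continuous_cvg _ _ _ _ _ h (@ramp R) (h y) (@ramp_continuous
  R _) (ch y)).
Qed.

Lemma cvg_rV (R : realType) n (x_ : nat -> 'rV[R]_n) (x : 'rV[R]_n) :
  (forall i, x_ j ord0 i @[j --> \oo] --> x ord0 i) -> x_ j @[j --> \oo] --> x.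
Proof.
move=> cx; apply/cvgrPdist_le => e e0.
have : \forall j \near \oo, forall i, `|x ord0 i - x_ j ord0 i| <= e.
  by apply: filter_forall => i; have /cvgrPdist_le := cx i; exact.
apply: filterS => j h; apply/rV_norm_leP; first exact: ltW.
by move=> i; rewrite !mxE.
Qed.

Lemma le_add1_exp (R : realType) (a : R) n : (0 < n)%N -> 0 <= a -> a <= 1 + a ^+ n.
Proof.
move=> n0 a0; have [a1|a1] := leP a 1; first by rewrite (le_trans a1) // lerDl exprn_ge0.
rewrite -[X in X <= _]add0r lerD ?ler01 // -[n]prednK // exprS ler_peMr //.
by rewrite exprn_ege1 // ltW.
Qed.

Section limit.
Variables (R : realType) (N : nat) (F : 'rV[R]_N -> R) (hF : finsler_norm F).
Variables (Omega : set 'rV[R]_N) (r : R).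
Hypotheses (N0 : (0 < N)%N) (mO : measurable Omega).
Hypothesis Or : forall x, Omega x -> forall i, `|x ord0 i| <= r.
Variables (u : 'rV[R]_N -> R) (G : 'rV[R]_N -> 'rV[R]_N).
Hypotheses (mu_ : measurable_fun Omega u).
Hypotheses (mG : forall i, measurable_fun Omega (fun x => G x ord0 i)).
Variables (phi : nat -> 'rV[R]_N -> R) (S : 'rV[R]_N -> R).
Hypothesis tphi : forall j, test_function Omega (phi j).
Hypothesis iS : (lebesgue_rV R N).-integrable Omega (EFin \o S).
Hypothesis approx : \forall x \ae lebesgue_rV R N, Omega x ->
      [/\ phi j x @[j --> \oo] --> u x,
          forall i, partial i (phi j) x @[j --> \oo] --> G x ord0 i,
          `|G x| ^+ N <= S x &
          forall j, `|gradient (phi j) x| ^+ N <= S x].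

Local Notation mu := (lebesgue_rV R N).

Lemma measurable_comp_rV (g : 'rV[R]_N -> R) : measurable_fun setT g ->
  measurable_fun Omega (g \o G).
Proof.
move=> mg; pose G' x := \row_i ((fun y => G y ord0 i) \_ Omega) x.
have mG' : measurable_fun setT G'.
  apply: measurable_fun_rV => i; under eq_fun do rewrite mxE.
  exact: (measurable_restrictT _ mO).1.
have := measurable_funTS (D := Omega) (measurableT_comp mg mG').
apply: eq_measurable_fun => x xO /=; congr (g _); apply/rowP => i.
by rewrite mxE patchE xO.
Qed.

Lemma domain_finite : (mu Omega < +oo)%E.
Proof.
apply: le_lt_trans (lebesgue_rV_box_le (normr_ge0 r) mO _) (ltry _).
by move=> x Ox i; apply: le_trans (Or Ox i) (ler_norm r).
Qed.

Lemma integrable_const (c : R) : mu.-integrable Omega (EFin \o cst c).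
Proof.
apply/integrableP; split; first exact/measurable_EFinP.
rewrite (eq_integral (cst `|c|%:E)) // integral_cst //.
by rewrite lte_mul_pinfty // domain_finite.
Qed.

(** The inequality for the approximants is applied on a slightly narrower band with a slightly
    smaller radius; the cut-offs [psi] and [chi] compare its two sides with integrals that
    converge. *)
Lemma isoperimetric_sobolev (a b rho kap : R) :
  0 <= a -> a < b -> 0 < rho -> 0 < kap ->
  ((kap ^+ N)%:E <= mu [set x | support_fun F x <= 1]%R)%E ->
  ((rho ^+ N)%:E <= mu (Omega `&` [set x | b < `|u x|]%R))%E ->
  ((N%:R * rho ^+ N.-1 * kap * (b - a))%:E <=
   \int[mu]_(x in Omega `&` [set x | a < `|u x| < b]%R) (F (G x))%:E)%E.
Proof.
move=> a0 ab rho0 kap0 kapK rhou.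
set X := N%:R * _ * _ * _; have X0 : 0 <= X.
  by rewrite /X !mulr_ge0 ?exprn_ge0 ?subr_ge0 // ltW.
apply/lee_mul01Pr; first by rewrite lee_fin.
(* The radius and the width of the band both shrink by the factor th, so N - 1 factors from the
   radius and one from the width make up q = th^N. *)
move=> q /andP[q0 q1]; have [th th0 thq] := @exists_root R N q N0 q0.
have th1 : th < 1.
  by rewrite -(@ltr_pXn2r _ N) // ?nnegrE ?ltW // thq expr1n.
(* The slack in width is cut into three: one third below t', one between t' and t, one above s, so
   that s - t = th (b - a). *)
pose d := (1 - th) * (b - a) / 3.
have d0 : 0 < d by rewrite divr_gt0 // mulr_gt0 // subr_gt0.
have dE : b - a - 3 * d = th * (b - a) by rewrite /d; field.
pose s := b - d; pose t := a + 2 * d; pose t' := a + d.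
have e0 : 0 < th * (b - a) by rewrite mulr_gt0 // subr_gt0.
have tE : t + th * (b - a) = s by rewrite -dE /t /s; ring.
have mphi j : measurable_fun Omega (phi j).
  apply: measurable_funTS; apply: continuous_measurable_rV.
  exact: (@test_function_continuous _ _ _ _ (tphi j) [::]).
(* [psi] is 1 for |y| >= b and 0 for |y| <= s, so it lies between the indicators of two superlevel
   sets. [chi] is 1 for t' <= |y| <= s and vanishes unless a < |y| < b. *)
pose psi (y : R) := ramp ((`|y| - s) / d).
pose chi (y : R) := ramp ((`|y| - a) / d) * ramp ((b - `|y|) / d).
have cpsi : continuous psi.
  by apply: continuous_ramp_comp => y; apply: cvgM; [apply: cvgB;
    [exact: norm_continuous|exact: cvg_cst]|exact: cvg_cst].
have cchi : continuous chi.
  have c1 : continuous (fun y : R => ramp ((`|y| - a) / d)).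
    by apply: continuous_ramp_comp => y; apply: cvgM; [apply: cvgB;
      [exact: norm_continuous|exact: cvg_cst]|exact: cvg_cst].
  have c2 : continuous (fun y : R => ramp ((b - `|y|) / d)).
    by apply: continuous_ramp_comp => y; apply: cvgM; [apply: cvgB;
      [exact: cvg_cst|exact: norm_continuous]|exact: cvg_cst].
  by move=> y; exact: (cvgM (c1 y) (c2 y)).
have [ipsi lpsi] : mu.-integrable Omega (EFin \o (psi \o u)) /\
  (\int[mu]_(x in Omega) (psi (phi j x))%:E)%E @[j --> \oo] --> (\int[mu]_(x in
    Omega) (psi (u x))%:E)%E.
  apply: (@dominated_convergence_real _ _ _ _ _ (fun j =>
    psi \o phi j) (psi \o u) (cst 1)) => //.
  - by move=> j; apply: measurableT_comp => //; exact: continuous_measurable_fun.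
  - by apply: measurableT_comp => //; exact: continuous_measurable_fun.
  - exact: integrable_const.
  - apply: filterS approx => x h Ox; have [c _ _ _] := h Ox.
    exact: (@continuous_cvg _ _ _ _ _ (fun j => phi j x) psi (u x) (cpsi (u x)) c).
  - by apply: aeW => x _ j; have /andP[h1 h2] := ramp01 ((`|phi j x| - s) / d);
    rewrite /= ger0_norm.
have [ichi lchi] : mu.-integrable Omega (EFin \o (fun x => chi (u x) * F (G x))) /\
  (\int[mu]_(x in Omega) (chi (phi j x) * F (gradient (phi j) x))%:E)%E @[j --> \oo]
    --> (\int[mu]_(x in Omega) (chi (u x) * F (G x))%:E)%E.
  apply: (@dominated_convergence_real _ _ _ _ _ (fun j x =>
    chi (phi j x) * F (gradient (phi j) x)) _ (fun x =>
      finsler_bound F * (1 + S x))) => //.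
  - move=> j; apply: measurable_funM.
      by apply: (measurableT_comp (f := chi)) => //; exact: continuous_measurable_fun.
    by apply: measurable_funTS; exact: measurable_finsler_gradient (tphi j).
  - apply: measurable_funM.
      by apply: (measurableT_comp (f := chi)) => //; exact: continuous_measurable_fun.
    apply: measurable_comp_rV; apply: continuous_measurable_rV.
    exact: (finsler_continuous hF).
  - have := integrableZl mO (finsler_bound F) (integrableD mO (integrable_const 1) iS).
    by apply: eq_integrable => // x _ /=; rewrite -EFinD -EFinM.
  - apply: filterS approx => x h Ox; have [c cG _ _] := h Ox.
    apply: cvgM; first exact: (@continuous_cvg _ _ _ _ _ (fun j =>
      phi j x) chi (u x) (cchi (u x)) c).
    have cG' : gradient (phi j) x @[j --> \oo] --> G x.
      by apply: cvg_rV => i; under eq_fun do rewrite mxE; exact: cG.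
    exact: (@continuous_cvg _ _ _ _ _ (fun j =>
      gradient (phi j) x) F (G x) (finsler_continuous hF (x:=G x)) cG').
  - apply: filterS approx => x h Ox j; have [_ _ _ b1] := h Ox.
    have /andP[h1 h2] := ramp01 ((`|phi j x| - a) / d).
    have /andP[h3 h4] := ramp01 ((b - `|phi j x|) / d).
    rewrite normrM ger0_norm ?mulr_ge0 // ger0_norm ?(finsler_ge0 hF) //.
    apply: (@le_trans _ _ (F (gradient (phi j) x))).
      by rewrite ler_piMl ?(finsler_ge0 hF) // mulr_ile1.
    apply: le_trans (finsler_le hF _) _; rewrite ler_wpM2l ?(finsler_bound_ge0 hF) //.
    by apply: le_trans (le_add1_exp N0 (normr_ge0 _)) _; rewrite lerD2l.
have near1 : \forall j \near \oo,
  ((q * X)%:E <= \int[mu]_(x in Omega) (chi (phi j x) * F (gradient (phi j) x))%:E)%E.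
  have mE : measurable (Omega `&` [set x | b < `|u x|]).
    exact: (@measurable_fun_ltr _ _ R Omega (cst b) (fun x =>
      `|u x|) (measurable_cst _) (measurableT_comp _ mu_)).
  have psi1 : ((rho ^+ N)%:E <= \int[mu]_(x in Omega) (psi (u x))%:E)%E.
    apply: le_trans rhou _.
    set E := Omega `&` _ in mE *.
    have -> : (mu E = \int[mu]_(x in Omega) (\1_E x)%:E)%E.
      by rewrite integral_indic // /E setIAC setIid.
    apply: ge0_le_integral => //.
    - by apply/measurable_EFinP; exact: measurable_indic.
    - by apply/measurable_EFinP; apply: (measurableT_comp (f := psi)) => //;
      exact: continuous_measurable_fun.
    move=> x Ox; rewrite lee_fin indicE; case: (boolP (x \in _)) => [|_].
      rewrite inE => -[_ /= bu]; rewrite /psi ramp1 // ler_pdivlMr // mul1r /s; lra.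
    by case/andP: (ramp01 ((`|u x| - s) / d)).
  have lfin := integrable_fin_num mO ipsi.
  (* The inequality is strict because th < 1, hence it persists for the approximants from some index
     on. *)
  have psi2 : (th * rho) ^+ N < fine (\int[mu]_(x in Omega) (psi (u x))%:E)%E.
    rewrite -lte_fin fineK //; apply: lt_le_trans psi1; rewrite lte_fin exprMn thq.
    by rewrite gtr_pMl // exprn_gt0.
  rewrite -[X in _ --> X](fineK lfin) in lpsi.
  have /fine_cvgP[f1 f2] := lpsi.
  have f3 : \forall j \near \oo,
    (th * rho) ^+ N < fine (\int[mu]_(x in Omega) (psi (phi j x))%:E)%E.
    exact: (@cvgr_gt _ _ _ _ _ _ f2 _ psi2).
  apply: (filterS _ (filterI f1 f3)) => j [fj pj].
  have mj : measurable_fun setT (fun x => `|phi j x|).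
    apply: measurableT_comp => //; apply: continuous_measurable_rV.
    exact: (@test_function_continuous _ _ _ _ (tphi j) [::]).
  have supp x : 0 < `|phi j x| -> Omega x.
    by rewrite normr_gt0; exact: (test_function_supp (tphi j)).
  have s0 : 0 < s.
    by rewrite -tE addr_gt0 // /t ltr_wpDl // mulr_gt0.
  have mS : measurable [set x | s < `|phi j x|].
    rewrite -[X in measurable X]setTI.
    exact: (@measurable_fun_ltr _ _ R setT (cst s) (fun x =>
      `|phi j x|) (measurable_cst _) mj).
  have := @isoperimetric_test R N F hF Omega r Or (phi j) (tphi j) t' t (th * (b -
    a)) (th * rho) kap N0 mO.
  have -> : q * X = N%:R * (th * rho) ^+ N.-1 * kap * (th * (b - a)).
    by rewrite /X -thq exprMn; move: (exprSr th N.-1); rewrite prednK // => ->; ring.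
  rewrite tE => iso; apply: le_trans (iso _ _ _ _ _ _ _) _ => {iso} //.
  - by rewrite /t' ltr_wpDl.
  - by rewrite /t' /t ltrD2l; lra.
  - exact: mulr_gt0.
  - apply: (@le_trans _ _ (\int[mu]_(x in Omega) (psi (phi j x))%:E)%E).
      by rewrite -(fineK fj) lee_fin; exact: ltW.
    rewrite (_ : [set x | s < `|phi j x|] = [set x | s < `|phi j x|] `&` Omega);
      last first.
      apply/seteqP; split => [x sx|x []//]; split => //; apply: supp; exact: lt_trans sx.
    rewrite -integral_indic //; apply: ge0_le_integral => //.
    + by move=> x _; rewrite lee_fin; case/andP: (ramp01 ((`|phi j x| - s) / d)).
    + by apply/measurable_EFinP; apply: (measurableT_comp (f := psi)) => //;
      exact: continuous_measurable_fun.
    + by apply/measurable_EFinP; exact: measurable_indic.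
    move=> x Ox; rewrite lee_fin indicE; case: (boolP (x \in _)) => [_|].
      by case/andP: (ramp01 ((`|phi j x| - s) / d)).
    move=> /negP xs; rewrite /psi ramp0 // pmulr_lle0 ?invr_gt0 // subr_le0 leNgt.
    by apply/negP => h; apply: xs; rewrite inE.
  have mB : measurable [set x | t' <= `|phi j x| <= s] by exact: measurable_level_band.
  rewrite integral_mkcond [leRHS]integral_mkcond; apply: ge0_le_integral => //.
  - by move=> x _; rewrite patchE; case: ifPn => // _; rewrite lee_fin;
    exact: finsler_ge0 hF _.
  - apply: (measurable_restrictT _ mB).1; apply: measurable_funTS; apply/measurable_EFinP.
    exact: measurable_finsler_gradient (tphi j).
  - apply: (measurable_restrictT _ mO).1; apply/measurable_EFinP; apply: measurable_funM.
      by apply: (measurableT_comp (f := chi)) => //; exact: continuous_measurable_fun.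
    by apply: measurable_funTS; exact: measurable_finsler_gradient (tphi j).
  move=> x _; rewrite !patchE; case: ifPn => xB; last first.
    case: ifPn => // _; rewrite lee_fin mulr_ge0 ?(finsler_ge0 hF) // mulr_ge0 //.
      by case/andP: (ramp01 ((`|phi j x| - a) / d)).
    by case/andP: (ramp01 ((b - `|phi j x|) / d)).
  move: xB; rewrite inE /= => /andP[x1 x2].
  have t'0 : 0 < t' by rewrite /t' ltr_wpDl.
  rewrite mem_set; last by apply: supp; exact: lt_le_trans x1.
  by rewrite lee_fin /chi !ramp1 ?mul1r // ler_pdivlMr // mul1r; move: x1 x2;
    rewrite /t' /s; lra.
rewrite -EFinM; apply: le_trans (cvge_ge near1 lchi) _.
have mB : measurable (Omega `&` [set x | a < `|u x| < b]).
  have /(_ mO `]a, b[%classic (measurable_itv _)) :=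
    measurableT_comp (@normr_measurable R setT) mu_.
  by congr (measurable (_ `&` _)); apply/seteqP; split => x /=; rewrite in_itv.
rewrite integral_mkcond [leRHS]integral_mkcond; apply: ge0_le_integral => //.
- move=> x _; rewrite patchE; case: ifPn => // _;
  rewrite lee_fin mulr_ge0 ?(finsler_ge0 hF) // mulr_ge0 //.
    by case/andP: (ramp01 ((`|u x| - a) / d)).
  by case/andP: (ramp01 ((b - `|u x|) / d)).
- apply: (measurable_restrictT _ mO).1; apply/measurable_EFinP; apply: measurable_funM.
    by apply: (measurableT_comp (f := chi)) => //; exact: continuous_measurable_fun.
  by apply: measurable_comp_rV; apply: continuous_measurable_rV;
    exact: (finsler_continuous hF).
- apply: (measurable_restrictT _ mB).1; apply/measurable_EFinP.
  apply: (@measurable_funS _ _ _ _ Omega) => //.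
  by apply: measurable_comp_rV; apply: continuous_measurable_rV;
    exact: (finsler_continuous hF).
move=> x _; rewrite !patchE; case: ifPn => xO; last first.
  by case: ifPn => // _; rewrite lee_fin; exact: finsler_ge0 hF _.
have [xB|xB] := boolP (x \in _).
  rewrite lee_fin ler_piMl ?(finsler_ge0 hF) //.
  have /andP[h1 h2] := ramp01 ((`|u x| - a) / d).
  have /andP[h3 h4] := ramp01 ((b - `|u x|) / d).
  exact: mulr_ile1.
rewrite lee_fin /chi.
have [ua|ua] := leP (`|u x|) a.
  by rewrite ramp0 ?mul0r // pmulr_lle0 ?invr_gt0 // subr_le0.
rewrite [X in _ * X * _]ramp0 ?mulr0 ?mul0r // pmulr_lle0 ?invr_gt0 // subr_le0 leNgt.
by apply/negP => ub; move/negP: xB; apply; rewrite inE; split;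
  [rewrite inE in xO|apply/andP].
Qed.

End limit.

(** * Smooth truncations and the energy estimate *)

Definition sigmoid (R : realType) (z : R) : R := 1 - (1 + expR z)^-1.

Definition softplus (R : realType) (z : R) : R := ln (1 + expR z).

Section sigmoid.
Variable R : realType.
Implicit Types z : R.

Let e0 z : 0 < 1 + expR z. Proof. by rewrite addr_gt0 ?expR_gt0. Qed.

Lemma sigmoid_ge0 z : 0 <= sigmoid z.
Proof. by rewrite /sigmoid subr_ge0 invf_le1 // lerDl expR_ge0. Qed.

Lemma sigmoid_le1 z : sigmoid z <= 1.
Proof. by rewrite /sigmoid gerBl invr_ge0 ltW. Qed.

Lemma sigmoid_homo : {homo @sigmoid R : x y / x <= y}.
Proof. by move=> x y xy; rewrite /sigmoid lerB // lef_pV2 ?posrE // lerD2l ler_expR. Qed.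

(** From e^z >= 1 + z. The rate 1/z is crude but enough, since the slope n of the truncations is
    free. *)
Lemma sigmoid_ge z : 0 < z -> 1 - z^-1 <= sigmoid z.
Proof.
move=> z0; rewrite /sigmoid lerB // lef_pV2 ?posrE //.
have := expR_ge1Dx z; lra.
Qed.

Lemma sigmoid_le z : z < 0 -> sigmoid z <= (- z)^-1.
Proof.
move=> z0; have z0' : 0 < - z by rewrite oppr_gt0.
have -> : sigmoid z = (1 + expR (- z))^-1.
  rewrite /sigmoid expRN; have ez := expR_gt0 z; field.
  by rewrite !gt_eqF ?addr_gt0.
rewrite lef_pV2 ?posrE //.
have := expR_ge1Dx (- z); lra.
Qed.

Lemma is_derive_sigmoid z : is_derive z 1 (@sigmoid R) (sigmoid z * (1 - sigmoid z)).
Proof.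
have d1 : is_derive z 1 (fun x => 1 + expR x) (expR z).
  have := is_deriveD (is_derive_cst (1 : R) z 1) (is_derive_expR z).
  by rewrite add0r.
have n0 : 1 + expR z != 0 by rewrite gt_eqF.
have d2 := is_deriveB (is_derive_cst (1 : R) z 1) (is_deriveV (f := fun x =>
  1 + expR x) n0 d1).
apply: is_derive_eq d2 _; rewrite sub0r /sigmoid.
by rewrite -[_ *: _]/(_ * _) -exprVn; field.
Qed.

Lemma is_derive_softplus z : is_derive z 1 (@softplus R) (sigmoid z).
Proof.
have d1 : is_derive z 1 (fun x => 1 + expR x) (expR z).
  have := is_deriveD (is_derive_cst (1 : R) z 1) (is_derive_expR z).
  by rewrite add0r.
have := @is_derive1_comp _ (@ln R) (fun x => 1 + expR x) _ _ _ (is_derive1_ln (e0 z)) d1.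
move=> dH; apply: is_derive_eq dH _; rewrite /sigmoid; field.
by rewrite gt_eqF.
Qed.

Lemma softplus_homo : {homo @softplus R : x y / x <= y}.
Proof. by move=> x y xy; rewrite /softplus ler_ln ?posrE // lerD2l ler_expR. Qed.

Lemma softplus_lip z d : 0 <= d -> softplus (z + d) <= softplus z + d.
Proof.
move=> d0; rewrite /softplus -[in leRHS](expRK d) -lnM ?posrE ?expR_gt0 //.
rewrite ler_ln ?posrE ?mulr_gt0 ?expR_gt0 // mulrDl mul1r -expRD lerD2r.
by rewrite -expR0 ler_expR.
Qed.

(** As the sigmoid solves y' = y - y^2, every derivative of softplus is a polynomial in the sigmoid,
    and differentiation sends the polynomial p to p' (X - X^2). *)
Definition softplus_derivatives (m : nat) : R -> R :=
  if m is k.+1 then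
    horner (iter k (fun p : {poly R} => p^`() * ('X - 'X^2)) 'X) \o @sigmoid R
  else @softplus R.

Lemma smooth1_softplus : smooth1 softplus_derivatives.
Proof.
case=> [|m] z /=.
  by rewrite hornerX; exact: is_derive_softplus.
have := is_derive1_comp (is_derive_poly (iter m (fun p : {poly R} =>
  p^`() * ('X - 'X^2)) 'X) (sigmoid z)) (is_derive_sigmoid z).
by move=> dH; apply: is_derive_eq dH _;
  rewrite hornerM hornerD hornerN hornerX hornerXn; ring.
Qed.

Lemma smooth1_affine (D : nat -> R -> R) (a c d : R) :
  smooth1 D -> smooth1 (fun m y => a * c ^+ m * D m (c * y + d)).
Proof.
move=> sD m y.
have d1 : is_derive y 1 (fun x : R => c * x + d) c.
  have := is_deriveD (is_deriveZ c (is_derive_id y 1)) (is_derive_cst d y 1).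
  by move=> dH; apply: is_derive_eq dH _; rewrite addr0 -[_ *: _]/(_ * _) mulr1.
have := is_deriveZ (a * c ^+ m) (@is_derive1_comp _ (D m) (fun x =>
  c * x + d) _ _ _ (sD m (c * y + d)) d1).
by move=> dH; apply: is_derive_eq dH _; rewrite -[_ *: _]/(_ * _) exprSr; ring.
Qed.

Lemma smooth1D (D E : nat -> R -> R) :
  smooth1 D -> smooth1 E -> smooth1 (fun m y => D m y + E m y).
Proof. by move=> sD sE m y; exact: is_deriveD. Qed.

(* [truncation n a b 0] is an odd smooth approximation of
   y |-> sgn(y) min(max(|y| - a, 0), b - a) and [truncation n a b m] is its m-th
   derivative; for m = 1 it tends to the indicator of a < |y| < b as n grows. *)
Definition truncation (n a b : R) (m : nat) (y : R) : R :=
  (n^-1 * n ^+ m * softplus_derivatives m (n * y + - (n * a)) +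
   - n^-1 * n ^+ m * softplus_derivatives m (n * y + - (n * b))) +
  (- n^-1 * (- n) ^+ m * softplus_derivatives m (- n * y + - (n * a)) +
   n^-1 * (- n) ^+ m * softplus_derivatives m (- n * y + - (n * b))).

Lemma smooth1_truncation n a b : smooth1 (truncation n a b).
Proof.
by apply: smooth1D; apply: smooth1D; apply: smooth1_affine; exact: smooth1_softplus.
Qed.

Lemma truncation0 n a b : truncation n a b 0 0 = 0.
Proof. by rewrite /truncation /= !expr0 !mulr0 !add0r; ring. Qed.

(** The truncation is g(y) - g(-y), where monotonicity and the Lipschitz constant 1 of softplus put
    both values of g in [0, b - a]. The difference is thus bounded by b - a with no factor 2, which
    the sharp constant requires. *)
Lemma truncation_bound n a b y : 0 < n -> a <= b -> `|truncation n a b 0 y| <= b - a.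
Proof.
move=> n0 ab; have g z : 0 <= n^-1 * (softplus (n * z + - (n * a)) - softplus (n * z
  + - (n * b))) <= b - a.
  have e : n * z + - (n * a) = n * z + - (n * b) + n * (b - a) by ring.
  have d0 : 0 <= n * (b - a) by rewrite mulr_ge0 ?subr_ge0 // ltW.
  apply/andP; split.
    rewrite mulr_ge0 ?invr_ge0 ?(ltW n0) // subr_ge0; apply: softplus_homo.
    by rewrite e lerDl.
  rewrite ler_pdivrMl // lerBlDl e; exact: softplus_lip.
have -> : truncation n a b 0 y =
  n^-1 * (softplus (n * y + - (n * a)) - softplus (n * y + - (n * b))) -
  n^-1 * (softplus (n * - y + - (n * a)) - softplus (n * - y + - (n * b))).
  by rewrite /truncation /= !expr0 !mulrN !mulNr; ring.
have /andP[h1 h2] := g y; have /andP[h3 h4] := g (- y).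
by rewrite ler_norml; apply/andP; split; lra.
Qed.

Lemma truncation1E n a b y : 0 < n -> truncation n a b 1 y =
  (sigmoid (n * (y - a)) - sigmoid (n * (y - b))) +
  (sigmoid (n * (- y - a)) - sigmoid (n * (- y - b))).
Proof.
move=> n0; rewrite /truncation /= !hornerX !expr1 !mulrN !mulNr !mulVf ?gt_eqF //.
rewrite !opprK !mul1r; congr (_ - _ + (_ - _)); by congr sigmoid; ring.
Qed.

Lemma truncation1_ge0 n a b y : 0 < n -> a <= b -> 0 <= truncation n a b 1 y.
Proof.
move=> n0 ab; rewrite truncation1E // addr_ge0 // subr_ge0; apply: sigmoid_homo.
all: by rewrite ler_pM2l //; lra.
Qed.

Lemma truncation1_le2 n a b y : 0 < n -> truncation n a b 1 y <= 2.
Proof.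
move=> n0; rewrite truncation1E //.
have := sigmoid_le1 (n * (y - a)); have := sigmoid_ge0 (n * (y - b)).
have := sigmoid_le1 (n * (- y - a)); have := sigmoid_ge0 (n * (- y - b)).
lra.
Qed.

Lemma truncation1_ge n a b tau y : 0 < n -> 0 < tau -> a <= b ->
  a + tau <= `|y| <= b - tau ->
  1 - 2 * (n * tau)^-1 <= truncation n a b 1 y.
Proof.
move=> n0 t0 ab; have nt : 0 < n * tau by exact: mulr_gt0.
have key z : a + tau <= z <= b - tau ->
    1 - 2 * (n * tau)^-1 <= sigmoid (n * (z - a)) - sigmoid (n * (z - b)).
  move=> /andP[h1 h2].
  have s1 : sigmoid (n * tau) <= sigmoid (n * (z - a)).
    by apply: sigmoid_homo; rewrite ler_pM2l //; lra.
  have s2 : sigmoid (n * (z - b)) <= sigmoid (- (n * tau)).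
    by apply: sigmoid_homo; rewrite -mulrN ler_pM2l //; lra.
  have := sigmoid_ge nt; have := @sigmoid_le (- (n * tau));
    rewrite oppr_lt0 opprK => /(_ nt).
  lra.
have pos z : 0 <= sigmoid (n * (z - a)) - sigmoid (n * (z - b)).
  by rewrite subr_ge0; apply: sigmoid_homo; rewrite ler_pM2l //; lra.
rewrite truncation1E //; have [y0|y0] := leP 0 y.
  by rewrite ger0_norm // => /key; have := pos (- y); lra.
by rewrite ltr0_norm // => /key; have := pos y; lra.
Qed.

End sigmoid.

Lemma smooth1_continuous (R : realType) (D : nat -> R -> R) m : smooth1 D ->
  continuous (D m).
Proof.
move=> sD x; apply: differentiable_continuous; apply/derivable1_diffP.
by have [] := sD m x.
Qed.

Lemma mul_exp_le (R : realType) (a b s : R) n : (0 < n)%N -> 0 <= a -> 0 <= b ->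
  a ^+ n <= s -> b ^+ n <= s -> a ^+ n.-1 * b <= s.
Proof.
case: n => // n _ a0 b0 an bn; have [ab|ba] := leP a b.
  apply: le_trans bn; rewrite exprSr ler_wpM2r //.
  by rewrite lerXn2r ?nnegrE.
by apply: le_trans an; rewrite exprSr ler_wpM2l ?exprn_ge0 // ltW.
Qed.

Lemma dotrV_cvg (R : realType) n (x : 'rV[R]_n) (y_ : nat -> 'rV[R]_n) (y : 'rV[R]_n) :
  (forall i, y_ j ord0 i @[j --> \oo] --> y ord0 i) ->
  dotrV x (y_ j) @[j --> \oo] --> dotrV x y.
Proof.
move=> cy; apply: cvg_sumr => i; apply: cvgM; first exact: cvg_cst.
exact: cy.
Qed.

Section energy.
Variables (R : realType) (N : nat) (F : 'rV[R]_N -> R) (hF : finsler_norm F).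
Variables (Omega : set 'rV[R]_N).
Hypotheses (N0 : (0 < N)%N) (mO : measurable Omega).
Variables (u : 'rV[R]_N -> R) (G : 'rV[R]_N -> 'rV[R]_N).
Hypotheses (mu_ : measurable_fun Omega u).
Hypotheses (mG : forall i, measurable_fun Omega (fun x => G x ord0 i)).
Variables (phi : nat -> 'rV[R]_N -> R) (S : 'rV[R]_N -> R).
Hypothesis tphi : forall j, test_function Omega (phi j).
Local Notation mu := (lebesgue_rV R N).
Hypothesis iS : mu.-integrable Omega (EFin \o S).
Hypothesis approx : \forall x \ae mu, Omega x ->
      [/\ phi j x @[j --> \oo] --> u x,
          forall i, partial i (phi j) x @[j --> \oo] --> G x ord0 i,
          `|G x| ^+ N <= S x &
          forall j, `|gradient (phi j) x| ^+ N <= S x].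
Variable f : 'rV[R]_N -> R.
Hypothesis hf : in_Lp Omega 1 f.
Hypothesis weak : forall psi, test_function Omega psi ->
      \int[mu]_(x in Omega) dotrV (anisotropic_flux F (G x)) (gradient psi x) =
      \int[mu]_(x in Omega) (f x * psi x).

Let if_ : mu.-integrable Omega (fun x => (`|f x|)%:E).
Proof.
have := @in_Lp_integrable R N Omega 1 f isT mO hf.
by apply: eq_integrable => // x _; rewrite expr1.
Qed.

(** The test functions are [D 0] of the approximants, whose gradients carry the factor [D 1]. The
    majorant S controls the flux term, and boundedness of [D 0] controls the right side with f in
    L^1. In the limit the flux meets its own gradient, and Euler's identity gives the power F^N. *)
Lemma weak_solution_limit (D : nat -> R -> R) (M0 M1 : R) :
  smooth1 D -> D 0%N 0 = 0 -> (forall y, `|D 0%N y| <= M0) ->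
    (forall y, `|D 1%N y| <= M1) ->
  mu.-integrable Omega (fun x => (f x * D 0%N (u x))%:E) /\
  (\int[mu]_(x in Omega) (D 1%N (u x) * F (G x) ^+ N)%:E =
   \int[mu]_(x in Omega) (f x * D 0%N (u x))%:E)%E.
Proof.
move=> sD D00 DM0 DM1; pose B := finsler_bound F.
have B0 : 0 <= B by exact: finsler_bound_ge0.
have M10 : 0 <= M1 by exact: le_trans (DM1 0).
have mD m : measurable_fun setT (D m).
  by apply: continuous_measurable_fun; exact: smooth1_continuous.
have mphi j s : measurable_fun Omega (partials s (phi j)).
  apply: measurable_funTS; apply: continuous_measurable_rV.
  exact: (@test_function_continuous _ _ _ _ (tphi j) s).
have mflux i : measurable_fun Omega (fun x => anisotropic_flux F (G x) ord0 i).
  exact: (measurable_comp_rV mO mG (measurable_flux hF i)).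
have mdot (h : 'rV[R]_N -> 'rV[R]_N) : (forall i,
  measurable_fun Omega (fun x => h x ord0 i)) ->
    measurable_fun Omega (fun x => dotrV (anisotropic_flux F (G x)) (h x)).
  by move=> mh; apply: measurable_sum => i; apply: measurable_funM.
have [iA cA] : mu.-integrable Omega (EFin \o (fun x =>
  D 1%N (u x) * dotrV (anisotropic_flux F (G x)) (G x))) /\
  (\int[mu]_(x in Omega) (D 1%N (phi j x) * dotrV (anisotropic_flux F (G x))
    (gradient (phi j) x))%:E)%E @[j --> \oo] -->
  (\int[mu]_(x in Omega) (D 1%N (u x) * dotrV (anisotropic_flux F (G x)) (G x))%:E)%E.
  apply: (@dominated_convergence_real _ _ _ mu Omega
    (fun j x => D 1%N (phi j x) * dotrV (anisotropic_flux F (G x)) (gradient (phi j) x)) _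
    (fun x => M1 * (B * B ^+ N.-1) * S x)) => //.
  - move=> j; apply: measurable_funM.
      by apply: (measurableT_comp (f := D 1%N)) => //; exact: (mphi j [::]).
    by apply: mdot => i; under eq_fun do rewrite mxE; exact: (mphi j [:: i]).
  - apply: measurable_funM; last exact: mdot.
    exact: (measurableT_comp (f := D 1%N)).
  - have := integrableZl mO (M1 * (B * B ^+ N.-1)) iS.
    by apply: eq_integrable => // x _ /=; rewrite -EFinM.
  - apply: filterS approx => x h Ox; have [c cG _ _] := h Ox.
    apply: cvgM.
      apply: (@continuous_cvg _ _ _ _ _ (fun j => phi j x) (D 1%N) (u x));
        [exact: smooth1_continuous|exact: c].
    by apply: dotrV_cvg => i; under eq_fun do rewrite mxE; exact: cG.
  - apply: filterS approx => x h Ox j; have [_ _ GS b1] := h Ox.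
    rewrite normrM -mulrA ler_pM //.
    apply: le_trans (flux_bound hF _ _) _; rewrite -mulrA ler_wpM2l //.
    apply: (@le_trans _ _ (B ^+ N.-1 * (`|G x| ^+ N.-1 * `|gradient (phi j) x|))).
      rewrite mulrA -exprMn ler_wpM2r // lerXn2r ?nnegrE ?mulr_ge0 ?(finsler_ge0 hF) //.
      exact: finsler_le hF _.
    by rewrite ler_wpM2l ?exprn_ge0 //; exact: mul_exp_le.
have [iC cC] : mu.-integrable Omega (EFin \o (fun x => f x * D 0%N (u x))) /\
  (\int[mu]_(x in Omega) (f x * D 0%N (phi j x))%:E)%E @[j --> \oo] -->
  (\int[mu]_(x in Omega) (f x * D 0%N (u x))%:E)%E.
  have [mf _] := hf.
  apply: (@dominated_convergence_real _ _ _ mu Omega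
    (fun j x => f x * D 0%N (phi j x)) _ (fun x => M0 * `|f x|)) => //.
  - move=> j; apply: measurable_funM => //.
    by apply: (measurableT_comp (f := D 0%N)) => //; exact: (mphi j [::]).
  - by apply: measurable_funM => //; exact: (measurableT_comp (f := D 0%N)).
  - have := integrableZl mO M0 if_.
    by apply: eq_integrable => // x _ /=; rewrite -EFinM.
  - apply: filterS approx => x h Ox; have [c _ _ _] := h Ox.
    apply: cvgM; first exact: cvg_cst.
    apply: (@continuous_cvg _ _ _ _ _ (fun j => phi j x) (D 0%N) (u x));
      [exact: smooth1_continuous|exact: c].
  - by apply: aeW => x _ j; rewrite normrM mulrC ler_wpM2r.
(* The weak equation equates real-valued integrals, hence [fine]; finiteness of both limits recovers
   the extended equality. *)
have eqj j : fine (\int[mu]_(x in Omega)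
    (D 1%N (phi j x) * dotrV (anisotropic_flux F (G x)) (gradient (phi j) x))%:E)%E =
    fine (\int[mu]_(x in Omega) (f x * D 0%N (phi j x))%:E)%E.
  have := weak (test_function_comp (m := 0%N) sD D00 (tphi j)).
  rewrite /Rintegral => <-; congr fine; apply: eq_integral => x _.
  by rewrite (gradient_comp _ _ sD (tphi j)) dotrVZr.
have E x : D 1%N (u x) * dotrV (anisotropic_flux F (G x)) (G x) =
  D 1%N (u x) * F (G x) ^+ N.
  by rewrite flux_euler.
split; first exact: iC.
have fA := integrable_fin_num mO iA; have fC := integrable_fin_num mO iC.
under eq_integral do rewrite -E.
rewrite -(fineK fA) -(fineK fC); congr EFin.
have cA' := cA; rewrite -[X in _ --> X](fineK fA) in cA'.
have cC' := cC; rewrite -[X in _ --> X](fineK fC) in cC'.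
have /fine_cvgP[_ cA2] := cA'; have /fine_cvgP[_ cC2] := cC'.
have eqf : fine \o (fun j =>
  \int[mu]_(x in Omega)
    (D 1%N (phi j x) * dotrV (anisotropic_flux F (G x)) (gradient (phi j) x))%:E)%E =
    fine \o (fun j => \int[mu]_(x in Omega) (f x * D 0%N (phi j x))%:E)%E.
  by apply/funext => j /=; exact: eqj.
rewrite eqf in cA2.
exact: (cvg_unique (@norm_hausdorff _ _) cA2 cC2).
Qed.

(** The truncation acts on the band enlarged by tau on each side, where its derivative is at least q
    on the original band and nonnegative elsewhere, while its size is at most b - a + 2 tau. *)
Lemma energy_estimate (a b M : R) : a <= b ->
  (\int[mu]_(x in Omega) (`|f x|)%:E = M%:E)%E ->
  (\int[mu]_(x in Omega `&` [set x | (a <= `|u x| <= b)%R]) (F (G x) ^+ N)%:E <= ((b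
    - a) * M)%:E)%E.
Proof.
move=> ab fM.
have M0 : 0 <= M by rewrite -lee_fin -fM; apply: integral_ge0 => x _; rewrite lee_fin.
set E := Omega `&` _.
have mFG : measurable_fun Omega (fun x => F (G x) ^+ N).
  apply: measurable_funX; apply: (measurable_comp_rV mO mG);
    apply: continuous_measurable_rV.
  exact: (finsler_continuous hF).
have mE : measurable E.
  have /(_ mO `[a, b]%classic (measurable_itv _)) :=
    measurableT_comp (@normr_measurable R setT) mu_.
  by congr (measurable (_ `&` _)); apply/seteqP; split => x /=; rewrite in_itv.
apply/lee_mul01Pr.
  by apply: integral_ge0 => x _; rewrite lee_fin exprn_ge0 ?(finsler_ge0 hF).
move=> q /andP[q0 q1]; apply/lee_addgt0Pr => eps eps0.
(* Chosen so that the excess 2 tau M is at most eps; M + 1 avoids dividing by 0. *)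
pose tau := eps / (2 * (M + 1)); have M1 : 0 < 2 * (M + 1) by lra.
have t0 : 0 < tau by exact: divr_gt0.
(* The slope for which 1 - 2 / (n tau), the lower bound of the derivative on the band, is exactly
   q. *)
pose n := 2 / ((1 - q) * tau).
have q1' : 0 < 1 - q by rewrite subr_gt0.
have n0 : 0 < n by rewrite divr_gt0 // mulr_gt0.
pose a1 := a - tau; pose b1 := b + tau.
have ab1 : a1 <= b1 by rewrite /a1 /b1; lra.
have qE : 1 - 2 * (n * tau)^-1 = q by rewrite /n; field; rewrite !gt_eqF.
have sT := smooth1_truncation n a1 b1.
have [||iI eqI] := weak_solution_limit (M0 := b1 - a1) (M1 := 2) sT (truncation0 n a1 b1).
- by move=> y; exact: truncation_bound.
- by move=> y; rewrite ger0_norm ?truncation1_ge0 // truncation1_le2.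
have [mf _] := hf.
have mT m : measurable_fun Omega (fun x => truncation n a1 b1 m (u x)).
  apply: (measurableT_comp (f := truncation n a1 b1 m)) => //.
  by apply: continuous_measurable_fun; exact: smooth1_continuous.
apply: (@le_trans _ _ (\int[mu]_(x in Omega) (truncation n a1 b1 1 (u x) * F (G x) ^+
  N)%:E)%E).
  rewrite -ge0_integralZl //; last 3 first.
  - by apply/measurable_EFinP; apply: measurable_funS mFG => //; exact: subIsetl.
  - by move=> x _; rewrite lee_fin exprn_ge0 ?(finsler_ge0 hF).
  - by rewrite lee_fin ltW.
  rewrite integral_mkcond [leRHS]integral_mkcond; apply: ge0_le_integral => //.
  - by move=> x _; rewrite patchE; case: ifPn => // _;
    rewrite -EFinM lee_fin mulr_ge0 ?(ltW q0) ?exprn_ge0 ?(finsler_ge0 hF).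
  - apply: (measurable_restrictT _ mE).1; apply/measurable_EFinP;
    apply: measurable_funM => //.
    by apply: measurable_funS mFG => //; exact: subIsetl.
  - by apply: (measurable_restrictT _ mO).1; apply/measurable_EFinP;
    exact: measurable_funM.
  move=> x _; rewrite !patchE; case: ifPn => xE; last first.
    by case: ifPn => // _; rewrite lee_fin mulr_ge0 ?exprn_ge0 ?(finsler_ge0 hF)
      ?truncation1_ge0.
  move: xE; rewrite inE => -[Ox /= ux]; rewrite mem_set // -EFinM lee_fin.
  rewrite ler_wpM2r ?exprn_ge0 ?(finsler_ge0 hF) // -qE; apply: truncation1_ge => //.
  by rewrite /a1 /b1 subrK addrK.
rewrite eqI; apply: (@le_trans _ _ (\int[mu]_(x in Omega) ((b1 - a1)%:E * (`|f
  x|)%:E))%E).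
  have mI : measurable_fun Omega (fun x => (b1 - a1) * `|f x|).
    by apply: measurable_funM => //; exact: measurableT_comp.
  under [leRHS]eq_integral do rewrite -EFinM.
  apply: le_integral => //.
  - have := integrableZl mO (b1 - a1) if_.
    by apply: eq_integrable => // x _ /=; rewrite -EFinM.
  move=> x _; rewrite lee_fin; apply: le_trans (ler_norm _) _.
  by rewrite normrM mulrC ler_wpM2r //; exact: truncation_bound.
rewrite ge0_integralZl //; last 2 first.
- by apply/measurable_EFinP; exact: measurableT_comp.
- by rewrite lee_fin subr_ge0.
rewrite fM -EFinM -EFinD lee_fin.
have -> : (b1 - a1) * M = (b - a) * M + 2 * tau * M by rewrite /a1 /b1; ring.
rewrite lerD2l /tau.
have -> : 2 * (eps / (2 * (M + 1))) * M = eps * (M / (M + 1)) by field; lra.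
by rewrite ler_piMr ?(ltW eps0) // ler_pdivrMr ?mul1r; lra.
Qed.

End energy.

(** * Exponential decay and conclusion *)

Lemma integral_expR (R : realType) (al w : R) : 0 <= w ->
  (\int[lebesgue_measure]_(s in `[0%R, w[) (al * expR (al * s))%:E =
   (expR (al * w) - 1)%:E)%E.
Proof.
move=> w0; have [->|wn0] := eqVneq w 0.
  by rewrite set_itvco0 ?integral_set0 ?mulr0 ?expR0 ?subrr.
have {wn0}w0 : 0 < w by rewrite lt0r wn0.
pose E (s : R) := expR (al * s).
have dE (s : R) : is_derive s 1 E (al * expR (al * s)).
  have d1 : is_derive s 1 (fun x : R => al * x) al.
    have := is_deriveZ al (is_derive_id s 1).
    by move=> dH; apply: is_derive_eq dH _; rewrite -[_ *: _]/(_ * _) mulr1.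
  have := @is_derive1_comp _ (@expR R) (fun x =>
    al * x) _ _ _ (is_derive_expR (al * s)) d1.
  by move=> dH; apply: is_derive_eq dH _; rewrite mulrC.
have cE : continuous E.
  move=> s; apply: differentiable_continuous; apply/derivable1_diffP.
  exact: ex_derive.
have cf : continuous (fun s : R => al * expR (al * s)).
  by move=> s; apply: cvgM; [exact: cvg_cst|exact: cE].
rewrite integral_itv_bndo_bndc; last first.
  by apply/measurable_EFinP; apply: measurable_funTS; exact: continuous_measurable_fun.
rewrite (@continuous_FTC2 _ _ E) //.
- by rewrite /E mulr0 expR0.
- exact: continuous_subspaceT.
- split=> [s _||]; first exact: ex_derive.
  + by apply: cvg_at_right_filter; exact: cE.
  + by apply: cvg_at_left_filter; exact: cE.
- by move=> s _; rewrite derive1E; exact: derive_val.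
Qed.

(** As exp(al w) - 1 is the integral of al exp(al s) over [0, w[, the layer-cake formula and the
    tail bound give at most V al / (c - al); the constant 1 adds V, and the total is V c / (c -
    al). *)
Lemma exp_integral_of_decay d (T : measurableType d) (R : realType)
    (m : {sigma_finite_measure set T -> \bar R}) (Omega : set T) (u : T ->
      R) (V c al : R) :
  measurable Omega -> measurable_fun Omega u -> 0 <= al -> al < c ->
  (m Omega = V%:E)%E ->
  (forall t, 0 <= t -> (m (Omega `&` [set x | t < `|u x|]%R) <= (V * expR (- c *
    t))%:E)%E) ->
  (\int[m]_(x in Omega) (expR (al * `|u x|))%:E <= (c / (c - al) * V)%:E)%E.
Proof.
move=> mO mu_ al0 alc mV dec; have ca : 0 < c - al by rewrite subr_gt0.
have V0 : 0 <= V by rewrite -lee_fin -mV.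
have mnu : measurable_fun Omega (fun x => `|u x|) by exact: measurableT_comp.
pose w := (fun x => `|u x|) \_ Omega.
have mw : measurable_fun setT w by exact: (measurable_restrictT _ mO).1.
have w0 x : 0 <= w x by rewrite /w patchE; case: ifPn.
have mrho : measurable_fun [set: R] (fun s => al * expR (al * s)).
  apply: measurable_funM => //; apply: measurableT_comp => //; exact: measurable_funM.
have rho0 s : 0 <= al * expR (al * s) by rewrite mulr_ge0 // expR_ge0.
have LC := @layer_cake _ _ R m (cst 0) w _ (measurable_cst _) mw mrho rho0;
  rewrite /= in LC.
have me : measurable_fun Omega (fun x => expR (al * `|u x|) - 1).
  apply: measurable_funB => //; apply: measurableT_comp => //; exact: measurable_funM.
have split_ : (\int[m]_(x in Omega) (expR (al * `|u x|))%:E =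
   \int[m]_(x in Omega) (expR (al * `|u x|) - 1)%:E + V%:E)%E.
  have -> : (V%:E = \int[m]_(x in Omega) (1 : R)%:E)%E by rewrite integral_cst // mul1e.
  rewrite -ge0_integralD //.
  - by apply: eq_integral => x _; rewrite -EFinD subrK.
  - by move=> x _; rewrite lee_fin subr_ge0 -expR0 ler_expR mulr_ge0.
  - exact/measurable_EFinP.
rewrite split_.
have -> : (\int[m]_(x in Omega) (expR (al * `|u x|) - 1)%:E =
   \int[m]_x \int[lebesgue_measure]_(s in `[0%R, w x[) (al * expR (al * s))%:E)%E.
  rewrite integral_mkcond; apply: eq_integral => x _.
  rewrite integral_expR // patchE /w patchE; case: ifPn => // _.
  by rewrite mulr0 expR0 subrr.
rewrite LC.
have -> : ((c / (c - al) * V)%:E = (al / (c - al) * V)%:E + V%:E)%E.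
  by rewrite -EFinD; congr EFin; field; rewrite gt_eqF.
rewrite leeD2r //.
(* The factor 1 is the total mass of the exponential density of rate c - al, with which the tail
   integrand is compared pointwise. *)
rewrite [leRHS](_ : _ = ((al / (c - al) * V)%:E * 1)%E); last by rewrite mule1.
rewrite -(integral_exponential_pdf ca) -ge0_integralZl //; last 3 first.
- by apply/measurable_EFinP; exact: measurable_exponential_pdf.
- by move=> s _; rewrite lee_fin exponential_pdf_ge0 // ltW.
- by rewrite lee_fin mulr_ge0 // divr_ge0 // ltW.
apply: ge0_le_integral => //.
- by move=> s _; rewrite mule_ge0 ?lee_fin.
- exact: measurable_layer_outer.
- apply: emeasurable_funM => //; apply/measurable_EFinP;
  exact: measurable_exponential_pdf.
move=> s _; have [s0|s0] := ltP s 0.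
  rewrite lt0_exponential_pdf // mule0 (_ : mkset _ = set0) ?measure0 ?mule0 //.
  by apply/seteqP; split => x //= /andP[]; rewrite leNgt s0.
rewrite exponential_pdfE //.
apply: (@le_trans _ _ ((al * expR (al * s))%:E * (V * expR (- c * s))%:E)%E).
  apply: lee_wpmul2l; first by rewrite lee_fin.
  apply: le_trans (dec s s0);
    rewrite [leLHS](_ : _ = m (Omega `&` [set x | s < `|u x|])) //.
  congr (m _); apply/seteqP; split => x /=.
rewrite /w patchE; case: ifPn => [|_ h]; first by rewrite inE.
    by move: (le_lt_trans s0 h); rewrite ltxx.
  by move=> [Ox h]; rewrite /w patchE mem_set.
rewrite -!EFinM lee_fin.
have -> : - (c - al) * s = al * s + - c * s by ring.
rewrite expRD le_eqVlt; apply/orP; left; apply/eqP; field.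
by rewrite gt_eqF.
Qed.

(** Iterating the step n times with width t / n gives (1 + y/n)^n m(t) <= V for y = c t. The
    explicit bound (1 + y/n)^n >= exp(y - y^2/n) replaces the limit in n. *)
Lemma decay_of_step (R : realType) (m : R -> R) (c V t : R) : 0 < c ->
  0 <= m t -> m 0 <= V ->
  (forall s e, 0 <= s -> 0 < e -> (1 + c * e) * m (s + e) <= m s) ->
  0 <= t -> m t <= V * expR (- c * t).
Proof.
move=> c0 mt0 mV step t0.
have [tE|tn0] := eqVneq t 0; first by rewrite tE mulr0 expR0 mulr1.
have {tn0}t0 : 0 < t by rewrite lt0r tn0.
have iter_ e k : 0 < e -> (1 + c * e) ^+ k * m (k%:R * e) <= V.
  move=> e0; have p0 : 0 < 1 + c * e by rewrite addr_gt0 // mulr_gt0.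
  elim: k => [|k IH]; first by rewrite expr0 mul1r mul0r.
  apply: le_trans IH; rewrite exprSr -mulrA ler_pM2l ?exprn_gt0 //.
  have -> : k.+1%:R * e = k%:R * e + e by rewrite -[k.+1%:R]natr1; ring.
  by apply: step => //; rewrite mulr_ge0 // ltW.
pose y := c * t; have y0 : 0 < y by exact: mulr_gt0.
pose C := m t * expR y; have C0 : 0 <= C by rewrite mulr_ge0 ?expR_ge0.
suff CV : C <= V.
  by rewrite mulNr expRN ler_pdivlMr ?expR_gt0.
apply/ler_addgt0Pr => e e0.
(* Large enough that the loss C y^2 / n is at most e. *)
pose n := (Num.trunc (C * y ^+ 2 / e)).+1.
have n0 : 0 < n%:R :> R by rewrite ltr0n.
have nE : C * y ^+ 2 / n%:R <= e.
  rewrite ler_pdivrMr // [e * _]mulrC -ler_pdivrMr //; apply: ltW; exact: truncnS_gt.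
have h := iter_ (t / n%:R) n (divr_gt0 t0 n0).
rewrite [n%:R * _]mulrC divfK ?gt_eqF // in h.
(* For x = y/n, e^(-z) >= 1 - z at z = x/(1+x) gives 1 + x >= exp(x/(1+x)), and n x/(1+x) = y/(1 +
   y/n) is at least y - y^2/n. *)
have b1 : expR (y - y ^+ 2 / n%:R) <= (1 + c * (t / n%:R)) ^+ n.
  have x0 : 0 < y / n%:R by rewrite divr_gt0.
  have -> : c * (t / n%:R) = y / n%:R by rewrite mulrA.
  apply: (@le_trans _ _ (expR (n%:R * (y / n%:R / (1 + y / n%:R))))).
    rewrite ler_expR.
    have -> : n%:R * (y / n%:R / (1 + y / n%:R)) = y / (1 + y / n%:R).
      by field; rewrite !gt_eqF // addr_gt0.
    rewrite ler_pdivlMr ?addr_gt0 //.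
    have -> : (y - y ^+ 2 / n%:R) * (1 + y / n%:R) = y - y * (y / n%:R) ^+ 2.
      by field; rewrite gt_eqF.
    by rewrite lerBlDr lerDl mulr_ge0 ?sqr_ge0 // ltW.
  rewrite expRM_natl lerXn2r ?nnegrE ?expR_ge0 ?addr_ge0 ?(ltW x0) //.
  have p0 : 0 < 1 + y / n%:R by rewrite addr_gt0.
  rewrite -[leRHS]invrK -lef_pV2 ?posrE ?invr_gt0 ?expR_gt0 // invrK -expRN.
  apply: le_trans (expR_ge1Dx _); rewrite le_eqVlt; apply/orP; left; apply/eqP.
  by field; rewrite !gt_eqF // addr_gt0.
have b2 : C - C * y ^+ 2 / n%:R <= m t * expR (y - y ^+ 2 / n%:R).
  rewrite expRD mulrA -/C -mulrA -[X in X - _]mulr1 -mulrBr ler_wpM2l //.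
  exact: expR_ge1Dx.
have b3 : m t * expR (y - y ^+ 2 / n%:R) <= V.
  by apply: le_trans h; rewrite mulrC ler_wpM2r.
by move: b2 b3 nE; lra.
Qed.

(** The tangent to g^(n+1) at b gives (n+1) b^n g <= g^(n+1) + n b^(n+1), which is then integrated
    over E. The parameter b stays free in order to be optimized later. *)
Lemma integral_young d (T : measurableType d) (R : realType)
    (mu : {measure set T -> \bar R}) (E : set T) (g : T -> R) n (b X Y m : R) :
  measurable E -> measurable_fun E g -> (forall x, 0 <= g x) -> 0 <= b ->
  (X%:E <= \int[mu]_(x in E) (g x)%:E)%E ->
  (\int[mu]_(x in E) (g x ^+ n.+1)%:E <= Y%:E)%E -> (mu E = m%:E)%E ->
  n.+1%:R * b ^+ n * X <= Y + n%:R * b ^+ n.+1 * m.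
Proof.
move=> mE mg g0 b0 hX hY hm.
have k0 : 0 <= n.+1%:R * b ^+ n by rewrite mulr_ge0 // exprn_ge0.
have k1 : 0 <= n%:R * b ^+ n.+1 by rewrite mulr_ge0 // exprn_ge0.
have mgn : measurable_fun E (fun x => (g x ^+ n.+1)%:E).
  by apply/measurable_EFinP; exact: measurable_funX.
have mg' : measurable_fun E (fun x => (g x)%:E) by apply/measurable_EFinP.
rewrite -lee_fin EFinM EFinD; apply: le_trans (lee_wpmul2l _ hX) _;
  first by rewrite lee_fin.
rewrite -ge0_integralZl //.
apply: (@le_trans _ _ (\int[mu]_(x in E) ((g x ^+ n.+1)%:E + (n%:R * b ^+ n.+1)%:E))%E).
  apply: ge0_le_integral => //.
  - by move=> x _; rewrite -EFinM lee_fin mulr_ge0.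
  - by apply: emeasurable_funM.
  - by apply: emeasurable_funD.
  move=> x _; rewrite -EFinM -EFinD lee_fin.
  have := pow_tangent n (g0 x) b0; rewrite mulrBr [b ^+ n.+1]exprSr -[n.+1%:R]natr1.
  lra.
rewrite ge0_integralD //.
- by rewrite integral_cst // hm EFinM leeD2r.
- by move=> x _; rewrite lee_fin exprn_ge0.
by move=> x _; rewrite lee_fin.
Qed.

(* b = B / rho with B = (n+1) kap / c is the equality case of Young's inequality. *)
Lemma decay_algebra (R : realType) n (kap c M rho e m : R) : (0 < n)%N ->
  0 < kap -> 0 < c -> 0 < M -> 0 < rho -> 0 < e -> c ^+ n * M = (n.+1%:R * kap) ^+ n.+1 ->
  (forall b, 0 <= b -> n.+1%:R * b ^+ n * (n.+1%:R * rho ^+ n * kap * e) <= e * M +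
    n%:R * b ^+ n.+1 * m) ->
  c * e * rho ^+ n.+1 <= m.
Proof.
move=> n0 kap0 c0 M0 rho0 e0 cM H.
pose B := n.+1%:R * kap / c.
have B0 : 0 < B by rewrite divr_gt0 // mulr_gt0 // ltr0n.
have nk0 : 0 < n.+1%:R * kap by rewrite mulr_gt0 // ltr0n.
have BM : B ^+ n * (n.+1%:R * kap) = M.
  rewrite /B expr_div_n mulrAC -exprSr -cM mulrAC divff ?mul1r // gt_eqF // exprn_gt0 //.
have := H (B / rho) (ltW (divr_gt0 B0 rho0)).
have -> : n.+1%:R * (B / rho) ^+ n * (n.+1%:R * rho ^+ n * kap * e) = n.+1%:R * (e * M).
  have : rho ^+ n != 0 by rewrite expf_neq0 // gt_eqF.
  by rewrite -BM expr_div_n; move: (rho ^+ n) (B ^+ n) (n.+1%:R) => rn Bn k rn0; field.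
rewrite -[n.+1%:R]natr1 mulrDl mul1r => H2.
(* One of the n + 1 copies of e M is absorbed by the energy term; the remaining factor n is
   cancelled next. *)
have H3 : n%:R * (e * M) <= n%:R * ((B / rho) ^+ n.+1 * m) by move: H2; lra.
rewrite ler_pM2l ?ltr0n // expr_div_n in H3.
have r0 : 0 < rho ^+ n.+1 by rewrite exprn_gt0.
have Bn0 : 0 < B ^+ n.+1 by rewrite exprn_gt0.
have -> : c * e * rho ^+ n.+1 = e * M * rho ^+ n.+1 / B ^+ n.+1.
  have -> : c = n.+1%:R * kap / B.
    by rewrite /B invfM invrK mulrA mulfV ?mul1r // gt_eqF.
  have : B ^+ n != 0 by rewrite expf_neq0 // gt_eqF.
  rewrite -BM [B ^+ n.+1]exprSr; move: (B ^+ n) (rho ^+ n.+1) => Bn rn Bn0'; field.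
  by rewrite Bn0' gt_eqF.
rewrite ler_pdivrMr //.
have := ler_wpM2r (ltW r0) H3.
have -> : B ^+ n.+1 / rho ^+ n.+1 * m * rho ^+ n.+1 = m * B ^+ n.+1 by field;
  rewrite gt_eqF.
by [].
Qed.

(** On the open band s < |u| < s + e the isoperimetric lower bound and the energy upper bound force
    a measure of at least c e m(s+e). The band and {|u| > s+e} are disjoint parts of {|u| > s},
    which is the step inequality. The relation between c, M and kap is equality in Young's
    inequality. *)
Lemma superlevel_decay (R : realType) n (F : 'rV[R]_n.+1 -> R) (Omega : set 'rV[R]_n.+1)
    (r : R) (f u : 'rV[R]_n.+1 -> R) (kap c M : R) :
  (0 < n)%N -> finsler_norm F -> measurable Omega ->
  (forall x, Omega x -> forall i, `|x ord0 i| <= r) ->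
  in_Lp Omega 1 f -> weak_solution F Omega f u ->
  0 < kap ->
  ((kap ^+ n.+1)%:E <= lebesgue_rV R n.+1 [set x | support_fun F x <= 1]%R)%E ->
  0 < M -> (\int[lebesgue_rV R n.+1]_(x in Omega) (`|f x|)%:E = M%:E)%E ->
  0 < c -> c ^+ n * M = (n.+1%:R * kap) ^+ n.+1 ->
  forall t, 0 <= t ->
  (lebesgue_rV R n.+1 (Omega `&` [set x | t < `|u x|]%R) <=
   (fine (lebesgue_rV R n.+1 Omega) * expR (- c * t))%:E)%E.
Proof.
move=> n0 hF mO Or hf [G [sob weak]] kap0 kapK M0 fM c0 cM t t0.
have [phi [S [tphi iS approx]]] := sobolev_approx (ltn0Sn n) mO sob.
have [[[mu_ _] GL _] _] := sob.
have mG i : measurable_fun Omega (fun x => G x ord0 i) by case: (GL i).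
pose mu := lebesgue_rV R n.+1; rewrite -/mu.
have Ofin : (mu Omega < +oo)%E by exact: domain_finite Or.
have mnu : measurable_fun Omega (fun x => `|u x|) by exact: measurableT_comp.
have mlev s : measurable (Omega `&` [set x | s < `|u x|]).
  exact: (@measurable_fun_ltr _ _ R Omega (cst s) (fun x =>
    `|u x|) (measurable_cst _) mnu).
have fin (A : set 'rV[R]_n.+1) : measurable A -> A `<=` Omega -> mu A \is a fin_num.
  move=> mA AO; rewrite ge0_fin_numE ?measure_ge0 //; apply: le_lt_trans Ofin.
  by apply: le_measure; rewrite ?inE.
have finl s : mu (Omega `&` [set x | s < `|u x|]) \is a fin_num.
  by apply: fin => //; exact: subIsetl.
pose m s := fine (mu (Omega `&` [set x | s < `|u x|])).
have mE s : mu (Omega `&` [set x | s < `|u x|]) = (m s)%:E by rewrite fineK.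
have m0 s : 0 <= m s by rewrite fine_ge0 ?measure_ge0.
have fG0 x : 0 <= F (G x) by exact: finsler_ge0 hF _.
have mFG : measurable_fun Omega (fun x => F (G x)).
  apply: (measurable_comp_rV mO mG); apply: continuous_measurable_rV.
  exact: (finsler_continuous hF).
rewrite mE lee_fin; apply: decay_of_step => //.
  rewrite -lee_fin -mE fineK ?ge0_fin_numE ?measure_ge0 //.
  by apply: le_measure; rewrite ?inE //; exact: subIsetl.
(* A null superlevel set makes the step trivial; otherwise it has a positive radius rho, as the
   isoperimetric inequality demands. *)
move=> s e s0 e0; have [ms|] := eqVneq (m (s + e)) 0; first by rewrite ms mulr0.
rewrite neq_lt ltNge m0 /= => ms.
have [rho rho0 rhoE] := @exists_root R n.+1 _ isT ms.
have se : s < s + e by rewrite ltrDl.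
have X := isoperimetric_sobolev hF (ltn0Sn n) mO Or mu_ mG tphi iS approx s0 se rho0
  kap0 kapK.
have Y := energy_estimate hF (ltn0Sn n) mO mu_ mG tphi iS approx hf weak (ltW se) fM.
have sE : s + e - s = e by rewrite addrC addKr.
rewrite sE in X Y.
set E := Omega `&` [set x | s < `|u x| < s + e] in X.
have mE' : measurable E.
  have /(_ mO `]s, s + e[%classic (measurable_itv _)) :=
    measurableT_comp (@normr_measurable R setT) mu_.
  by congr (measurable (_ `&` _)); apply/seteqP; split => x /=; rewrite in_itv.
have mclosed : measurable (Omega `&` [set x | s <= `|u x| <= s + e]).
  have /(_ mO `[s, s + e]%classic (measurable_itv _)) :=
    measurableT_comp (@normr_measurable R setT) mu_.
  by congr (measurable (_ `&` _)); apply/seteqP; split => x /=; rewrite in_itv.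
have EO : E `<=` Omega by exact: subIsetl.
have EE := fineK (fin E mE' EO).
(* The energy bound on the closed band is restricted to the open one, so that both estimates concern
   the same set E. *)
have Y' : (\int[mu]_(x in E) (F (G x) ^+ n.+1)%:E <= (e * M)%:E)%E.
  apply: le_trans Y; apply: ge0_subset_integral => //.
  - apply/measurable_EFinP; apply: measurable_funX; apply: measurable_funS mFG => //.
  - by move=> x _; rewrite lee_fin exprn_ge0.
  - by move=> x [Ox /= /andP[h1 h2]]; split => //=; rewrite !ltW.
have X' : ((n.+1%:R * rho ^+ n * kap * e)%:E <= \int[mu]_(x in E) (F (G x))%:E)%E.
  by apply: X; rewrite rhoE -mE.
have Em : c * e * rho ^+ n.+1 <= fine (mu E).
  apply: (decay_algebra n0 kap0 c0 M0 rho0 e0 cM) => b b0.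
  apply: (integral_young mE' (measurable_funS mO EO mFG) fG0 b0 X' Y').
  by rewrite EE.
rewrite rhoE in Em; rewrite mulrDl mul1r.
apply: (@le_trans _ _ (m (s + e) + fine (mu E))); first by rewrite lerD2l.
rewrite -lee_fin EFinD EE -!mE -measureU //.
- apply: le_measure; rewrite ?inE //; first exact: measurableU.
  move=> x [[Ox /= h]|[Ox /= /andP[h1 h2]]]; split => //=.
  by apply: lt_trans h; rewrite ltrDl.
- apply/seteqP; split => x //= -[[_ h1] [_ /andP[_ h2]]].
  by move: (lt_trans h1 h2); rewrite ltxx.
Qed.

Theorem theorem1p1 (R : realType) (N : nat) (hN : (2 <= N)%N)
  (F : 'rV[R]_N -> R) (hF : finsler_norm F)
  (Omega : set 'rV[R]_N) (hOmega : bounded_domain Omega)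
  (f : 'rV[R]_N -> R) (hf : in_Lp Omega 1 f)
  (u : 'rV[R]_N -> R) (hu : weak_solution F Omega f u)
  (delta : R) (hdelta0 : 0 < delta) (hdelta : delta < beta_N F) :
  (\int[lebesgue_rV R N]_(x in Omega)
     (expR ((beta_N F - delta) * `|u x|
            / fine (Lp_norm Omega 1 f) `^ (N%:R - 1)^-1))%:E
   <= (beta_N F / delta)%:E * lebesgue_rV R N Omega)%E.
Proof.
case: N hN F hF Omega hOmega f hf u hu hdelta =>
  [//|n] n0 F hF Omega hOmega f hf u hu hdelta.
have {}n0 : (0 < n)%N by [].
have [_ oO _ bO] := hOmega; have mO := open_measurable_rV oO.
have [r Or] : exists r : R, forall x, Omega x -> forall i, `|x ord0 i| <= r.
  have [q [_ qO]] := bO; exists (`|q| + 1) => x Ox i;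
    apply: le_trans (coor_le_norm _ _) _.
  by apply: qO Ox; rewrite (le_lt_trans (ler_norm q)) // ltrDl.
have Ofin : (lebesgue_rV R n.+1 Omega < +oo)%E := domain_finite mO Or.
have OE : lebesgue_rV R n.+1 Omega = (fine (lebesgue_rV R n.+1 Omega))%:E.
  by rewrite fineK // ge0_fin_numE.
have nE : n.+1%:R - 1 = n%:R :> R by rewrite -natr1 addrK.
have nn0 : n%:R != 0 :> R by rewrite pnatr_eq0 -lt0n.
have root_exp (x : R) : 0 <= x -> (x `^ n%:R^-1) ^+ n = x.
  by move=> x0; rewrite -powR_mulrn ?powR_ge0 // -powRrM mulVf // powRr1.
have b0 := lt_trans hdelta0 hdelta.
pose k := wulff_volume F.
(* As fine +oo = 0, the volume of the polar ball is finite and nonzero. *)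
have k0 : 0 < k.
  rewrite lt0r fine_ge0 ?measure_ge0 // andbT; apply: contraTneq b0 => kE.
  by rewrite /beta_N -/k kE nE powR0 ?mulr0 ?ltxx // invr_neq0.
have kK : (k%:E = lebesgue_rV R n.+1 [set x | support_fun F x <= 1]%R)%E.
  rewrite /k /wulff_volume; move: k0; rewrite /k /wulff_volume.
  by case: (lebesgue_rV R n.+1 _) (measure_ge0 (lebesgue_rV R n.+1) [set x |
    support_fun F x <= 1]) => //= _; rewrite ltxx.
(* Raising to the power N - 1 = n clears the roots and matches the relation required of c. *)
have bn : beta_N F ^+ n = n.+1%:R ^+ n.+1 * k.
  rewrite /beta_N nE exprMn root_exp ?(ltW k0) //; congr (_ * _).
  by rewrite powRrM root_exp ?powR_ge0 // powR_mulrn.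
have bd : 1 <= beta_N F / delta by rewrite ler_pdivlMr // mul1r ltW.
have fL := @integral_Lp_norm R n.+1 Omega 1 f isT mO.
set M := fine _; have M0 : 0 <= M by rewrite fine_ge0 // Lnorm_ge0.
have fM : (\int[lebesgue_rV R n.+1]_(x in Omega) (`|f x|)%:E = M%:E)%E.
  transitivity (\int[lebesgue_rV R n.+1]_(x in Omega) (`|f x| ^+ 1)%:E)%E.
    by apply: eq_integral => x _; rewrite expr1.
  rewrite fL poweRe1 ?Lnorm_ge0 // /M fineK //.
  by rewrite ge0_fin_numE ?Lnorm_ge0 //; case: hf.
rewrite nE; have [ME|Mn0] := eqVneq M 0.
  (* Dividing by 0 gives 0: the exponent vanishes. *)
  rewrite ME powR0 ?invr_neq0 // invr0.
  under eq_integral do rewrite mulr0 expR0.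
  rewrite integral_cst // mul1e [leLHS]OE [X in (_ * X)%E]OE -EFinM lee_fin ler_peMl
    // fine_ge0 ?measure_ge0 //.
have {Mn0}M0 : 0 < M by rewrite lt0r Mn0.
pose q := M `^ n%:R^-1; have q0 : 0 < q by rewrite powR_gt0.
pose c := beta_N F / q; have c0 : 0 < c by exact: divr_gt0.
pose al := (beta_N F - delta) / q.
have alc : al < c by rewrite ltr_pM2r ?invr_gt0 // gtrBl.
have al0 : 0 <= al by rewrite divr_ge0 ?subr_ge0 // ltW.
have [kap kap0 kapE] := @exists_root R n.+1 k isT k0.
have cM : c ^+ n * M = (n.+1%:R * kap) ^+ n.+1.
  rewrite /c expr_div_n root_exp ?(ltW M0) // divfK ?gt_eqF //.
  by rewrite bn exprMn kapE.
have [_ [[[mu_ _] _ _] _] _] : exists2 G, sobolev1_0 Omega n.+1%:R u G & True.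
  by case: hu => G [h _]; exists G.
have dec := superlevel_decay n0 hF mO Or hf hu kap0 _ M0 fM c0 cM.
have := exp_integral_of_decay mO mu_ al0 alc OE (dec _).
rewrite OE -EFinM.
(* The common divisor q cancels, so the norm of f disappears from the constant. *)
have -> : c / (c - al) = beta_N F / delta.
  by rewrite /c /al; field; rewrite !gt_eqF //; lra.
have -> : (\int[lebesgue_rV R n.+1]_(x in Omega) (expR (al * `|u x|))%:E =
   \int[lebesgue_rV R n.+1]_(x in Omega) (expR ((beta_N F - delta) * `|u x| / q))%:E)%E.
  by apply: eq_integral => x _; rewrite /al mulrAC.
by apply; rewrite kapE kK.
Qed.
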